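(* Let $\lambda>1$, $L=\ln\lambda$, $\alpha$ Diophantine. For any $\Gamma$ with $L<\Gamma\le 2L$, for all sufficiently large $|n|$, $$\ln\int_0^1\sum_s|\phi_{\theta;s}(0)\phi_{\theta;s}(n)|\,d\theta\ge -\Gamma|n|.$$
   Context: For $\theta\in\mathbb{R}$, the almost Mathieu operator $H_\theta$ acts on $u\in\ell^2(\mathbb{Z})$ by $(H_\theta u)(m)=u(m+1)+u(m-1)+2\lambda\cos(2\pi(\theta+m\alpha))u(m)$. The frequency $\alpha$ is Diophantine if there exist $\kappa>0,\tau>0$ such that $\|k\alpha\|_{\mathbb{R}/\mathbb{Z}}\ge \tau/|k|^{\kappa}$ for all integers $k\neq 0$. For almost every $\theta$, $H_\theta$ has pure point spectrum and $\{\phi_{\theta;s}\}_s$ denotes a complete orthonormal basis of eigenfunctions of $H_\theta$. *)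

(* Defs.v *)
From HB Require Import structures.
From mathcomp Require Import all_boot all_order all_algebra.
From mathcomp Require Import all_classical all_reals all_analysis.
From mathcomp Require Import complex.
Set Implicit Arguments. Unset Strict Implicit. Unset Printing Implicit Defensive.
Import Order.TTheory GRing.Theory Num.Theory.
Import numFieldNormedType.Exports.
Local Open Scope ring_scope.
Local Open Scope classical_set_scope.
Local Open Scope complex_scope.

Section AMO.
Variable R : realType.

Definition distZ (x : R) : R :=
  Num.min (x - (Num.floor x)%:~R) ((Num.floor x + 1)%:~R - x).

Definition diophantine (alpha : R) : Prop :=
  exists kappa tau : R, 0 < kappa /\ 0 < tau /\
    forall k : int, k != 0 ->
      tau / ((`|k|%:~R : R) `^ kappa) <= distZ (k%:~R * alpha).

Definition psumZ (f : int -> R[i]) (N : nat) : R[i] :=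
  \sum_(k < (2 * N).+1) f (k%:Z - N%:Z).

Definition sqmod (z : R[i]) : R := (complex.Re z) ^+ 2 + (complex.Im z) ^+ 2.

Definition l2Z (u : int -> R[i]) : Prop :=
  exists M : R, forall N : nat, \sum_(k < (2 * N).+1) sqmod (u (k%:Z - N%:Z)) <= M.

Definition inner_is (u v : int -> R[i]) (c : R[i]) : Prop :=
  ((fun N => complex.Re (psumZ (fun m => u m * conjc (v m)) N)) @ \oo
     --> complex.Re c) /\
  ((fun N => complex.Im (psumZ (fun m => u m * conjc (v m)) N)) @ \oo
     --> complex.Im c).

Definition amo (lam alpha theta : R) (u : int -> R[i]) (m : int) : R[i] :=
  u (m + 1) + u (m - 1)
  + (2 * lam * cos (2 * pi * (theta + m%:~R * alpha)))%:C * u m.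

Definition eigen_onb (lam alpha theta : R) (phi : nat -> int -> R[i]) : Prop :=
  [/\ forall s t : nat, inner_is (phi s) (phi t) (if s == t then 1 else 0),
      forall u : int -> R[i], l2Z u -> (forall s, inner_is u (phi s) 0) ->
        u = (fun _ => 0) &
      forall s : nat, exists E : R, forall m : int,
        amo lam alpha theta (phi s) m = E%:C * phi s m].

Definition corr_sum (Phi : R -> nat -> int -> R[i]) (n : int) (theta : R)
  : \bar R :=
  (\sum_(0 <= s <oo) (Num.sqrt (sqmod (Phi theta s 0 * Phi theta s n)))%:E)%E.

End AMO.

(* Main.v *)
Require Import Defs.
From HB Require Import structures.
From mathcomp Require Import all_boot all_order all_algebra.
From mathcomp Require Import all_classical all_reals all_analysis.
From mathcomp Require Import complex.
From mathcomp Require Import measurable_realfun.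
From mathcomp Require Import ring lra zify.
Set Implicit Arguments. Unset Strict Implicit. Unset Printing Implicit Defensive.
Import Order.TTheory GRing.Theory Num.Theory.
Import numFieldNormedType.Exports.
Local Open Scope ring_scope.
Local Open Scope classical_set_scope.

(* Let H = H_theta, let E be an eigenvalue with l2 eigenvector chi, and put
   E' = E / lam.  The Fourier transform of chi is a Bloch wave of the dual
   operator (coupling 1/lam) at energy E'; for 2 theta outside alpha Z + Z the
   wave and its conjugate have nonzero constant Wronskian W, so the dual Dirichlet
   determinants at E' are trigonometric polynomials of degree n with coefficients
   O(1/W), hence O(n) uniformly in the phase.
   Traces of powers of H per unit volume are, up to the factor lam^k, the same for
   H and for its dual.  Approximating log by polynomials, this transfers the bound:
   the determinants of H at the energy E are at most lam^n e^{eps n}, so chi decays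
   no faster than lam^{-n} e^{-eps n} on pairs of consecutive sites.  Applied to a
   mode with phi_s(0) phi_s(1) <> 0 (one exists since <delta_1, H delta_0> = 1),
   this makes |phi_s(0) phi_s(n)| or |phi_s(1) phi_s(n+1)| large.
   The basis is not assumed measurable in theta.  Such a lower bound is therefore
   read off from matrix elements <delta_n, f(H_theta) delta_0> for polynomials f
   with |f| <= 1 on the spectrum: they are continuous and periodic in theta,
   covariant under translation by alpha, and bounded by the eigenfunction sum. *)


(** * Two-sided sums *)

(** Polynomial approximation of log fails at the energy itself, where log |x - E'| is singular. The
    dual determinants are therefore first moved to E' + i eta; a discrete Duhamel expansion shows
    that this costs only a small exponential rate. The function log((x - E')^2 + eta^2) is smooth on
    both spectra, and adding eta^2 can only increase the squared determinant of H, so only upper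
    bounds have to be transferred. Decay is controlled on pairs of sites, so at a given theta either
    (0, n) or (1, n+1) may be the good pair. By covariance both alternatives are translates of one
    set of phases K_n. Good phases of measure c are covered by two translates of K_n, hence by
    periodicity K_n has measure at least c/2. Reading the symmetric kernel backwards gives the same
    for -n. The set K_n does not mention a basis, which makes the threshold [N] independent of
    [Phi]. The gap between L and Gamma is halved: one half pays for the losses e^{eps n}, the other
    absorbs c/2. *)

Section TwoSidedSums.
Variable R : realType.
Implicit Types (f g : int -> R) (N : nat).

Definition psum f N : R := \sum_(k < (2 * N).+1) f (k%:Z - N%:Z).

Lemma psum0 f : psum f 0 = f 0.
Proof. by rewrite /psum big_ord1. Qed.

Lemma psumS f N : psum f N.+1 = psum f N + (f N.+1%:Z + f (- N.+1%:Z)).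
Proof.
rewrite /psum mulnS !addSn add0n big_ord_recl big_ord_recr/=.
rewrite sub0r addrCA; congr (_ + _).
  by apply: eq_bigr => i _; congr f; rewrite /bump/=; lia.
by rewrite addrC; congr (f _ + _); rewrite /bump/=; lia.
Qed.

Lemma eq_psum f g N : (forall k, f k = g k) -> psum f N = psum g N.
Proof. by move=> h; apply: eq_bigr => i _; rewrite h. Qed.

Lemma psumD f g N : psum (fun k => f k + g k) N = psum f N + psum g N.
Proof. by rewrite /psum big_split. Qed.

Lemma psumMl c f N : psum (fun k => c * f k) N = c * psum f N.
Proof. by rewrite /psum mulr_sumr. Qed.

Lemma psum_sum (n : nat) (F : nat -> int -> R) N :
  psum (fun k => \sum_(i < n) F i k) N = \sum_(i < n) psum (F i) N.
Proof. by rewrite /psum exchange_big. Qed.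

Lemma ler_psum f g N : (forall k, f k <= g k) -> psum f N <= psum g N.
Proof. by move=> h; apply: ler_sum. Qed.

Lemma psum_ge0 f N : (forall k, 0 <= f k) -> 0 <= psum f N.
Proof. by move=> h; apply: sumr_ge0. Qed.

Lemma ler_norm_psum f N : `|psum f N| <= psum (fun k => `|f k|) N.
Proof. exact: ler_norm_sum. Qed.

Lemma psum_nondec f : (forall k, 0 <= f k) -> nondecreasing_seq (psum f).
Proof.
by move=> h; apply/nondecreasing_seqP => n; rewrite psumS lerDl addr_ge0.
Qed.

Lemma psum_term f N (k : int) : (forall k, 0 <= f k) -> (`|k| <= N)%N -> f k <= psum f N.
Proof.
move=> h; elim: N => [|N IH] kN.
  by rewrite psum0; have -> : k = 0 by lia.
rewrite psumS; have [kN'|kN'] := leqP `|k|%N N.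
  by apply: (le_trans (IH kN')); rewrite lerDl addr_ge0.
have [->|->] : k = N.+1%:Z \/ k = - N.+1%:Z by lia.
  by rewrite addrCA lerDl addr_ge0// psum_ge0.
by rewrite addrA lerDr addr_ge0// psum_ge0.
Qed.

Lemma psum_shift f N :
  psum (fun k => f (k + 1)) N = psum f N + f (N%:Z + 1) - f (- N%:Z).
Proof.
elim: N => [|N IH]; first by rewrite !psum0 oppr0; ring.
rewrite !psumS IH.
have -> : (N.+1%:Z : int) = N%:Z + 1 by lia.
have -> : - (N%:Z + 1) + 1 = - N%:Z :> int by lia.
ring.
Qed.

Lemma psum_reflect f N : psum (fun k => f (- k)) N = psum f N.
Proof.
elim: N => [|N IH]; first by rewrite !psum0 oppr0.
by rewrite !psumS IH opprK; congr (_ + _); rewrite addrC.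
Qed.

Lemma psum_shiftN f N :
  psum (fun k => f (k - 1)) N = psum f N + f (- N%:Z - 1) - f N%:Z.
Proof.
elim: N => [|N IH]; first by rewrite !psum0 oppr0; ring.
rewrite !psumS IH.
have -> : (N.+1%:Z : int) = N%:Z + 1 by lia.
rewrite addrK.
have -> : - N%:Z - 1 = - (N%:Z + 1) :> int by lia.
ring.
Qed.

Lemma psum_delta c (k0 : int) N : (`|k0| <= N)%N ->
  psum (fun k => if k == k0 then c else 0) N = c.
Proof.
move=> h; rewrite /psum.
have ok : (`|(k0 + N%:Z)%R| < (2 * N).+1)%N by lia.
rewrite (bigD1 (Ordinal ok))//= big1 ?addr0.
  by case: ifP => // /negP[]; apply/eqP; lia.
move=> i /negP ne; case: ifP => // /eqP e; exfalso; apply: ne; apply/eqP/val_inj => /=; lia.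
Qed.

(** Absolute summability is encoded as a bound, and [tot] uses the same symmetric windows as
    [psumZ]. *)
Definition summ f := exists M : R, forall N, psum (fun k => `|f k|) N <= M.

Definition tot f : R := limn (psum f).

Lemma summ_le f g : summ g -> (forall k, `|f k| <= g k) -> summ f.
Proof.
move=> [M hM] h; exists M => N; apply: le_trans (hM N); apply: ler_psum => k.
by apply: le_trans (h k) (ler_norm _).
Qed.

Lemma summD f g : summ f -> summ g -> summ (fun k => f k + g k).
Proof.
move=> [M hM] [M' hM']; exists (M + M') => N; apply: le_trans (lerD (hM N) (hM' N)).
by rewrite -psumD; apply: ler_psum => k; exact: ler_normD.
Qed.

Lemma summZ c f : summ f -> summ (fun k => c * f k).
Proof.
move=> [M hM]; exists (`|c| * M) => N.
rewrite (eq_psum (g := fun k => `|c| * `|f k|)) ?psumMl ?ler_wpM2l// => k.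
exact: normrM.
Qed.

Lemma summB f g : summ f -> summ g -> summ (fun k => f k - g k).
Proof.
move=> sf /(summZ (-1)) sg; have [M hM] := summD sf sg; exists M => N.
by rewrite (eq_psum (g := fun k => `|f k + -1 * g k|))// => k; rewrite mulN1r.
Qed.

(** A shifted window lies in a larger centred one, so one constant [M] serves for every shift; this
    is what makes [acor_bound] uniform in [k]. *)
Lemma psum_shift_le f (a : int) (M : R) : (forall N, psum (fun k => `|f k|) N <= M) ->
  forall N, psum (fun k => `|f (k + a)|) N <= M.
Proof.
move=> hM N.
suff hh : exists N', psum (fun k => `|f (k + a)|) N <= psum (fun k => `|f k|) N'.
  by case: hh => N' h; apply: le_trans h (hM N').
have key (g : int -> R) (b : nat) : (forall k, 0 <= g k) ->
    psum (fun k => g (k + b%:Z)) N <= psum g (N + b)%N.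
  move=> g0; elim: b => [|b IH]; first by rewrite addn0 (eq_psum (g := g))// => k; rewrite addr0.
  elim: b g g0 {IH} => [|b IH] g g0.
    rewrite psum_shift addn1 psumS.
    have -> : (N%:Z + 1 : int) = N.+1%:Z by lia.
    by rewrite -addrA lerD2l lerD2l (@le_trans _ _ 0)// oppr_le0.
  pose g' k := g (k + 1).
  rewrite (eq_psum (g := fun k => g' (k + b.+1%:Z))); last first.
    by move=> k; rewrite /g'; congr g; lia.
  apply: le_trans (IH g' _) _; first by move=> k; exact: g0.
  rewrite psum_shift [in X in _ <= X]addnS psumS.
  have -> : ((N + b.+1)%N%:Z + 1 : int) = (N + b.+1).+1%:Z by lia.
  by rewrite -addrA lerD2l lerD2l (@le_trans _ _ 0)// oppr_le0.
case: (lerP 0 a) => a0.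
  exists (N + `|a|)%N; have := key (fun k => `|f k|) `|a|%N (fun k => normr_ge0 _).
  by rewrite gez0_abs.
exists (N + `|a|)%N.
have := key (fun k => `|f (- k)|) `|a|%N (fun k => normr_ge0 _).
rewrite (psum_reflect (fun k => `|f k|)); apply: le_trans.
rewrite -psum_reflect le_eqVlt; apply/orP; left; apply/eqP; apply: eq_psum => k.
by congr (`|f _|); lia.
Qed.

Lemma summ_shift f (a : int) : summ f -> summ (fun k => f (k + a)).
Proof. by move=> [M hM]; exists M; exact: psum_shift_le. Qed.

(** Terms at m and -m are paired so that symmetric sums become an ordinary series. *)
Let pr f (n : nat) : R := if n is m.+1 then f m.+1%:Z + f (- m.+1%:Z) else f 0.

Let psumE f N : psum f N = series (pr f) N.+1.
Proof.
elim: N => [|N IH]; first by rewrite psum0 /series/= big_nat1.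
by rewrite psumS IH /series/= [in RHS]big_nat_recr.
Qed.

Lemma summ_cvg f : summ f -> psum f @ \oo --> tot f.
Proof.
move=> [M hM].
have cv : cvgn (series (pr f)).
  apply: normed_cvg.
  have -> : [normed series (pr f)] = series (fun n => `|pr f n|) by [].
  apply: nondecreasing_is_cvgn.
    by apply/nondecreasing_seqP => n; rewrite /series/= big_nat_recr//= lerDl.
  exists M => _ [n _ <-]; case: n => [|n].
    by rewrite /series/= big_geq//; apply: le_trans (hM 0%N); rewrite psum0.
  apply: le_trans (hM n); elim: n => [|n IH].
    by rewrite psum0 /series/= big_nat1.
  by rewrite psumS /series/= big_nat_recr//= lerD// ler_normD.
suff : cvgn (psum f) by [].
have -> : psum f = [sequence series (pr f) n.+1]_n by apply/funext => n /=; exact: psumE.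
by apply/cvg_ex; exists (limn (series (pr f))); rewrite cvg_shiftS.
Qed.

Lemma summ_term0 f : summ f -> (fun N => f N%:Z) @ \oo --> (0 : R).
Proof.
move=> [M hM].
have cv : cvgn (series (fun n => `|f n%:Z|)).
  apply: nondecreasing_is_cvgn.
    by apply/nondecreasing_seqP => n; rewrite /series/= big_nat_recr//= lerDl.
  exists M => _ [n _ <-]; case: n => [|n].
    by rewrite /series/= big_geq//; apply: le_trans (hM 0%N); rewrite psum0.
  apply: le_trans (hM n); elim: n => [|n IH].
    by rewrite psum0 /series/= big_nat1.
  rewrite psumS /series/= big_nat_recr//= lerD// lerDl//.
by apply/norm_cvg0P; exact: cvg_series_cvg_0 cv.
Qed.

Lemma tot_eq f (l : R) : psum f @ \oo --> l -> tot f = l.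
Proof. by move=> h; apply: cvg_lim. Qed.

Lemma eq_tot f g : (forall k, f k = g k) -> tot f = tot g.
Proof. by move=> h; congr tot; apply/funext. Qed.

Lemma totD f g : summ f -> summ g -> tot (fun k => f k + g k) = tot f + tot g.
Proof.
move=> sf sg; apply: tot_eq.
have -> : psum (fun k => f k + g k) = psum f \+ psum g.
  by apply/funext => N; rewrite psumD.
by apply: cvgD; exact: summ_cvg.
Qed.

Lemma totZ c f : summ f -> tot (fun k => c * f k) = c * tot f.
Proof.
move=> sf; apply: tot_eq.
have -> : psum (fun k => c * f k) = (fun N => c * psum f N).
  by apply/funext => N; rewrite psumMl.
by apply: cvgMr; exact: summ_cvg.
Qed.

Lemma totB f g : summ f -> summ g -> tot (fun k => f k - g k) = tot f - tot g.
Proof.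
move=> sf sg; rewrite (eq_tot (g := fun k => f k + (-1) * g k)); last first.
  by move=> k; rewrite mulN1r.
by rewrite totD ?totZ ?mulN1r//; exact: summZ.
Qed.

Lemma tot_shift1 f : summ f -> tot (fun k => f (k + 1)) = tot f.
Proof.
move=> sf; apply: tot_eq.
have -> : psum (fun k => f (k + 1)) = (fun N => psum f N + f (N%:Z + 1) - f (- N%:Z)).
  by apply/funext => N; rewrite psum_shift.
have h1 := summ_cvg sf.
have h2 := summ_term0 (summ_shift 1 sf).
have h3 : (fun N : nat => f (- N%:Z)) @ \oo --> (0 : R).
  apply: (@summ_term0 (fun k => f (- k))).
  by case: sf => M hM; exists M => N; rewrite (psum_reflect (fun k => `|f k|)).
by have := cvgB (cvgD h1 h2) h3; rewrite addr0 subr0; exact.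
Qed.

Lemma tot_shiftN1 f : summ f -> tot (fun k => f (k - 1)) = tot f.
Proof.
move=> sf; rewrite -(tot_shift1 (summ_shift (-1) sf)).
by apply: eq_tot => k; rewrite addrK.
Qed.

Lemma tot_le f (M : R) : (forall N, psum (fun k => `|f k|) N <= M) -> `|tot f| <= M.
Proof.
move=> h; have sf : summ f by exists M.
have := summ_cvg sf => /cvg_norm cv.
rewrite -(cvg_lim _ cv)//; apply: limr_le; first by apply/cvg_ex; exists `|tot f|.
by near=> N; apply: le_trans (h N); exact: ler_norm_psum.
Unshelve. all: by end_near. Qed.

Lemma tot_delta c (k0 : int) : tot (fun k => if k == k0 then c else 0) = c.
Proof.
apply: tot_eq; apply: cvg_near_cst; exists `|k0|%N => // N /= h.
exact: psum_delta.
Qed.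

Lemma tot_sum (n : nat) (F : nat -> int -> R) : (forall i, summ (F i)) ->
  tot (fun k => \sum_(i < n) F i k) = \sum_(i < n) tot (F i).
Proof.
move=> sF; apply: tot_eq.
have -> : psum (fun k => \sum_(i < n) F i k) = (fun N => \sum_(i < n) psum (F i) N).
  by apply/funext => N; rewrite psum_sum.
elim: n => [|n IH].
  rewrite big_ord0 (_ : (fun N : nat => _) = fun=> 0); first exact: cvg_cst.
  by apply/funext => N; rewrite big_ord0.
rewrite big_ord_recr (_ : (fun N : nat => _) =
  (fun N => \sum_(i < n) psum (F i) N) \+ psum (F n)).
  by apply: cvgD => //; exact: summ_cvg.
by apply/funext => N; rewrite big_ord_recr.
Qed.

Lemma summ_tail f (e : R) : 0 < e -> summ f ->
  exists N, forall N', (N <= N')%N ->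
    psum (fun k => `|f k|) N' <= psum (fun k => `|f k|) N + e.
Proof.
move=> e0 [M hM].
have cv : cvgn (psum (fun k => `|f k|)).
  apply: nondecreasing_is_cvgn; first by apply: psum_nondec.
  by exists M => _ [n _ <-].
have nd : nondecreasing_seq (psum (fun k => `|f k|)) by apply: psum_nondec.
have /cvgrPdist_lt/(_ _ e0)[N _ hN] := cv.
exists N => N' _; have := hN N (leqnn _).
have := nondecreasing_cvgn_le nd cv N'; have := nondecreasing_cvgn_le nd cv N.
move=> h1 h2; rewrite ger0_norm ?subr_ge0// => h3; lra.
Qed.

End TwoSidedSums.


(** * Continuants and the dual Bloch wave *)

Section Continuants.
Variable K : comNzRingType.
Implicit Types (a : nat -> K) (n : nat).

(** Euler's continuant: the determinant of the Jacobi matrix with diagonal [a] and off-diagonal -1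
    ([det_tridiag]). It is expanded at the first entry here, at the last one in [contSSr]. *)
Fixpoint cont a n {struct n} : K :=
  match n with
  | 0 => 1
  | n1.+1 => match n1 with
             | 0 => a 0%N
             | n2.+1 => a 0%N * cont (fun k => a k.+1) n1 - cont (fun k => a k.+2) n2
             end
  end.

Lemma contSS a n :
  cont a n.+2 = a 0%N * cont (fun k => a k.+1) n.+1 - cont (fun k => a k.+2) n.
Proof. by []. Qed.

Lemma contSSr a n : cont a n.+2 = a n.+1 * cont a n.+1 - cont a n.
Proof.
suff [] : (forall a, cont a n.+2 = a n.+1 * cont a n.+1 - cont a n) /\
   (forall a, cont a n.+3 = a n.+2 * cont a n.+2 - cont a n.+1) by [].
elim: n => [|n [IH1 IH2]].
  by split=> b; rewrite /= ?mulr1; ring.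
split=> // b; rewrite contSS IH2 (IH1 (fun k => b k.+2)) [cont b n.+3]contSS [cont b n.+2]contSS; ring.
Qed.

Lemma eq_cont a b n : (forall k, (k < n)%N -> a k = b k) -> cont a n = cont b n.
Proof.
suff [] : (forall a b, (forall k, (k < n)%N -> a k = b k) -> cont a n = cont b n) /\
   (forall a b, (forall k, (k < n.+1)%N -> a k = b k) -> cont a n.+1 = cont b n.+1).
  by move=> h _; exact: h.
elim: n => [|n [IH1 IH2]]; first by split=> // c d h; exact: h.
split=> // c d h; rewrite !contSS h// (IH2 _ (fun k => d k.+1)) ?(IH1 _ (fun k => d k.+2))//.
  by move=> k kn; apply: (h k.+2).
by move=> k kn; apply: (h k.+1).
Qed.

End Continuants.

(** Multiplication by [sin y] telescopes the sum (Dirichlet kernel), which is therefore bounded in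
    [n] whenever [sin y] is nonzero. *)
Lemma cos_sum_le (R : realType) (a y : R) (n : nat) :
  `|\sum_(i < n) cos (a + i%:R * (2 * y))| * `|sin y| <= 1.
Proof.
rewrite -normrM mulr_suml.
have -> : \sum_(i < n) cos (a + i%:R * (2 * y)) * sin y =
    2^-1 * (sin (a + (2 * n%:R - 1) * y) - sin (a - y)).
  elim: n => [|n IH].
    by rewrite big_ord0 mulr0 sub0r mulN1r subrr mulr0.
  rewrite big_ord_recr/= IH.
  have -> : a + (2 * n%:R - 1) * y = (a + n%:R * (2 * y)) - y by ring.
  have -> : a + (2 * n.+1%:R - 1) * y = (a + n%:R * (2 * y)) + y by rewrite -natr1; ring.
  by set Z := a + n%:R * _; rewrite (sinB Z) (sinD Z); field.
have h1 := sin_le1 (a + (2 * n%:R - 1) * y); have h2 := sin_geN1 (a + (2 * n%:R - 1) * y).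
have h3 := sin_le1 (a - y); have h4 := sin_geN1 (a - y).
rewrite ler_norml; apply/andP; split; lra.
Qed.

(** * Dual determinants bounded by means of one eigenvector *)

Section DualBound.
Variables (R : realType) (lam alpha theta E : R) (chi : int -> R).
Hypothesis lam0 : lam != 0.
Hypothesis irr : forall k : int, k != 0 -> sin (pi * (k%:~R * alpha)) != 0.
Hypothesis nonres : forall k : int, sin (pi * (2 * theta + k%:~R * alpha)) != 0.
Hypothesis chi2 : summ (fun j => chi j ^+ 2).
Hypothesis eig : forall m : int,
  chi (m + 1) + chi (m - 1) + 2 * lam * cos (2 * pi * (theta + m%:~R * alpha)) * chi m
  = E * chi m.

(** Phases are taken at [ph j k], the midpoint of j and j + k; this centring keeps all correlations
    real. *)
Let ang (x nu : R) : R := 2 * pi * nu * (theta + x * alpha).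
Let ph (j k : int) : R := j%:~R + k%:~R / 2.

Lemma summ_corr (s : int -> R) (k l : int) : (forall j, `|s j| <= 1) ->
  summ (fun j => s j * (chi (j + k) * chi (j + l))).
Proof.
move=> s1; apply: (summ_le (summD (summ_shift k chi2) (summ_shift l chi2))) => j /=.
rewrite normrM (@le_trans _ _ (`|chi (j + k) * chi (j + l)|))// ?ler_piMl//.
rewrite normrM -[X in _ <= X + _]real_normK ?num_real// -[X in _ <= _ + X]real_normK ?num_real//.
by set x := `|_|; set y := `|_|; nra.
Qed.

(* With U the function whose Fourier coefficients are chi, and nu = n, this is
   (up to phase and the factor 2i) the k-th Fourier coefficient of the Wronskian-like
   bracket of the dual Bloch waves e^{2 pi i n theta} U(x + n alpha) and its conjugate,
   centred symmetrically so that it is real. *)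
Definition acor (nu : R) (k : int) : R :=
  tot (fun j => sin (ang (ph j k) nu) * (chi (j + k) * chi (j + 0))).

Let sin1 (f : int -> R) j : `|sin (f j)| <= 1.
Proof. by rewrite ler_norml sin_geN1 sin_le1. Qed.
Let cos1 (f : int -> R) j : `|cos (f j)| <= 1.
Proof. by rewrite ler_norml cos_geN1 cos_le1. Qed.

Let Ts nu k p q := tot (fun j => sin (ang (ph j k) nu) * (chi (j + p) * chi (j + q))).
Let Tc nu k p q := tot (fun j => cos (ang (ph j k) nu) * (chi (j + p) * chi (j + q))).

Let sTs nu k p q : summ (fun j => sin (ang (ph j k) nu) * (chi (j + p) * chi (j + q))).
Proof. by apply: summ_corr => j; exact: (sin1 (fun j => ang (ph j k) nu)). Qed.
Let sTc nu k p q : summ (fun j => cos (ang (ph j k) nu) * (chi (j + p) * chi (j + q))).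
Proof. by apply: summ_corr => j; exact: (cos1 (fun j => ang (ph j k) nu)). Qed.

Let angD x y nu : ang (x + y) nu = ang x nu + 2 * pi * nu * y * alpha.
Proof. by rewrite /ang; ring. Qed.

Let gam nu := pi * nu * alpha.

Let angh x nu : ang (x + 1 / 2) nu = ang x nu + gam nu.
Proof. by rewrite angD /gam; congr (_ + _); field. Qed.

Let anghB x nu : ang (x - 1 / 2) nu = ang x nu - gam nu.
Proof. by rewrite angD /gam; congr (_ + _); field. Qed.

(** Around the common midpoint [ph j (k + 1)] the phases of the two sums differ by -[gam nu] and
    +[gam nu], and the addition formulas leave a single correlation. The three identities below are
    obtained alike, the b-versions around [ph j (k - 1)]. *)
Let Ia nu k : Ts nu k (k + 1) 0 + Ts nu k k (- 1) = 2 * cos (gam nu) * acor nu (k + 1).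
Proof.
rewrite /Ts -[X in _ + X]tot_shift1// -totD//; last exact: (summ_shift 1 (sTs nu k k (-1))).
rewrite -totZ; last exact: sTs.
apply: eq_tot => j.
have -> : ph j k = ph j (k + 1) - 1 / 2 by rewrite /ph intrD; field.
have -> : ph (j + 1) k = ph j (k + 1) + 1 / 2 by rewrite /ph !intrD; field.
rewrite anghB angh sinB sinD.
have -> : j + 1 + k = j + (k + 1) by lia.
have -> : j + 1 - 1 = j + 0 by lia.
ring.
Qed.

Let Ib nu k : Ts nu k (k - 1) 0 + Ts nu k k 1 = 2 * cos (gam nu) * acor nu (k - 1).
Proof.
rewrite /Ts -[X in _ + X]tot_shiftN1// -totD//; last exact: (summ_shift (-1) (sTs nu k k 1)).
rewrite -totZ; last exact: sTs.
apply: eq_tot => j.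
have -> : ph j k = ph j (k - 1) + 1 / 2 by rewrite /ph intrD; field.
have -> : ph (j - 1) k = ph j (k - 1) - 1 / 2 by rewrite /ph !intrD; field.
rewrite anghB angh sinB sinD.
have -> : j - 1 + k = j + (k - 1) by lia.
have -> : j - 1 + 1 = j + 0 by lia.
ring.
Qed.

Let IIa nu k : Tc nu k (k + 1) 0 - Tc nu k k (- 1) = 2 * sin (gam nu) * acor nu (k + 1).
Proof.
rewrite /Tc -[X in _ - X]tot_shift1// -totB//; last exact: (summ_shift 1 (sTc nu k k (-1))).
rewrite -totZ; last exact: sTs.
apply: eq_tot => j.
have -> : ph j k = ph j (k + 1) - 1 / 2 by rewrite /ph intrD; field.
have -> : ph (j + 1) k = ph j (k + 1) + 1 / 2 by rewrite /ph !intrD; field.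
rewrite anghB angh cosB cosD.
have -> : j + 1 + k = j + (k + 1) by lia.
have -> : j + 1 - 1 = j + 0 by lia.
ring.
Qed.

Let IIb nu k : Tc nu k (k - 1) 0 - Tc nu k k 1 = - (2 * sin (gam nu) * acor nu (k - 1)).
Proof.
rewrite /Tc -[X in _ - X]tot_shiftN1// -totB//; last exact: (summ_shift (-1) (sTc nu k k 1)).
rewrite -mulNr -totZ; last exact: sTs.
apply: eq_tot => j.
have -> : ph j k = ph j (k - 1) + 1 / 2 by rewrite /ph intrD; field.
have -> : ph (j - 1) k = ph j (k - 1) - 1 / 2 by rewrite /ph !intrD; field.
rewrite anghB angh cosB cosD.
have -> : j - 1 + k = j + (k - 1) by lia.
have -> : j - 1 + 1 = j + 0 by lia.
ring.
Qed.

Let pot (j : int) : 2 * lam * cos (2 * pi * (theta + j%:~R * alpha)) * chi j =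
  E * chi j - chi (j + 1) - chi (j - 1).
Proof. by rewrite -eig; ring. Qed.

(** A unit step in nu changes the phase by B, and 2 cos B cos beta is the sum of the potential
    cosines at j + k and at j. The eigenvalue equation [pot] trades each potential for hopping. *)
Lemma acor_cos nu (k : int) :
  cos (pi * (k%:~R * alpha)) * (acor (nu + 1) k + acor (nu - 1) k) =
  E / lam * acor nu k - cos (gam nu) / lam * (acor nu (k + 1) + acor nu (k - 1)).
Proof.
have -> : cos (gam nu) / lam * (acor nu (k + 1) + acor nu (k - 1)) = (2 * lam)^-1 *
    ((Ts nu k (k + 1) 0 + Ts nu k k (- 1)) + (Ts nu k (k - 1) 0 + Ts nu k k 1)).
  by rewrite Ia Ib; field.
rewrite /Ts /acor -!totD//; try exact: summD.
rewrite -!totZ//; try by repeat apply: summD.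
rewrite -totB//; [|exact: summZ|by apply: summZ; repeat apply: summD].
apply: eq_tot => j.
apply: (mulfI (_ : 2 * lam != 0)); first by rewrite mulf_neq0// pnatr_eq0.
rewrite mulrBr [2 * lam * (_ / _ * _)](_ : _ = 2 * E * (sin (ang (ph j k) nu) * (chi (j + k) * chi (j + 0)))); last by field.
rewrite mulVKf ?mulf_neq0 ?pnatr_eq0//.
set B := 2 * pi * (theta + ph j k * alpha).
have a1 : ang (ph j k) (nu + 1) = ang (ph j k) nu + B by rewrite /ang /B; ring.
have a2 : ang (ph j k) (nu - 1) = ang (ph j k) nu - B by rewrite /ang /B; ring.
have c1 := pot (j + k); have c2 := pot j.
set beta := pi * (k%:~R * alpha).
have b1 : 2 * pi * (theta + (j + k)%:~R * alpha) = B + beta.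
  by rewrite /B /ph /beta intrD; field.
have b2 : 2 * pi * (theta + j%:~R * alpha) = B - beta by rewrite /B /ph /beta; field.
rewrite b1 cosD in c1; rewrite b2 cosB in c2.
rewrite a1 a2 sinB sinD !addr0.
have -> : j + (k + 1) = j + k + 1 by lia.
have -> : j + (k - 1) = j + k - 1 by lia.
set s := sin (ang _ _); set c := cos (ang _ _).
transitivity (s * ((2 * lam * (cos B * cos beta - sin B * sin beta) * chi (j + k)) * chi j +
    (2 * lam * (cos B * cos beta + sin B * sin beta) * chi j) * chi (j + k))); first by ring.
rewrite c1 c2; ring.
Qed.

(** Companion relation: 2 sin B sin beta is the difference of the same two cosines, so the terms in
    [E] cancel. *)
Lemma acor_sin nu (k : int) :
  sin (pi * (k%:~R * alpha)) * (acor (nu + 1) k - acor (nu - 1) k) =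
  sin (gam nu) / lam * (acor nu (k + 1) - acor nu (k - 1)).
Proof.
have -> : sin (gam nu) / lam * (acor nu (k + 1) - acor nu (k - 1)) = (2 * lam)^-1 *
    ((Tc nu k (k + 1) 0 - Tc nu k k (- 1)) + (Tc nu k (k - 1) 0 - Tc nu k k 1)).
  by rewrite IIa IIb; field.
rewrite /Tc /acor -!totB//.
rewrite -totD//; try exact: summB.
rewrite -!totZ//; [|by apply: summD; exact: summB|exact: summB].
apply: eq_tot => j.
apply: (mulfI (_ : 2 * lam != 0)); first by rewrite mulf_neq0// pnatr_eq0.
rewrite [RHS]mulVKf ?mulf_neq0 ?pnatr_eq0//.
set B := 2 * pi * (theta + ph j k * alpha).
have a1 : ang (ph j k) (nu + 1) = ang (ph j k) nu + B by rewrite /ang /B; ring.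
have a2 : ang (ph j k) (nu - 1) = ang (ph j k) nu - B by rewrite /ang /B; ring.
have c1 := pot (j + k); have c2 := pot j.
set beta := pi * (k%:~R * alpha).
have b1 : 2 * pi * (theta + (j + k)%:~R * alpha) = B + beta.
  by rewrite /B /ph /beta intrD; field.
have b2 : 2 * pi * (theta + j%:~R * alpha) = B - beta by rewrite /B /ph /beta; field.
rewrite b1 cosD in c1; rewrite b2 cosB in c2.
rewrite a1 a2 sinB sinD !addr0.
have -> : j + (k + 1) = j + k + 1 by lia.
have -> : j + (k - 1) = j + k - 1 by lia.
set s := sin (ang _ _); set c := cos (ang _ _).
transitivity (c * ((2 * lam * (cos B * cos beta + sin B * sin beta) * chi j) * chi (j + k) -
    (2 * lam * (cos B * cos beta - sin B * sin beta) * chi (j + k)) * chi j)); first by ring.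
rewrite c1 c2; ring.
Qed.

(** Weighting [acor_cos] and [acor_sin] by the cosine and sine of pi k alpha and adding uses cos^2 +
    sin^2 = 1; no division by a factor that may vanish occurs. *)
Lemma acor_rec nu (k : int) :
  acor (nu + 1) k = - cos (2 * (pi * (k%:~R * alpha))) * acor (nu - 1) k +
   cos (pi * (k%:~R * alpha)) *
     (E / lam * acor nu k - cos (gam nu) / lam * (acor nu (k + 1) + acor nu (k - 1))) +
   sin (pi * (k%:~R * alpha)) * (sin (gam nu) / lam * (acor nu (k + 1) - acor nu (k - 1))).
Proof.
rewrite -acor_cos -acor_sin mulr_natl mulr2n cosD; set b := pi * _.
have h := cos2Dsin2 b; rewrite !expr2 in h.
transitivity ((cos b * cos b + sin b * sin b) * acor (nu + 1) k); first by rewrite h mul1r.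
ring.
Qed.

Lemma acor0 k : acor 0 k = 0.
Proof.
rewrite /acor (eq_tot (g := fun j => if j == 0 then 0 else 0)) ?tot_delta// => j.
by rewrite /ang mulr0 mul0r sin0 mul0r if_same.
Qed.

Lemma acorN nu k : acor (- nu) k = - acor nu k.
Proof.
rewrite -[RHS]mulN1r /acor -totZ//.
by apply: eq_tot => j; rewrite /ang mulrN mulNr sinN mulN1r mulNr.
Qed.

(** Constancy of the Wronskian: [acor_sin] at nu = 0 reads 2 sin(pi k alpha) acor 1 k = 0. Only W =
    [acor 1 0] may survive. *)
Lemma acor1 (k : int) : k != 0 -> acor 1 k = 0.
Proof.
move=> k0; have := acor_sin 0 k.
rewrite !add0r acorN opprK /gam mulr0 mul0r sin0 !mul0r => /eqP.
by rewrite mulf_eq0 (negbTE (irr k0))/= -mulr2n mulrn_eq0 /= => /eqP.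
Qed.

Let acor_recn (n : nat) k :
  acor n.+2%:R k = - cos (2 * (pi * (k%:~R * alpha))) * acor n%:R k +
   cos (pi * (k%:~R * alpha)) * (E / lam * acor n.+1%:R k -
      cos (gam n.+1%:R) / lam * (acor n.+1%:R (k + 1) + acor n.+1%:R (k - 1))) +
   sin (pi * (k%:~R * alpha)) *
      (sin (gam n.+1%:R) / lam * (acor n.+1%:R (k + 1) - acor n.+1%:R (k - 1))).
Proof.
have e : n%:R = n.+1%:R - 1 :> R by rewrite -natr1 addrK.
by rewrite -[n.+2%:R]natr1 acor_rec -e.
Qed.

(** Each step of the recursion widens the support in k by one. This bounds the degree of the
    trigonometric polynomial [acor_fn]. *)
Lemma acor_supp (n : nat) (k : int) : (n <= `|k|)%N -> acor n%:R k = 0.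
Proof.
suff [] : (forall k : int, (n <= `|k|)%N -> acor n%:R k = 0) /\
  (forall k : int, (n.+1 <= `|k|)%N -> acor n.+1%:R k = 0) by move=> h _; exact: h.
clear k; elim: n => [|n [IH1 IH2]].
  split=> l hl; first exact: acor0.
  by rewrite acor1//; lia.
split=> // l hl; rewrite acor_recn.
by rewrite IH1 ?IH2; [ring|lia|lia|lia|lia].
Qed.

Lemma acor_all0 : acor 1 0 = 0 -> forall (n : nat) k, acor n%:R k = 0.
Proof.
move=> h; have h1 k : acor 1 k = 0 by have [->|/acor1] := eqVneq k 0.
suff H n : (forall k, acor n%:R k = 0) /\ (forall k, acor n.+1%:R k = 0).
  by move=> n k; have [] := H n.
elim: n => [|n [IH1 IH2]]; first by split=> k; rewrite ?acor0 ?h1.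
by split=> // k; rewrite acor_recn !IH2 IH1; ring.
Qed.

Lemma acor_bound : exists C : R, forall nu k, `|acor nu k| <= C.
Proof.
have [C hC] := chi2; exists C => nu k; apply: tot_le => N.
have h (l : int) : psum (fun j => chi (j + l) ^+ 2) N <= C.
  apply: le_trans (psum_shift_le l hC N); apply: ler_psum => j; exact: ler_norm.
apply: (@le_trans _ _ (psum (fun j => 2^-1 * (chi (j + k) ^+ 2 + chi (j + 0) ^+ 2)) N)).
  apply: ler_psum => j; rewrite normrM (@le_trans _ _ (`|chi (j + k) * chi (j + 0)|))//.
    by rewrite ler_piMl// (sin1 (fun j => ang (ph j k) nu)).
  rewrite normrM -[X in _ <= _ * (X + _)]real_normK ?num_real//.
  rewrite -[X in _ <= _ * (_ + X)]real_normK ?num_real//.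
  by set x := `|_|; set y := `|_|; have := sqr_ge0 (x - y); rewrite sqrrB; lra.
rewrite psumMl psumD; have := h k; have := h 0; lra.
Qed.

(** The bracket of the dual Bloch wave and its conjugate at distance n, resummed from its Fourier
    coefficients: it is 0 for n = 0 and the Wronskian for n = 1. *)
Definition acor_fn (n : nat) (x : R) (M : nat) : R :=
  psum (fun k => acor n%:R k * cos (2 * pi * k%:~R * (x + n%:R * alpha / 2))) M.

Lemma acor_fn0 x M : acor_fn 0 x M = 0.
Proof.
rewrite /acor_fn (eq_psum (g := fun k => if k == 0 then 0 else 0)) ?psum_delta// => k.
by rewrite acor0 mul0r if_same.
Qed.

Lemma acor_fn1 x M : acor_fn 1 x M = acor 1 0.
Proof.
rewrite /acor_fn (eq_psum (g := fun k => if k == 0 then acor 1 0 else 0)) ?psum_delta// => k.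
by case: eqP => [->|/eqP/acor1->]; rewrite ?mul0r// mulr0 mul0r cos0 mulr1.
Qed.

(** Multiplication by cos Y shifts the Fourier index both ways; the coefficients then match by
    [acor_cos] and [acor_sin]. The window condition kills the boundary terms of the shifted sums. *)
Lemma acor_fn_rec (n : nat) x M : (n.+1 <= M)%N ->
  acor_fn n.+2 x M = (E / lam - 2 * lam^-1 * cos (2 * pi * (x + n.+1%:R * alpha))) *
    acor_fn n.+1 x M - acor_fn n x M.
Proof.
move=> nM; apply/eqP; rewrite eq_sym subr_eq eq_sym; apply/eqP.
set nu := n.+1%:R : R; set Y := 2 * pi * (x + nu * alpha).
pose X (k : int) := 2 * pi * k%:~R * (x + nu * alpha / 2).
pose f (k : int) := acor nu k * cos (X k - Y).
pose g (k : int) := acor nu k * cos (X k + Y).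
have ef : psum (fun k => f (k + 1)) M = psum f M.
  by rewrite psum_shift /f !acor_supp; [ring|lia|lia].
have eg : psum (fun k => g (k - 1)) M = psum g M.
  by rewrite psum_shiftN /g !acor_supp; [ring|lia|lia].
have efg : psum f M + psum g M = 2 * cos Y * acor_fn n.+1 x M.
  by rewrite -psumD /acor_fn -psumMl; apply: eq_psum => k; rewrite /f /g -/nu -/(X k) cosB cosD; ring.
have -> : (E / lam - 2 * lam^-1 * cos Y) * acor_fn n.+1 x M =
   E / lam * acor_fn n.+1 x M + (- lam^-1) * (psum (fun k => f (k + 1)) M + psum (fun k => g (k - 1)) M).
  by rewrite ef eg efg; ring.
rewrite -psumD -psumMl /acor_fn -psumMl -!psumD; apply: eq_psum => k.
rewrite -/nu /f /g.
have -> : X (k + 1) - Y = X k - gam nu by rewrite /X /Y /gam intrD; field.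
have -> : X (k - 1) + Y = X k + gam nu by rewrite /X /Y /gam intrB; field.
set b := pi * (k%:~R * alpha).
have e2 : n.+2%:R = nu + 1 by rewrite /nu natr1.
have e0 : n%:R = nu - 1 by rewrite /nu -natr1 addrK.
have -> : 2 * pi * k%:~R * (x + n.+2%:R * alpha / 2) = X k + b.
  by rewrite e2 /X /b; field.
have -> : 2 * pi * k%:~R * (x + n%:R * alpha / 2) = X k - b.
  by rewrite e0 /X /b; field.
rewrite -/(X k) e2 e0 !cosB !cosD.
have h1 := acor_cos nu k; have h2 := acor_sin nu k; rewrite -/b in h1 h2.
transitivity (cos (X k) * (cos b * (acor (nu + 1) k + acor (nu - 1) k)) -
  sin (X k) * (sin b * (acor (nu + 1) k - acor (nu - 1) k))); first by ring.
by rewrite h1 h2; field.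
Qed.

(** Both sides obey the same three-term recursion with the same initial values 0 and W. *)
Lemma acor_fn_cont (n : nat) x M : (n <= M)%N ->
  acor_fn n.+1 x M = acor 1 0 *
    cont (fun k => E / lam - 2 * lam^-1 * cos (2 * pi * (x + k.+1%:R * alpha))) n.
Proof.
suff [] : ((n <= M)%N -> acor_fn n.+1 x M = acor 1 0 *
    cont (fun k => E / lam - 2 * lam^-1 * cos (2 * pi * (x + k.+1%:R * alpha))) n) /\
  ((n.+1 <= M)%N -> acor_fn n.+2 x M = acor 1 0 *
    cont (fun k => E / lam - 2 * lam^-1 * cos (2 * pi * (x + k.+1%:R * alpha))) n.+1) by [].
elim: n => [|n [IH1 IH2]].
  split=> h; first by rewrite acor_fn1 mulr1.
  by rewrite acor_fn_rec// acor_fn1 acor_fn0 subr0 mulrC.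
split=> // h; rewrite acor_fn_rec// IH2 1?ltnW// IH1 1?ltnW 1?ltnW// contSSr; ring.
Qed.

(* If the Wronskian vanished, the measure \sum_j chi_j^2 delta_{theta + j alpha} on the
   circle would be symmetric under reflection; for nonresonant theta its atoms and
   their mirror images are disjoint. *)
Lemma acor10_neq0 (j0 : int) : chi j0 != 0 -> acor 1 0 != 0.
Proof.
move=> cj0; apply/negP => /eqP /acor_all0 allz'; have allz n := allz' n 0.
pose a (j : int) := 2 * pi * (theta + j%:~R * alpha).
have z (n : nat) : tot (fun j => sin (n%:R * a j) * chi j ^+ 2) = 0.
  rewrite -(allz n); apply: eq_tot => j; rewrite /ang /ph /a !addr0 mul0r addr0 expr2.
  by congr (sin _ * _); ring.
have sz (n : nat) : summ (fun j => sin (n%:R * a j) * chi j ^+ 2).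
  apply: (summ_le chi2) => j; rewrite normrM [`|chi j ^+ 2|]ger0_norm ?sqr_ge0//.
  by rewrite ler_piMl ?sqr_ge0// (sin1 (fun j => n%:R * a j)).
(* Test kernel peaked at the atom j0: large at j = j0, bounded in m at every other j. Being a
   combination of the functions sin(n a), it has total 0 against chi^2. *)
pose G (m : nat) (j : int) := \sum_(n < m) sin (n%:R * a j0) * sin (n%:R * a j).
have totG m : tot (fun j => G m j * chi j ^+ 2) = 0.
  rewrite (eq_tot (g := fun j => \sum_(n < m)
     sin (n%:R * a j0) * (sin (n%:R * a j) * chi j ^+ 2))); last first.
    by move=> j; rewrite mulr_suml; apply: eq_bigr => i _; rewrite mulrA.
  rewrite (tot_sum _ (F := fun n j => sin (n%:R * a j0) * (sin (n%:R * a j) * chi j ^+ 2))).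
    by rewrite big1// => i _; rewrite totZ// z mulr0.
  by move=> i; exact: summZ.
have sG m : summ (fun j => G m j * chi j ^+ 2).
  apply: (summ_le (summZ m%:R chi2)) => j; rewrite normrM [`|chi j ^+ 2|]ger0_norm ?sqr_ge0//.
  rewrite ler_wpM2r ?sqr_ge0//; apply: le_trans (ler_norm_sum _ _ _) _.
  rewrite -[m in m%:R]card_ord -sumr_const; apply: ler_sum => i _.
  by rewrite normrM mulr_ile1// (sin1 (fun j => i%:R * a j)).
pose s1 j := sin (pi * ((j - j0)%:~R * alpha)); pose s2 j := sin (pi * (2 * theta + (j0 + j)%:~R * alpha)).
pose Cj j := `|s1 j|^-1 + `|s2 j|^-1.
(* [G] is half the difference of two Dirichlet sums. At j = j0 the first one equals m, and [s1 j] is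
   sin 0, whose inverse is 0 by convention; the second sum stays bounded even there by [nonres]. *)
have Glow (m : nat) j : - Cj j + (if j == j0 then m%:R / 2 else 0) <= G m j.
  have e : G m j = 2^-1 * \sum_(n < m) cos (0 + n%:R * (2 * (pi * ((j - j0)%:~R * alpha)))) -
      2^-1 * \sum_(n < m) cos (0 + n%:R * (2 * (pi * (2 * theta + (j0 + j)%:~R * alpha)))).
    rewrite -mulrBr -sumrB /G mulr_sumr; apply: eq_bigr => n _.
    have -> : 0 + n%:R * (2 * (pi * ((j - j0)%:~R * alpha))) = n%:R * a j - n%:R * a j0.
      by rewrite /a intrB; ring.
    have -> : 0 + n%:R * (2 * (pi * (2 * theta + (j0 + j)%:~R * alpha))) = n%:R * a j + n%:R * a j0.
      by rewrite /a intrD; ring.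
    by rewrite cosB cosD; field.
  have h2 : \sum_(n < m) cos (0 + n%:R * (2 * (pi * (2 * theta + (j0 + j)%:~R * alpha)))) <= `|s2 j|^-1.
    rewrite -[X in _ <= X]mul1r ler_pdivlMr ?normr_gt0 ?nonres//.
    apply: le_trans (cos_sum_le 0 (pi * (2 * theta + (j0 + j)%:~R * alpha)) m).
    by rewrite ler_wpM2r// ler_norm.
  have p1 : 0 <= `|s1 j|^-1 by rewrite invr_ge0.
  have p2 : 0 <= `|s2 j|^-1 by rewrite invr_ge0.
  rewrite e /Cj; have [jj|jj] := eqVneq j j0.
    have -> : \sum_(n < m) cos (0 + n%:R * (2 * (pi * ((j - j0)%:~R * alpha)))) = m%:R.
      rewrite -[m in RHS]card_ord -sumr_const; apply: eq_bigr => n _.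
      by rewrite jj subrr mul0r !mulr0 addr0 cos0.
    lra.
  have h1 : - `|s1 j|^-1 <= \sum_(n < m) cos (0 + n%:R * (2 * (pi * ((j - j0)%:~R * alpha)))).
    rewrite lerNl -[X in _ <= X]mul1r ler_pdivlMr ?normr_gt0 ?irr ?subr_eq0//.
    apply: le_trans (cos_sum_le 0 (pi * ((j - j0)%:~R * alpha)) m).
    by rewrite ler_wpM2r// -normrN ler_norm.
  lra.
have Gabs (m : nat) j : `|G m j| <= m%:R.
  apply: le_trans (ler_norm_sum _ _ _) _.
  rewrite -[m in m%:R]card_ord -sumr_const; apply: ler_sum => i _.
  by rewrite normrM mulr_ile1// (sin1 (fun j => i%:R * a j)).
set w := chi j0 ^+ 2.
have w0 : 0 < w by rewrite exprn_even_gt0//= cj0.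
(* A tail of mass w/8 costs at most m w/8 since |G| <= m, while the atom contributes m w/2; the
   difference outgrows the constant [K]. *)
have w80 : 0 < w / 8 by rewrite divr_gt0.
have [N0 hN0] := summ_tail w80 chi2.
pose N := maxn N0 `|j0|%N.
have hN N' : (N <= N')%N -> psum (fun j => chi j ^+ 2) N' <= psum (fun j => chi j ^+ 2) N + w / 8.
  move=> NN'.
  have ab M : psum (fun j => `|chi j ^+ 2|) M = psum (fun j => chi j ^+ 2) M.
    by apply: eq_psum => j; rewrite ger0_norm ?sqr_ge0.
  have := hN0 N' (leq_trans (leq_maxl _ _) NN'); rewrite !ab => h.
  apply: (le_trans h); rewrite lerD2r; apply: psum_nondec (leq_maxl _ _) => j.
  exact: sqr_ge0.
pose K := psum (fun j => Cj j * chi j ^+ 2) N.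
have main (m : nat) : m%:R * (w / 2) - K - m%:R * (w / 8) <= 0.
  rewrite -(totG m); have := summ_cvg (sG m) => cv.
  rewrite /tot; apply: limr_ge; first by apply/cvg_ex; eexists; exact: cv.
  exists N => // N' /= NN'.
  have low : m%:R * (w / 2) - K <= psum (fun j => G m j * chi j ^+ 2) N.
    have -> : m%:R * (w / 2) = psum (fun j => if j == j0 then m%:R * (w / 2) else 0) N.
      by rewrite psum_delta// leq_maxr.
    rewrite /K -mulN1r -psumMl -psumD; apply: ler_psum => j.
    apply: le_trans (ler_wpM2r (sqr_ge0 _) (Glow m j)).
    move: (Cj j) => c; case: eqP => [->|_]; last by rewrite add0r addr0 mulN1r mulNr.
    by rewrite -/w; lra.
  have tail : psum (fun j => G m j * chi j ^+ 2) N - m%:R * (w / 8) <= psum (fun j => G m j * chi j ^+ 2) N'.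
    have nd : nondecreasing_seq (psum (fun j => (G m j + m%:R) * chi j ^+ 2)).
      apply: psum_nondec => j; rewrite mulr_ge0 ?sqr_ge0//.
      by have := Gabs m j; rewrite ler_norml => /andP[+ _]; rewrite addrC -lerBlDl sub0r.
    have := nd _ _ NN'.
    have sp M : psum (fun j => (G m j + m%:R) * chi j ^+ 2) M =
        psum (fun j => G m j * chi j ^+ 2) M + m%:R * psum (fun j => chi j ^+ 2) M.
      by rewrite -psumMl -psumD; apply: eq_psum => j; rewrite mulrDl.
    rewrite !sp; have := ler_wpM2l (ler0n R m) (hN _ NN'); lra.
  lra.
have [m hm] : exists m : nat, K < m%:R * (w / 4).
  exists (Num.Def.archi_bound (K / (w / 4))).
  rewrite -ltr_pdivrMr ?divr_gt0//.
  case: (lerP 0 (K / (w / 4))) => h; first exact: archi_boundP.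
  by rewrite (lt_le_trans h).
have := main m; have : 0 <= m%:R * w by rewrite mulr_ge0// ltW.
lra.
Qed.

(** [acor_fn_cont] divided by W: there are 2n + 1 coefficients, each at most [C0] and independent of
    x, and 2n + 1 <= 3(n + 1) gives the factor 3. *)
Lemma dual_cont_bound : (exists j, chi j != 0) ->
  exists2 C : R, 0 <= C & forall (x : R) (n : nat),
    `|cont (fun k => E / lam - 2 * lam^-1 * cos (2 * pi * (x + k%:R * alpha))) n|
      <= C * n.+1%:R.
Proof.
move=> [j0 /acor10_neq0 W0]; have [C0 hC0] := acor_bound.
have C0p : 0 <= C0 by apply: le_trans (hC0 0 0).
exists (3 * C0 / `|acor 1 0|); first by rewrite divr_ge0// mulr_ge0.
move=> x n.
have <- : cont (fun k => E / lam - 2 * lam^-1 * cos (2 * pi * (x - alpha + k.+1%:R * alpha))) n =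
    cont (fun k => E / lam - 2 * lam^-1 * cos (2 * pi * (x + k%:R * alpha))) n.
  by apply: eq_cont => k _; rewrite -natr1; congr (_ - _ * cos (_ * _)); ring.
rewrite -(ler_pM2l (_ : 0 < `|acor 1 0|)) ?normr_gt0// -normrM -(acor_fn_cont _ (leqnn n)).
apply: le_trans (ler_norm_psum _ _) _.
apply: (@le_trans _ _ (psum (fun=> C0) n)).
  apply: ler_psum => k; rewrite normrM -[X in _ <= X]mulr1 ler_pM//.
  exact: (cos1 (fun k => 2 * pi * k%:~R * _)).
rewrite /psum sumr_const card_ord -[C0 *+ _]mulr_natl.
have -> : `|acor 1 0| * (3 * C0 / `|acor 1 0| * n.+1%:R) = 3 * C0 * n.+1%:R.
  by field; rewrite normr_eq0.
have -> : 3 * C0 * n.+1%:R = (3 * n.+1)%:R * C0 by rewrite natrM; ring.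
by rewrite ler_wpM2r// ler_nat; lia.
Qed.

End DualBound.


(** * Spectra of tridiagonal matrices *)

Section Tridiagonal.
Variable K : comNzRingType.

(** Two values of [b] matter: 1 for the truncated operator, -1 for z - H, whose determinant is a
    continuant. *)
Definition tridiag (b : K) (a : nat -> K) n : 'M[K]_n :=
  \matrix_(i, j) if i == j then a i else if (i.+1 == j) || (j.+1 == i) then b else 0.

Lemma det_tridiag (a : nat -> K) n : \det (tridiag (-1) a n) = cont a n.
Proof.
suff [] : (forall a, \det (tridiag (-1) a n) = cont a n) /\
   (forall a, \det (tridiag (-1) a n.+1) = cont a n.+1) by [].
clear a; elim: n => [|n [IH1 IH2]].
  by split=> b; rewrite ?det_mx00// det_mx11 mxE.
split=> // b; rewrite contSS -IH2 -IH1.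
rewrite (expand_det_row _ ord0) big_ord_recl big_ord_recl big1 ?addr0; last first.
  by move=> i _; rewrite !mxE /= mul0r.
rewrite !mxE/= /cofactor/= expr0 mul1r expr1.
congr (_ + _).
  congr (_ * \det _); apply/matrixP => i j.
  by rewrite !mxE -!val_eqE/= /bump/= !add1n !eqSS.
rewrite mulN1r mulN1r opprK -[RHS]mulN1r (expand_det_col _ ord0) big_ord_recl big1 ?addr0.
  rewrite !mxE/= /cofactor/= expr0 mul1r; congr (_ * \det _); apply/matrixP => i j.
  by rewrite !mxE -!val_eqE/= /bump/= !add1n ?eqSS.
by move=> i _; rewrite !mxE/= mul0r.
Qed.

End Tridiagonal.

(** * Real symmetric matrices: eigenvalues, traces, norm bounds *)

Section SymSpectrum.
Variable R : realType.
Local Notation toC := (real_complex R).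

(** Spectral theorem for the complexified matrix, whose spectrum is real. The determinant identity
    is over complex z because it is needed off the real axis; eigenvectors are recovered over R from
    the vanishing determinant. *)
Lemma sym_spectrum n (A : 'M[R]_n.+1) : A^T = A -> exists e : 'I_n.+1 -> R,
  [/\ forall k, \tr (A ^+ k) = \sum_i e i ^+ k,
      forall z, \det (z%:M - map_mx toC A) = \prod_i (z - toC (e i)) &
      forall i, exists2 v : 'rV[R]_n.+1, v != 0 & v *m A = e i *: v].
Proof.
move=> symA; pose Ac := map_mx toC A.
have realA : Ac \is a realmx.
  by apply/mxOverP => i j; rewrite mxE; apply/complex_realP; exists (A i j).
have herm : Ac \is hermsymmx.
  apply: realsym_hermsym => //; apply/is_hermitianmxP.
  by rewrite expr0 scale1r map_mx_id// /Ac map_trmx symA.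
have nA := hermitian_normalmx herm.
have /orthomx_spectralP := nA; set P := spectralmx Ac => AE.
have uP : P \in unitmx by exact: spectral_unit.
have rd := hermitian_spectral_diag_real herm.
pose e i : R := complex.Re (spectral_diag Ac 0 i).
have eE i : toC (e i) = spectral_diag Ac 0 i.
  by apply: RRe_real; have /mxOverP := rd; exact.
have dE z : \det (z%:M - Ac) = \prod_i (z - toC (e i)).
  rewrite AE.
  have -> : z%:M - invmx P *m diag_mx (spectral_diag Ac) *m P =
     invmx P *m (z%:M - diag_mx (spectral_diag Ac)) *m P.
    by rewrite mulmxBr mulmxBl scalar_mxC mulmxKV.
  rewrite !det_mulmx mulrAC -det_mulmx mulVmx// det1 mul1r.
  have -> : z%:M - diag_mx (spectral_diag Ac) = diag_mx (\row_i (z - toC (e i))).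
    apply/matrixP => i j; rewrite !mxE eE; case: eqP => _; rewrite ?mulr1n ?mulr0n ?subr0//.
  by rewrite det_diag; apply: eq_bigr => i _; rewrite mxE.
exists e; split=> //.
  move=> k; apply: (@complexI R).
  have -> : toC (\tr (A ^+ k)) = \tr (Ac ^+ k).
    by rewrite -rmorphXn/= /mxtrace rmorph_sum; apply: eq_bigr => i _; rewrite mxE.
  have -> : Ac ^+ k = invmx P *m (diag_mx (spectral_diag Ac)) ^+ k *m P.
    elim: k => [|k IH]; first by rewrite !expr0 mulmx1 mulVmx.
    by rewrite !exprS -!mulmxE IH {1}AE !mulmxA mulmxK.
  rewrite mxtrace_mulC mulmxA mulmxV// mul1mx.
  have -> : diag_mx (spectral_diag Ac) ^+ k = diag_mx (\row_i (toC (e i) ^+ k)).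
    elim: k => [|k IH].
      by rewrite expr0; apply/matrixP => i j; rewrite !mxE expr0.
    rewrite exprS IH -mulmxE mulmx_diag; congr diag_mx; apply/rowP => i.
    by rewrite !mxE exprS eE.
  by rewrite mxtrace_diag rmorph_sum; apply: eq_bigr => i _; rewrite mxE rmorphXn.
move=> i.
have /eqP/det0P[v v0 vA] : \det ((e i)%:M - A) = 0.
  apply: (@complexI R); rewrite -det_map_mx map_mxB map_scalar_mx/= dE.
  by rewrite (bigD1 i)//= subrr mul0r rmorph0.
exists v => //; apply/eqP; rewrite -subr_eq0 -opprB oppr_eq0.
by rewrite -mul_mx_scalar -mulmxBr vA.
Qed.

(** The eigenvalue equation is read at the coordinate where |v| is largest. *)
Lemma eigenvalue_le n (A : 'M[R]_n.+1) (e B : R) (v : 'rV[R]_n.+1) : v != 0 ->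
  v *m A = e *: v -> (forall j, \sum_i `|A i j| <= B) -> `|e| <= B.
Proof.
move=> v0 vA hB.
pose j := [arg max_(i > ord0) `|v ord0 i|]%O.
have hj i : `|v ord0 i| <= `|v ord0 j|.
  by rewrite /j; case: arg_maxP => //= k _; exact.
have vj : 0 < `|v ord0 j|.
  rewrite normr_gt0; apply: contra v0 => /eqP vj0; apply/eqP/rowP => i.
  by apply/eqP; rewrite mxE -normr_le0; have := hj i; rewrite vj0 normr0.
rewrite -(ler_pM2r vj) -normrM.
have := congr1 (fun M : 'rV_n.+1 => M ord0 j) vA; rewrite /= !mxE => <-.
apply: le_trans (ler_norm_sum _ _ _) _.
apply: le_trans (_ : `|v ord0 j| * \sum_i `|A i j| <= _).
  by rewrite mulr_sumr; apply: ler_sum => i _; rewrite normrM ler_wpM2r.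
by rewrite mulrC ler_wpM2r.
Qed.

Lemma tridiag_col (b : R) (a : nat -> R) (c : R) n (j : 'I_n) : (forall k, `|a k| <= c) ->
  \sum_i `|tridiag b a n i j| <= c + 2 * `|b|.
Proof.
move=> ha.
have one (p : 'I_n -> bool) : (forall i i', p i -> p i' -> i = i') ->
    \sum_i (if p i then `|b| else 0) <= `|b|.
  move=> up; rewrite -big_mkcond/=.
  case: (pickP p) => [i pi|p0]; last by rewrite big1 // => i; rewrite p0.
  rewrite (bigD1 i)//= big1 ?addr0// => k /andP[pk /negP]; case; apply/eqP; exact: up.
have c0 : 0 <= c by apply: le_trans (ha 0%N).
apply: (@le_trans _ _ (\sum_i ((if i == j then c else 0) + (if i.+1 == j then `|b| else 0) +
   (if j.+1 == i then `|b| else 0)))).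
  apply: ler_sum => i _; rewrite mxE.
  case: ifP => [/eqP->|_].
    by rewrite -addrA (le_trans (ha j))// lerDl addr_ge0//; case: ifP.
  by case: (i.+1 == j); case: (j.+1 == i :> nat) => /=; rewrite ?normr0 ?addr0 ?add0r// lerDl.
rewrite !big_split/= -big_mkcond/= big_pred1_eq.
have h1 := one (fun i => i.+1 == j :> nat) _; have h2 := one (fun i => j.+1 == i :> nat) _.
rewrite -addrA lerD2l mulr_natl mulr2n lerD ?h1 ?h2//.
  by move=> i i' /eqP e1 /eqP e2; apply/val_inj; have := etrans e1 (esym e2) => -[].
by move=> i i' /eqP e1 /eqP e2; apply/val_inj => /=; rewrite -e1 -e2.
Qed.

End SymSpectrum.


(** * Aubry duality for traces *)

Section Kernel.
Variables (R : realType) (alpha : R).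

(* Weyl-ordered coefficients of (u + u^-1 + mu (v + v^-1))^k in the rotation algebra.
   Averaging left and right multiplication makes the recursion real and manifestly
   symmetric under the exchange of u and v. *)
Fixpoint wcoef (mu : R) (k : nat) (a b : int) : R :=
  if k is k'.+1 then
    cos (pi * (b%:~R * alpha)) * (wcoef mu k' (a - 1) b + wcoef mu k' (a + 1) b) +
    mu * cos (pi * (a%:~R * alpha)) * (wcoef mu k' a (b - 1) + wcoef mu k' a (b + 1))
  else if (a == 0) && (b == 0) then 1 else 0.

Lemma wcoef_supp mu k (a b : int) : (k < `|b|)%N -> wcoef mu k a b = 0.
Proof.
elim: k a b => [|k IH] a b kb /=.
  by rewrite (_ : (b == 0) = false) ?andbF//; lia.
by rewrite !IH ?addr0 ?mulr0 ?addr0//; lia.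
Qed.

(** Aubry duality: exchanging a and b swaps the two halves of the recursion up to a factor mu. At a
    = b = 0 it compares traces per unit volume. *)
Lemma wcoef_dual mu k (a b : int) : mu != 0 -> wcoef mu k a b = mu ^+ k * wcoef mu^-1 k b a.
Proof.
move=> mu0; elim: k a b => [|k IH] a b /=; first by rewrite expr0 mul1r andbC.
by rewrite !IH exprS; field.
Qed.

Variables (mu x : R).

Definition site (m : int) : R := 2 * mu * cos (2 * pi * (x + m%:~R * alpha)).

Definition hop (u : int -> R) (m : int) : R := u (m + 1) + u (m - 1) + site m * u m.

Definition dl (j m : int) : R := if m == j then 1 else 0.

Definition hker k (j m : int) : R := iter k hop (dl j) m.

Lemma hker_supp k (j m : int) : (k < `|(m - j)%R|)%N -> hker k j m = 0.
Proof.
elim: k m => [|k IH] m km; rewrite /hker/=.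
  by rewrite /dl (_ : (m == j) = false)//; lia.
rewrite /hop.
have h p : (k < `|(p - j)%R|)%N -> iter k hop (dl j) p = 0 by exact: IH.
by rewrite !h ?mulr0 ?addr0//; lia.
Qed.

Lemma iter_hop_lin k (f g h : int -> R) (c : R) m :
  iter k hop (fun p => f p + g p + c * h p) m =
  iter k hop f m + iter k hop g m + c * iter k hop h m.
Proof.
elim: k m => [|k IH] m //=.
by rewrite {1}/hop !IH /hop; ring.
Qed.

Lemma hkerSl k (j m : int) :
  hker k.+1 j m = hker k j (m + 1) + hker k j (m - 1) + site m * hker k j m.
Proof. by []. Qed.

(** Here H acts first, on delta_j, so that hopping moves the source; averaging with [hkerSl] gives
    the symmetric form of [wcoef]. *)
Lemma hkerSr k (j m : int) :
  hker k.+1 j m = hker k (j - 1) m + hker k (j + 1) m + site j * hker k j m.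
Proof.
rewrite /hker iterSr -iter_hop_lin; congr (iter k hop _ m); apply/funext => p.
rewrite /hop /dl.
rewrite [(p + 1 == j)](_ : _ = (p == j - 1)); last by apply/eqP/eqP; lia.
rewrite [(p - 1 == j)](_ : _ = (p == j + 1)); last by apply/eqP/eqP; lia.
by congr (_ + _); case: eqP => [->|_]; rewrite ?mulr0.
Qed.

(** Weyl expansion of H^k, with the phase at the midpoint j + a/2; the window only has to contain
    the support in b. *)
Lemma hker_wcoef k (j a : int) M : (k <= M)%N ->
  hker k j (j + a) =
  psum (fun b => wcoef mu k a b * cos (2 * pi * b%:~R * (x + (j%:~R + a%:~R / 2) * alpha))) M.
Proof.
elim: k j a => [|k IH] j a kM.
  rewrite /hker /dl /=.
  rewrite (eq_psum (g := fun b => if b == 0 then (if a == 0 then 1 else 0) else 0)).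
    rewrite psum_delta//; congr (if _ then _ else _); apply/eqP/eqP; lia.
  move=> b; case: (eqVneq b 0) => [->|b0].
    by rewrite mulr0 mul0r cos0 mulr1 andbT.
  by rewrite andbF mul0r.
have kM' : (k <= M)%N by exact: ltnW.
have e1 : hker k j (j + a + 1) = hker k j (j + (a + 1)) by congr hker; lia.
have e2 : hker k j (j + a - 1) = hker k j (j + (a - 1)) by congr hker; lia.
have e3 : hker k (j - 1) (j + a) = hker k (j - 1) (j - 1 + (a + 1)) by congr hker; lia.
have e4 : hker k (j + 1) (j + a) = hker k (j + 1) (j + 1 + (a - 1)) by congr hker; lia.
(* Mean of the left and right recursions: the mean of the potentials at j and j + a produces the
   factor cos gam, and the sine terms drop out. *)
have -> : hker k.+1 j (j + a) = 2^-1 * (hker k j (j + (a + 1)) + hker k j (j + (a - 1)) +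
    (hker k (j - 1) (j - 1 + (a + 1)) + hker k (j + 1) (j + 1 + (a - 1))) +
    (site (j + a) + site j) * hker k j (j + a)).
  rewrite -e1 -e2 -e3 -e4.
  have h1 := hkerSl k j (j + a); have h2 := hkerSr k j (j + a).
  transitivity (2^-1 * (hker k.+1 j (j + a) + hker k.+1 j (j + a))); first by field.
  by rewrite {1}h1 h2; ring.
pose y := j%:~R + a%:~R / 2 : R.
pose Y (b : int) := 2 * pi * b%:~R * (x + y * alpha).
pose Z := 2 * pi * (x + y * alpha).
pose gam := pi * (a%:~R * alpha).
have eS : site (j + a) + site j = 4 * mu * cos gam * cos Z.
  rewrite /site.
  have -> : 2 * pi * (x + (j + a)%:~R * alpha) = Z + gam by rewrite /Z /gam /y intrD; field.
  have -> : 2 * pi * (x + j%:~R * alpha) = Z - gam by rewrite /Z /gam /y; field.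
  by rewrite cosB cosD; ring.
pose f b := wcoef mu k a b * cos (Y b + Z).
pose g b := wcoef mu k a b * cos (Y b - Z).
have ef : psum (fun b => f (b - 1)) M = psum f M.
  by rewrite psum_shiftN /f !wcoef_supp; [ring|lia|lia].
have eg : psum (fun b => g (b + 1)) M = psum g M.
  by rewrite psum_shift /g !wcoef_supp; [ring|lia|lia].
have efg : 2 * cos Z * hker k j (j + a) = psum (fun b => f (b - 1)) M + psum (fun b => g (b + 1)) M.
  rewrite ef eg -psumD IH// -psumMl; apply: eq_psum => b.
  by rewrite -/y -/(Y b) /f /g cosB cosD; ring.
have -> : (site (j + a) + site j) * hker k j (j + a) =
    2 * mu * cos gam * (psum (fun b => f (b - 1)) M + psum (fun b => g (b + 1)) M).
  by rewrite eS -efg; ring.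
rewrite !IH// -!psumD -!psumMl -!psumD -psumMl; apply: eq_psum => b /=.
rewrite /f /g -/gam -/y -/(Y b).
set be := pi * (b%:~R * alpha).
have -> : 2 * pi * b%:~R * (x + (j%:~R + (a + 1)%:~R / 2) * alpha) = Y b + be.
  by rewrite /Y /y /be intrD; field.
have -> : 2 * pi * b%:~R * (x + (j%:~R + (a - 1)%:~R / 2) * alpha) = Y b - be.
  by rewrite /Y /y /be intrB; field.
have -> : 2 * pi * b%:~R * (x + ((j - 1)%:~R + (a + 1)%:~R / 2) * alpha) = Y b - be.
  by rewrite /Y /y /be intrB intrD; field.
have -> : 2 * pi * b%:~R * (x + ((j + 1)%:~R + (a - 1)%:~R / 2) * alpha) = Y b + be.
  by rewrite /Y /y /be intrB intrD; field.
have -> : Y (b - 1) + Z = Y b by rewrite /Y /Z intrB; ring.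
have -> : Y (b + 1) - Z = Y b by rewrite /Y /Z intrD; ring.
by rewrite cosB cosD; field.
Qed.

Hypothesis irr : forall k : int, k != 0 -> sin (pi * (k%:~R * alpha)) != 0.

(** On the diagonal the frequency b = 0 gives the mean value; every other frequency gives a bounded
    ergodic sum by [cos_sum_le] and [irr]. *)
Lemma hker_diag_sum k : exists C : R, forall n : nat,
  `|\sum_(j < n) hker k j%:Z j%:Z - n%:R * wcoef mu k 0 0| <= C.
Proof.
pose q (b : int) : R := if b == 0 then 0 else `|wcoef mu k 0 b| / `|sin (pi * (b%:~R * alpha))|.
exists (psum q k) => n.
pose f (b : int) (j : nat) := cos (2 * pi * b%:~R * x + j%:R * (2 * (pi * (b%:~R * alpha)))).
have -> : \sum_(j < n) hker k j%:Z j%:Z = psum (fun b => wcoef mu k 0 b * \sum_(j < n) f b j) k.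
  transitivity (\sum_(j < n) psum (fun b => wcoef mu k 0 b * f b j) k).
    apply: eq_bigr => j _; rewrite -[X in hker _ _ X]addr0 (hker_wcoef _ _ (leqnn k)).
    apply: eq_psum => b; rewrite /f; congr (_ * cos _).
    by rewrite -pmulrn; ring.
  rewrite -(psum_sum _ (fun j b => wcoef mu k 0 b * f b j)); apply: eq_psum => b.
  by rewrite mulr_sumr.
have -> : n%:R * wcoef mu k 0 0 = psum (fun b => if b == 0 then n%:R * wcoef mu k 0 0 else 0) k.
  by rewrite psum_delta.
rewrite -mulN1r -psumMl -psumD; apply: le_trans (ler_norm_psum _ _) _.
apply: ler_psum => b; rewrite mulN1r /q; case: (eqVneq b 0) => [->|b0].
  rewrite (eq_bigr (fun=> 1)); last first.
    by move=> i _; rewrite /f mulr0 mul0r mul0r !mulr0 addr0 cos0.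
  by rewrite sumr_const card_ord mulrC subrr normr0.
rewrite subr0 normrM ler_wpM2l// -[X in _ <= X]mul1r ler_pdivlMr ?normr_gt0 ?irr//.
exact: cos_sum_le.
Qed.

Lemma tridiag_row (a : nat -> R) n (i : 'I_n) (f : int -> R) :
  f (-1) = 0 -> f n%:Z = 0 ->
  \sum_l tridiag 1 a n i l * f l%:Z = f (i%:Z + 1) + f (i%:Z - 1) + a i * f i%:Z.
Proof.
move=> f1 fn.
transitivity (\sum_(l < n) ((if i.+1 == l :> nat then f l%:Z else 0) +
   (if l.+1 == i :> nat then f l%:Z else 0) + (if l == i then a i * f l%:Z else 0))).
  apply: eq_bigr => l _; rewrite mxE [i == l]eq_sym -!val_eqE /=.
  case: (eqVneq (l : nat) i) => [->|li]; first by rewrite !gtn_eqF// !add0r.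
  rewrite addr0; case: eqP => [h|_]; case: eqP => [h'|_] /=; rewrite ?mul1r ?mul0r ?addr0 ?add0r//.
  by exfalso; lia.
rewrite !big_split/=; congr (_ + _ + _).
- rewrite -big_mkcond/=; have [h|h] := ltnP i.+1 n.
    rewrite (big_pred1 (Ordinal h)) /=; first by congr f; lia.
    by move=> l; rewrite /= -val_eqE /= eq_sym.
  have en : i.+1 = n by apply/eqP; rewrite eqn_leq h ltn_ord.
  rewrite big1; last by move=> l /eqP e; have := ltn_ord l; rewrite -e en ltnn.
  by rewrite -fn; congr f; lia.
- rewrite -big_mkcond/=; case: i => [[|m] hm] /=.
    by rewrite big1 ?sub0r// => l /eqP.
  rewrite (big_pred1 (Ordinal (ltnW hm))) /=; first by congr f; lia.
  by move=> l; rewrite /= -val_eqE /= eqSS.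
- by rewrite -big_mkcond/= big_pred1_eq.
Qed.

Definition hmx n : 'M[R]_n.+1 := tridiag 1 (fun m => site m%:Z) n.+1.

Lemma site_le m : `|site m| <= 2 * `|mu|.
Proof.
rewrite /site !normrM normr_nat -[X in _ <= X]mulr1 ler_wpM2l ?mulr_ge0//.
by rewrite ler_norml cos_geN1 cos_le1.
Qed.

(** In k steps the operator does not leave the box 0..n when it starts from a column at distance at
    least k from both edges, so the truncation is not felt. *)
Lemma hmx_pow k n (i j : 'I_n.+1) : (k <= j)%N -> (j + k <= n)%N ->
  (hmx n ^+ k) i j = hker k j%:Z i%:Z.
Proof.
elim: k i => [|k IH] i kj jk.
  rewrite expr0 mxE /hker /dl /= -val_eqE /= eqz_nat.
  by case: eqP.
rewrite exprS -mulmxE mxE hkerSl.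
rewrite -(tridiag_row (fun m => site m%:Z) (n := n.+1) i); last first.
- by apply: hker_supp; lia.
- by apply: hker_supp; lia.
by apply: eq_bigr => l _; rewrite IH//; lia.
Qed.

Let B : R := 2 * `|mu| + 2.

Let B0 : 0 <= B. Proof. by rewrite addr_ge0// mulr_ge0. Qed.

Lemma hmx_col n (j : 'I_n.+1) : \sum_i `|hmx n i j| <= 2 * `|mu| + 2.
Proof.
have := tridiag_col 1 j (fun k => site_le k%:Z).
by rewrite normr1 mulr1.
Qed.

Lemma hmx_pow_col k n (j : 'I_n.+1) : \sum_i `|(hmx n ^+ k) i j| <= B ^+ k.
Proof.
elim: k j => [|k IH] j.
  rewrite expr0 (bigD1 j)//= big1 ?addr0; first by rewrite mxE eqxx normr1.
  by move=> i /negbTE ij; rewrite mxE ij normr0.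
rewrite exprSr -mulmxE.
apply: (@le_trans _ _ (\sum_i \sum_l `|(hmx n ^+ k) i l| * `|hmx n l j|)).
  apply: ler_sum => i _; rewrite mxE; apply: le_trans (ler_norm_sum _ _ _) _.
  by apply: ler_sum => l _; rewrite normrM.
rewrite exchange_big/= exprSr.
apply: (@le_trans _ _ (\sum_l B ^+ k * `|hmx n l j|)).
  by apply: ler_sum => l _; rewrite -mulr_suml ler_wpM2r.
by rewrite -mulr_sumr ler_wpM2l ?exprn_ge0// hmx_col.
Qed.

Lemma hmx_pow_le k n (i j : 'I_n.+1) : `|(hmx n ^+ k) i j| <= B ^+ k.
Proof.
by apply: le_trans (hmx_pow_col k j); rewrite (bigD1 i)//= lerDl sumr_ge0.
Qed.

Lemma hker_le k j m : `|hker k j m| <= B ^+ k.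
Proof.
elim: k m => [|k IH] m.
  by rewrite expr0 /hker /dl /=; case: ifP => _; rewrite ?normr1 ?normr0.
rewrite hkerSl; have -> : B ^+ k.+1 = B ^+ k + B ^+ k + 2 * `|mu| * B ^+ k.
  by rewrite exprS {1}/B; ring.
apply: le_trans (ler_normD _ _) _; rewrite lerD//.
  by apply: le_trans (ler_normD _ _) _; rewrite lerD.
by rewrite normrM ler_pM// site_le.
Qed.

Lemma count_ltn (n k : nat) (c : R) : 0 <= c -> \sum_(j < n) (if (j < k)%N then c else 0) <= k%:R * c.
Proof.
move=> c0; suff : \sum_(j < n) (if (j < k)%N then c else 0) <= (minn n k)%:R * c.
  by move=> h; apply: le_trans h _; rewrite ler_wpM2r// ler_nat geq_minr.
elim: n => [|n IH]; first by rewrite big_ord0 min0n mul0r.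
rewrite big_ord_recr/=; case: ltnP => nk.
  rewrite (minn_idPl nk) -natr1 mulrDl mul1r lerD2r.
  by rewrite (minn_idPl (ltnW nk)) in IH.
by rewrite addr0; move: IH; rewrite (minn_idPr nk) (minn_idPr (leqW nk)).
Qed.

(** At most k diagonal entries near each edge differ from those of the infinite operator, each by at
    most 2 B^k; the rest is [hker_diag_sum]. *)
Lemma trace_hmx k : exists C : R, forall n : nat,
  `|\tr (hmx n ^+ k) - n.+1%:R * wcoef mu k 0 0| <= C.
Proof.
have [C hC] := hker_diag_sum k.
exists (2 * (k%:R * (2 * B ^+ k)) + C) => n.
rewrite -(subrK (\sum_(j < n.+1) hker k j%:Z j%:Z) (\tr _)) -addrA.
apply: le_trans (ler_normD _ _) _; rewrite lerD//.
rewrite /mxtrace -sumrB; apply: le_trans (ler_norm_sum _ _ _) _.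
have c0 : 0 <= 2 * B ^+ k by rewrite mulr_ge0// exprn_ge0.
apply: (@le_trans _ _ (\sum_(j < n.+1) ((if (j < k)%N then 2 * B ^+ k else 0) +
  (if (n < j + k)%N then 2 * B ^+ k else 0)))).
  apply: ler_sum => j _.
  have tr : `|(hmx n ^+ k) j j - hker k j%:Z j%:Z| <= 2 * B ^+ k.
    rewrite mulr_natl [X in _ <= X]mulr2n; apply: le_trans (ler_normB _ _) _.
    by rewrite lerD// ?hmx_pow_le// hker_le.
  case: ltnP => h1; first by apply: (le_trans tr); rewrite lerDl; case: ifP.
  case: ltnP => h2; first by rewrite add0r.
  by rewrite hmx_pow// subrr normr0 addr0.
rewrite big_split/= [X in _ <= X]mulr_natl [X in _ <= X]mulr2n; apply: lerD; first exact: count_ltn.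
rewrite (reindex_inj rev_ord_inj)/=.
rewrite (eq_bigr (fun j : 'I_n.+1 => if (j < k)%N then 2 * B ^+ k else 0)) ?count_ltn//.
by move=> j _; congr (if _ then _ else _); have := ltn_ord j; lia.
Qed.

End Kernel.


(** * Growth of the determinants at an eigenvalue *)

Section LogPoly.
Variable R : realType.

Lemma is_derive_poly_exp (p q : {poly R}) (x : R) :
  is_derive x 1 (fun t => q.[t] * expR p.[t])
    ((q^`().[x] + q.[x] * p^`().[x]) * expR p.[x]).
Proof.
have dp : is_derive x 1 (horner p) p^`().[x].
  by apply: DeriveDef; [exact: derivable_horner|rewrite -derive1E derivE].
have dq : is_derive x 1 (horner q) q^`().[x].
  by apply: DeriveDef; [exact: derivable_horner|rewrite -derive1E derivE].
have de : is_derive x 1 (expR \o horner p) (p^`().[x] * expR p.[x]).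
  apply: is_derive_eq; rewrite /GRing.scale/= mulrC; congr (_ * _).
apply: is_derive_eq.
by rewrite /GRing.scale/=; ring.
Qed.

(** [p] is a Taylor polynomial of -log(1 - t); in exponential form no logarithm of a determinant is
    ever taken. *)
Lemma log_poly (r e : R) : 0 <= r < 1 -> 0 < e ->
  exists p : {poly R}, forall t, 0 <= t <= r ->
    (1 - t <= expR (- p.[t])) /\ (expR (- p.[t]) <= (1 - t) * expR e).
Proof.
move=> /andP[r0 r1] e0.
have [K hK] : exists K, r ^+ K <= e * (1 - r).
  have cv : (fun n => r ^+ n) @ \oo --> (0 : R) by apply: cvg_expr; rewrite ger0_norm.
  have ep : 0 < e * (1 - r) by rewrite mulr_gt0// subr_gt0.
  have /cvgrPdist_le/(_ _ ep)[N _ hN] := cv.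
  exists N; have := hN N (leqnn _); rewrite sub0r normrN ger0_norm// exprn_ge0//.
pose p : {poly R} := \sum_(k < K) (k.+1%:R)^-1 *: 'X^(k.+1).
have dp t : p^`().[t] = \sum_(k < K) t ^+ k.
  rewrite /p raddf_sum horner_sum; apply: eq_bigr => k _.
  by rewrite /= derivZ derivXn hornerZ hornerMn hornerXn -[t ^+ _ *+ _]mulr_natl mulrA mulVf ?mul1r// pnatr_eq0.
have gs t : (1 - t) * \sum_(k < K) t ^+ k = 1 - t ^+ K.
  by have := subrX1 t K => h; rewrite -opprB mulNr -h opprB.
have p0 : p.[0] = 0.
  by rewrite /p horner_sum big1// => k _; rewrite hornerZ hornerXn expr0n/= mulr0.
exists p => t /andP[t0 tr].
have t1 : 0 < 1 - t by rewrite subr_gt0 (le_lt_trans tr).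
have q1 (s : R) : (1 - 'X : {poly R}).[s] = 1 - s by rewrite !hornerE.
have dq1 (s : R) : (1 - 'X : {poly R})^`().[s] = -1.
  by rewrite derivB derivC derivX sub0r hornerN hornerC.
have cont_w (p' q' : {poly R}) (a b : R) : {within `[a, b], continuous (fun t => q'.[t] * expR p'.[t])}.
  apply: continuous_subspaceT => s; apply: differentiable_continuous.
  by apply/derivable1_diffP; exact: (@ex_derive _ _ _ _ _ _ _ (is_derive_poly_exp p' q' s)).
split.
  (* (1 - t) exp (p t) has derivative - t^K exp (p t) <= 0, and (1 - t) exp (p t + e t) is nondecreasing. *)
  have [c] := MVT_segment t0 (fun x _ => is_derive_poly_exp p (1 - 'X) x) (cont_w _ _ _ _).
  rewrite in_itv/= => /andP[c0 ct].
  rewrite !q1 p0 subr0 expR0 mulr1 subr0 dq1 dp gs.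
  move/eqP; rewrite subr_eq => /eqP h.
  rewrite expRN -[X in _ <= X]mul1r ler_pdivlMr ?expR_gt0// h -lerBrDr subrr.
  rewrite [-1 + _]addrC addrAC subrr sub0r mulNr mulNr oppr_le0.
  by rewrite !mulr_ge0 ?expR_ge0// exprn_ge0.
have pe0 : (p + e *: 'X).[0] = 0 by rewrite hornerD p0 hornerZ hornerX mulr0 addr0.
have dpe (s : R) : (p + e *: 'X)^`().[s] = \sum_(k < K) s ^+ k + e.
  by rewrite derivD derivZ derivX hornerD dp hornerZ hornerC mulr1.
have [c] := MVT_segment t0 (fun x _ => is_derive_poly_exp (p + e *: 'X) (1 - 'X) x) (cont_w _ _ _ _).
rewrite in_itv/= => /andP[c0 ct].
rewrite !q1 pe0 !subr0 expR0 mulr1 dq1 dpe mulrDr gs => h.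
have cr : c <= r by exact: le_trans ct tr.
have low : 0 <= (-1 + (1 - c ^+ K + (1 - c) * e)) * expR (p + e *: 'X).[c] * t.
  rewrite !mulr_ge0 ?expR_ge0//.
  have : c ^+ K <= r ^+ K by rewrite lerXn2r// nnegrE.
  have : 0 <= (r - c) * e by rewrite mulr_ge0 ?subr_ge0// ltW.
  lra.
rewrite -h subr_ge0 hornerD hornerZ hornerX expRD in low.
rewrite expRN -[X in X <= _]mul1r ler_pdivrMr ?expR_gt0//.
apply: (le_trans low); rewrite mulrA mulrAC ler_wpM2r ?expR_ge0// ler_wpM2l ?ltW//.
by rewrite ltr_expR -[X in _ < X]mulr1 ltr_pM2l// (le_lt_trans tr).
Qed.

End LogPoly.

(** * Determinant growth under a complex energy shift *)

Section Duhamel.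

(** Discrete Duhamel formula: the sum runs over the last perturbed site j, with a perturbed
    continuant before it and an unperturbed one after it. *)
Lemma cont_shift_energy (K : comNzRingType) (a : nat -> K) (d : K) n :
  cont (fun k => a k + d) n = cont a n +
   d * \sum_(j < n) cont (fun k => a (j.+1 + k)%N) (n - j.+1) * cont (fun k => a k + d) j.
Proof.
set u := cont (fun k => a k + d).
pose S n := \sum_(j < n) cont (fun k => a (j.+1 + k)%N) (n - j.+1) * u j.
(* [S] solves the unperturbed recursion with source [u]: each unperturbed factor is expanded at its
   last entry. *)
have SS m : S m.+2 = a m.+1 * S m.+1 - S m + u m.+1.
  rewrite /S !big_ord_recr/= !subnn subSnn !mul1r.
  rewrite [cont _ 1](_ : _ = a m.+1); last by rewrite /= addn0.
  rewrite mulrDr.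
  rewrite [X in X + _ + _](_ : _ = a m.+1 * (\sum_(i < m) cont (fun k => a (i.+1 + k)%N) (m.+1 - i.+1) * u i) -
     \sum_(j < m) cont (fun k => a (j.+1 + k)%N) (m - j.+1) * u j); first by ring.
  rewrite mulr_sumr -sumrB; apply: eq_bigr => i _.
  have im := ltn_ord i.
  have -> : (m.+2 - i.+1 = (m - i.+1).+2)%N by lia.
  have -> : (m.+1 - i.+1 = (m - i.+1).+1)%N by lia.
  rewrite contSSr; have -> : (i.+1 + (m - i.+1).+1 = m.+1)%N by lia.
  ring.
suff [] : u n = cont a n + d * S n /\ u n.+1 = cont a n.+1 + d * S n.+1 by [].
elim: n => [|n [IH1 IH2]].
  by rewrite /S big_ord0 mulr0 addr0 big_ord1/= /u /= !mulr1.
split=> //; rewrite SS {1}/u contSSr -/u contSSr.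
rewrite mulrDr mulrBr; rewrite [u n.+1 in LHS]IH2 [u n in LHS]IH1 !IH2; ring.
Qed.

Variable R : realType.

(** Induction with the constant 2A: the geometric sum gives rho^n / (rho - sg), and the size allowed
    for [d] reduces the Duhamel term to A rho^n times A/(A + 1), within the second half of 2A. *)
Lemma cont_energy_bound (a : nat -> R[i]) (d : R[i]) (A sg rho : R) (n : nat) :
  0 <= A -> 0 <= sg -> sg < rho -> (forall j m, `|cont (fun k => a (j + k)%N) m| <= (A * sg ^+ m)%:C%C) ->
  `|d| <= ((rho - sg) / (2 * (A + 1)))%:C%C ->
  `|cont (fun k => a k + d) n| <= (2 * A * rho ^+ n)%:C%C.
Proof.
move=> A0 s0 sr hA hd.
have rho0 : 0 <= rho by rewrite (le_trans s0)// ltW.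
have A1 : 0 < A + 1 by rewrite ltr_wpDl.
elim/ltn_ind: n => n IH.
rewrite cont_shift_energy; apply: le_trans (ler_normD _ _) _.
have h1 : `|cont a n| <= (A * rho ^+ n)%:C%C.
  apply: le_trans (hA 0%N n) _; rewrite lecR ler_wpM2l//.
  by rewrite lerXn2r ?nnegrE// ltW.
have h2 : `|d * \sum_(j < n) cont (fun k => a (j.+1 + k)%N) (n - j.+1) * cont (fun k => a k + d) j|
   <= (A * rho ^+ n)%:C%C.
  rewrite normrM.
  have hs : `|\sum_(j < n) cont (fun k => a (j.+1 + k)%N) (n - j.+1) * cont (fun k => a k + d) j| <=
     (2 * A * A * (rho ^+ n / (rho - sg)))%:C%C.
    apply: le_trans (ler_norm_sum _ _ _) _.
    apply: (@le_trans _ _ (\sum_(j < n) (A * sg ^+ (n - j.+1) * (2 * A * rho ^+ j))%:C%C)).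
      apply: ler_sum => j _; rewrite normrM rmorphM ler_pM//.
      exact: IH.
    rewrite -rmorph_sum lecR.
    rewrite (eq_bigr (fun j : 'I_n => 2 * A * A * (rho ^+ (n.-1 - (n.-1 - j)) * sg ^+ (n.-1 - j)))); last first.
      move=> j _; have jn := ltn_ord j.
      have -> : (n.-1 - (n.-1 - j) = j)%N by lia.
      have -> : (n.-1 - j = n - j.+1)%N by lia.
      ring.
    rewrite -mulr_sumr ler_wpM2l ?mulr_ge0// ler_pdivlMr ?subr_gt0//.
    rewrite mulrC (reindex_inj rev_ord_inj)/=.
    rewrite (eq_bigr (fun j : 'I_n => rho ^+ (n.-1 - j) * sg ^+ j)); last first.
      move=> j _; have jn := ltn_ord j.
      by have -> : (n.-1 - (n - j.+1) = j)%N by lia.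
    rewrite -subrXX lerBlDr lerDl exprn_ge0//.
  apply: le_trans (ler_pM _ _ hd hs) _ => //.
  rewrite -rmorphM lecR.
  have rs : 0 < rho - sg by rewrite subr_gt0.
  have -> : (rho - sg) / (2 * (A + 1)) * (2 * A * A * (rho ^+ n / (rho - sg))) =
     A * rho ^+ n * (A / (A + 1)) by field; rewrite !gt_eqF.
  rewrite -[X in _ <= X]mulr1 ler_wpM2l//.
    by rewrite mulr_ge0// exprn_ge0.
  by rewrite ler_pdivrMr// mul1r lerDl.
apply: le_trans (lerD h1 h2) _; rewrite -rmorphD lecR; lra.
Qed.

End Duhamel.


(** * Transfer of the dual bound to the determinants of H *)

Section Growth.
Variable R : realType.
Variables (lam alpha E C : R).
Hypothesis lam_gt0 : 0 < lam.
Hypothesis irr : forall k : int, k != 0 -> sin (pi * (k%:~R * alpha)) != 0.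
Hypothesis C0 : 0 <= C.
Hypothesis dual : forall (x : R) (n : nat),
    `|cont (fun k => E / lam - 2 * lam^-1 * cos (2 * pi * (x + k%:R * alpha))) n|
      <= C * n.+1%:R.

Local Notation toC := (real_complex R).

Lemma hmx_spectrum mu x n : exists e : 'I_n.+1 -> R,
  [/\ forall k, \tr (hmx alpha mu x n ^+ k) = \sum_i e i ^+ k,
      forall z, cont (fun k => z - toC (site alpha mu x k%:Z)) n.+1 = \prod_i (z - toC (e i)) &
      forall i, `|e i| <= 2 * `|mu| + 2].
Proof.
have symH : (hmx alpha mu x n)^T = hmx alpha mu x n.
  apply/matrixP => i j; rewrite !mxE eq_sym.
  case: eqP => [->//|_]; congr (if _ then _ else _).
  by rewrite orbC.
have [e [h1 h2 h3]] := sym_spectrum symH.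
exists e; split=> //.
  move=> z; rewrite -h2 -det_tridiag; congr (\det _); apply/matrixP => i j.
  rewrite !mxE; case: eqP => [->|_]; rewrite ?mulr1n// mulr0n.
  by case: ifP; rewrite ?sub0r ?subr0 ?rmorph1 ?rmorph0 ?oppr0.
move=> i; have [v v0 hv] := h3 i.
by apply: eigenvalue_le v0 hv _ => j; exact: hmx_col.
Qed.

Lemma cont_complex (a : nat -> R) m : toC (cont a m) = cont (fun k => toC (a k)) m.
Proof.
suff [] : (forall a, toC (cont a m) = cont (fun k => toC (a k)) m) /\
  (forall a, toC (cont a m.+1) = cont (fun k => toC (a k)) m.+1) by [].
clear a; elim: m => [|m [IH1 IH2]]; first by split=> b; rewrite /= ?rmorph1.
split=> // b; rewrite !contSS rmorphB rmorphM; congr (_ * _ - _); [exact: IH2|exact: IH1].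
Qed.

Lemma cont_prod mu x n (e : 'I_n.+1 -> R) (z : R) :
  (forall z, cont (fun k => z - toC (site alpha mu x k%:Z)) n.+1 = \prod_i (z - toC (e i))) ->
  cont (fun k => z - site alpha mu x k%:Z) n.+1 = \prod_i (z - e i).
Proof.
move=> h; apply: (@complexI R).
rewrite cont_complex rmorph_prod.
rewrite (@eq_cont _ _ (fun k => toC z - toC (site alpha mu x k%:Z))); last first.
  by move=> k _; rewrite rmorphB.
by rewrite h; apply: eq_bigr => i _; rewrite rmorphB.
Qed.

(** Both traces are n + 1 times a constant up to bounded errors, and [wcoef_dual] identifies the
    constants. These do not depend on the phase, so the dual phase is fixed at 0. *)
Lemma moment_compare (x : R) (k : nat) : exists D : R, forall n : nat,
  `|lam ^- k * \tr (hmx alpha lam x n ^+ k) - \tr (hmx alpha lam^-1 0 n ^+ k)| <= D.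
Proof.
have [D1 h1] := trace_hmx lam x irr k.
have [D2 h2] := trace_hmx lam^-1 0 irr k.
exists (lam ^- k * D1 + D2) => n.
have lk : 0 < lam ^+ k by rewrite exprn_gt0.
have := h2 n; have := h1 n.
rewrite wcoef_dual ?gt_eqF//.
set t1 := \tr _; set t2 := \tr _; set w := wcoef _ _ _ _ _ => H1 H2.
have -> : lam ^- k * t1 - t2 = lam ^- k * (t1 - n.+1%:R * (lam ^+ k * w)) - (t2 - n.+1%:R * w).
  by field; rewrite gt_eqF.
apply: le_trans (ler_normB _ _) _; rewrite lerD// normrM ger0_norm ?invr_ge0 ?(ltW lk)//.
by rewrite ler_pM2l// invr_gt0.
Qed.

Lemma poly_compare (x : R) (g : {poly R}) : exists D : R, forall (n : nat) (e f : 'I_n.+1 -> R),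
  (forall k, \tr (hmx alpha lam x n ^+ k) = \sum_i e i ^+ k) ->
  (forall k, \tr (hmx alpha lam^-1 0 n ^+ k) = \sum_i f i ^+ k) ->
  `|\sum_i g.[e i / lam] - \sum_i g.[f i]| <= D.
Proof.
have /choice[D hD] := moment_compare x.
exists (\sum_(k < size g) `|g`_k| * D k) => n e f he hf.
have sg (h : 'I_n.+1 -> R) : \sum_i g.[h i] = \sum_(k < size g) g`_k * \sum_i h i ^+ k.
  under eq_bigr do rewrite horner_coef.
  by rewrite exchange_big; apply: eq_bigr => k _; rewrite mulr_sumr.
rewrite (sg (fun i => e i / lam)) sg -sumrB; apply: le_trans (ler_norm_sum _ _ _) _.
apply: ler_sum => k _; rewrite -mulrBr normrM ler_wpM2l//.
apply: le_trans (hD k n); rewrite he hf mulr_sumr.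
by under eq_bigr do rewrite expr_div_n mulrC.
Qed.

(** The linear bound is weakened to rate ep/4, which [cont_energy_bound] turns into rate ep/2 at
    E/lam + i eta; squaring the modulus gives rate ep and the constant (2A)^2. *)
Lemma dual_offaxis (ep : R) : 0 < ep -> exists eta K : R, [/\ 0 < eta, 0 <= K &
  forall n (f : 'I_n.+1 -> R),
  (forall z, cont (fun k => z - toC (site alpha lam^-1 0 k%:Z)) n.+1 = \prod_i (z - toC (f i))) ->
  \prod_i ((f i - E / lam) ^+ 2 + eta ^+ 2) <= K * expR (ep * n.+1%:R)].
Proof.
move=> ep0.
pose sg := expR (ep / 4); pose rho := expR (ep / 2).
have sr : sg < rho by rewrite ltr_expR; lra.
(* Chosen because (1 + 4/ep)(1 + ep n/4) >= n + 1, combined with 1 + y <= e^y. *)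
pose A := C * (1 + 4 / ep).
have A0 : 0 <= A by rewrite mulr_ge0// addr_ge0// divr_ge0// ltW.
have hA (x : R) n : `|cont (fun k => E / lam - 2 * lam^-1 * cos (2 * pi * (x + k%:R * alpha))) n| <= A * sg ^+ n.
  apply: le_trans (dual x n) _; rewrite /A -mulrA ler_wpM2l//.
  rewrite /sg -expRM_natl; set y := (n%:R * _).
  have y0 : 0 <= y by rewrite mulr_ge0// divr_ge0// ltW.
  apply: (@le_trans _ _ ((1 + 4 / ep) * (1 + y))); last first.
    by rewrite ler_wpM2l ?expR_ge1Dx// addr_ge0// divr_ge0// ltW.
  have -> : (1 + 4 / ep) * (1 + y) = n.+1%:R + (4 / ep + y).
    by rewrite /y -natr1; field; rewrite gt_eqF.
  by rewrite lerDl addr_ge0// divr_ge0// ltW.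
pose eta := (rho - sg) / (2 * (A + 1)).
have eta0 : 0 < eta by rewrite divr_gt0 ?subr_gt0// mulr_gt0// ltr_wpDl.
exists eta, ((2 * A) ^+ 2); split=> //; first by rewrite sqr_ge0.
move=> n f hf.
pose d : R[i] := 'i%C * toC eta.
have nd : `|d| = toC eta.
  by rewrite normc_def /d/= !mul0r !mul1r ?add0r ?oppr0 ?expr0n/= ?sub0r ?oppr0 ?addr0 ?mulr0 ?expr0n/= ?add0r sqrtr_sqr ger0_norm// ltW.
have bound : `|cont (fun k => toC (E / lam - site alpha lam^-1 0 k%:Z) + d) n.+1|
    <= (2 * A * rho ^+ n.+1)%:C%C.
  apply: (cont_energy_bound (sg := sg)) => //; last by rewrite nd.
  - exact: expR_ge0.
  - move=> j m; rewrite -(cont_complex (fun k => E / lam - site alpha lam^-1 0 (j + k)%N%:Z)).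
    have -> : `|toC (cont (fun k => E / lam - site alpha lam^-1 0 (j + k)%N%:Z) m)| =
       toC `|cont (fun k => E / lam - site alpha lam^-1 0 (j + k)%N%:Z) m|.
      by rewrite normc_def/= expr0n/= addr0 sqrtr_sqr.
    rewrite lecR; apply: le_trans (hA (j%:R * alpha) m).
    rewrite le_eqVlt; apply/orP; left; apply/eqP; congr `|_|; apply: eq_cont => k _.
    by rewrite /site -pmulrn natrD; congr (_ - _ * cos (_ * _)); ring.
rewrite (@eq_cont _ _ (fun k => (toC (E / lam) + d) - toC (site alpha lam^-1 0 k%:Z))) in bound; last first.
  by move=> k _; rewrite rmorphB addrAC.
rewrite hf normr_prod in bound.
have e1 i : `|toC (E / lam) + d - toC (f i)| ^+ 2 = toC ((f i - E / lam) ^+ 2 + eta ^+ 2).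
  rewrite -add_Re2_Im2; congr toC; rewrite /d/= !mul0r !mul1r ?mulr0 ?subr0 ?add0r ?addr0 ?subr0 ?oppr0 ?addr0.
  by ring.
have e2 : toC (\prod_i ((f i - E / lam) ^+ 2 + eta ^+ 2)) = (\prod_i `|toC (E / lam) + d - toC (f i)|) ^+ 2.
  by rewrite rmorph_prod -prodrXl; apply: eq_bigr => i _; rewrite e1.
rewrite -lecR e2.
have -> : (2 * A) ^+ 2 * expR (ep * n.+1%:R) = (2 * A * rho ^+ n.+1) ^+ 2.
  by rewrite [RHS]exprMn /rho -[in RHS]exprM -[in RHS]expRM_natl; congr (_ * expR _); rewrite natrM; field.
rewrite rmorphXn lerXn2r// ?nnegrE.
  by rewrite prodr_ge0.
by rewrite ler0c mulr_ge0 ?exprn_ge0 ?expR_ge0// mulr_ge0.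
Qed.

Lemma supercritical_growth (x ep : R) : 0 < ep -> exists N : nat, forall n, (N <= n)%N ->
  `|cont (fun k => E - 2 * lam * cos (2 * pi * (x + k%:R * alpha))) n| <= lam ^+ n * expR (ep * n%:R).
Proof.
move=> ep20; pose ep1 := ep / 2; have ep0 : 0 < ep1 by rewrite divr_gt0.
have [eta [K [eta0 K0 hK]]] := dual_offaxis ep0.
(* The spectra of H/lam and of its dual both lie within (2 lam + 2)/lam of 0, hence within [B] of
   E/lam. *)
pose B := (2 * lam + 2 + `|E|) / lam.
have B0 : 0 <= B by rewrite divr_ge0 ?(ltW lam_gt0)// addr_ge0// addr_ge0// mulr_ge0// ltW.
pose c := B ^+ 2 + eta ^+ 2.
have c0 : 0 < c by rewrite ltr_wpDl ?sqr_ge0// exprn_gt0.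
(* Normalised so that 1 - t = ((y - E/lam)^2 + eta^2)/c; eta > 0 keeps t at most B^2/c < 1, away
   from the singularity of the logarithm. *)
pose t (y : R) := (B ^+ 2 - (y - E / lam) ^+ 2) / c.
pose tp : {poly R} := c^-1 *: ((B ^+ 2)%:P - ('X - (E / lam)%:P) ^+ 2).
have tpE y : tp.[y] = t y by rewrite /tp /t !hornerE mulrC.
have r1 : 0 <= B ^+ 2 / c < 1.
  rewrite divr_ge0 ?sqr_ge0 ?ltW//= ltr_pdivrMr// mul1r ltrDl exprn_gt0//.
have [p hp] := log_poly r1 ep0.
have [D hD] := poly_compare x (p \Po tp).
have trange y : `|y| <= (2 * lam + 2) / lam -> 0 <= t y <= B ^+ 2 / c.
  move=> hy.
  have hy2 : `|y - E / lam| <= B.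
    apply: le_trans (ler_normB _ _) _; rewrite normrM normfV [`|lam|]gtr0_norm//.
    by rewrite /B mulrDl lerD.
  have hy3 : (y - E / lam) ^+ 2 <= B ^+ 2.
    by rewrite -[X in X <= _]real_normK ?num_real// lerXn2r ?nnegrE.
  by rewrite /t divr_ge0 ?subr_ge0 ?(ltW c0)//= ler_pM2r ?invr_gt0// gerBl sqr_ge0.
have onet y : 1 - t y = ((y - E / lam) ^+ 2 + eta ^+ 2) / c.
  have cn : c != 0 by rewrite gt_eqF.
  rewrite /t -(divff cn) -mulrBl; congr (_ / _); rewrite /c; ring.
have [N hN] : exists N : nat, K * expR D <= expR (ep1 * N%:R).
  exists (Num.Def.archi_bound (K * expR D / ep1)).
  have k0 : 0 <= K * expR D / ep1 by rewrite divr_ge0 ?(ltW ep0)// mulr_ge0// expR_ge0.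
  have := archi_boundP k0; rewrite ltr_pdivrMr// => h.
  by apply: le_trans (expR_ge1Dx _); rewrite [ep1 * _]mulrC; apply: ltW; apply: lt_trans h _; rewrite ltrDr.
exists N.+1 => -[//|n] nN.
have [e [he1 he2 he3]] := hmx_spectrum lam x n.
have [f [hf1 hf2 hf3]] := hmx_spectrum lam^-1 0 n.
have {}hD := hD n e f he1 hf1.
have {}hK := hK n f hf2.
have eE : cont (fun k => E - 2 * lam * cos (2 * pi * (x + k%:R * alpha))) n.+1 = \prod_i (E - e i).
  by rewrite -(cont_prod _ he2).
have re i : 0 <= t (e i / lam) <= B ^+ 2 / c.
  apply: trange; rewrite normrM normfV (gtr0_norm lam_gt0) ler_pM2r ?invr_gt0//.
  by have := he3 i; rewrite (gtr0_norm lam_gt0).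
have rf i : 0 <= t (f i) <= B ^+ 2 / c.
  apply: trange; have := hf3 i; rewrite (@gtr0_norm _ lam^-1) ?invr_gt0// => h.
  apply: le_trans h _; rewrite le_eqVlt; apply/orP; left; apply/eqP.
  by field; rewrite gt_eqF.
(* Adding lam^2 eta^2 to every factor only enlarges the product; only the half 1 - t <= exp(-p) is
   used on this side, the other half in [h2]. *)
have h1 : (\prod_i (E - e i)) ^+ 2 <= lam ^+ (2 * n.+1) * c ^+ n.+1 * expR (- \sum_i (p \Po tp).[e i / lam]).
  rewrite -prodrXl -sumrN expR_sum.
  have -> : lam ^+ (2 * n.+1) * c ^+ n.+1 * \prod_i expR (- (p \Po tp).[e i / lam]) =
     \prod_(i < n.+1) (lam ^+ 2 * c * expR (- (p \Po tp).[e i / lam])).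
    have -> : lam ^+ (2 * n.+1) = \prod_(i < n.+1) (lam ^+ 2) by rewrite prodr_const card_ord exprM.
    have -> : c ^+ n.+1 = \prod_(i < n.+1) c by rewrite prodr_const card_ord.
    by rewrite -!big_split.
  apply: ler_prod => i _; rewrite sqr_ge0/=.
  have [h _] := hp _ (re i).
  rewrite horner_comp tpE.
  apply: le_trans (ler_wpM2l _ h); last by rewrite mulr_ge0 ?sqr_ge0// ltW.
  rewrite onet.
  have -> : lam ^+ 2 * c * (((e i / lam - E / lam) ^+ 2 + eta ^+ 2) / c) = (E - e i) ^+ 2 + lam ^+ 2 * eta ^+ 2.
    by field; rewrite !gt_eqF.
  by rewrite lerDl mulr_ge0 ?sqr_ge0.
have h2 : expR (- \sum_i (p \Po tp).[f i]) * c ^+ n.+1 <= K * expR (ep1 * n.+1%:R) * expR (ep1 * n.+1%:R).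
  apply: (@le_trans _ _ (\prod_i ((f i - E / lam) ^+ 2 + eta ^+ 2) * expR (ep1 * n.+1%:R))); last first.
    by rewrite ler_wpM2r ?expR_ge0.
  have -> : expR (ep1 * n.+1%:R) = \prod_(i < n.+1) expR ep1.
    by rewrite prodr_const card_ord mulrC expRM_natl.
  have -> : c ^+ n.+1 = \prod_(i < n.+1) c by rewrite prodr_const card_ord.
  rewrite -sumrN expR_sum -!big_split/=; apply: ler_prod => i _.
  rewrite mulr_ge0 ?expR_ge0 ?(ltW c0)//=.
  have [_ h] := hp _ (rf i).
  rewrite horner_comp tpE.
  apply: le_trans (ler_wpM2r (ltW c0) h) _.
  by rewrite onet mulrAC divfK ?gt_eqF.
have h3 : expR (- \sum_i (p \Po tp).[e i / lam]) <= expR D * expR (- \sum_i (p \Po tp).[f i]).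
  rewrite -expRD ler_expR; move: hD; rewrite ler_norml => /andP[]; lra.
have lp : 0 < lam ^+ (2 * n.+1) by rewrite exprn_gt0.
(* The square on the right carries e^{4 ep1 (n+1)}: two factors are the losses of [hK] and
   [log_poly], the other two absorb K e^D. *)
have main : (\prod_i (E - e i)) ^+ 2 <= (lam ^+ n.+1 * expR (2 * ep1 * n.+1%:R)) ^+ 2.
  apply: (le_trans h1).
  apply: (@le_trans _ _ (lam ^+ (2 * n.+1) * (expR D * (K * expR (ep1 * n.+1%:R) * expR (ep1 * n.+1%:R))))).
    rewrite -mulrA ler_pM2l//.
    apply: (@le_trans _ _ (expR D * (expR (- \sum_i (p \Po tp).[f i]) * c ^+ n.+1))).
      by rewrite mulrA mulrC ler_wpM2r// exprn_ge0// ltW.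
    by rewrite ler_wpM2l ?expR_ge0.
  rewrite exprMn -exprM [(n.+1 * 2)%N]mulnC ler_pM2l//.
  have -> : expR D * (K * expR (ep1 * n.+1%:R) * expR (ep1 * n.+1%:R)) =
    K * expR D * (expR (ep1 * n.+1%:R) * expR (ep1 * n.+1%:R)) by ring.
  have -> : expR (2 * ep1 * n.+1%:R) ^+ 2 = expR (ep1 * n.+1%:R) * expR (ep1 * n.+1%:R) * (expR (ep1 * n.+1%:R) * expR (ep1 * n.+1%:R)).
    by rewrite expr2 -!expRD; congr expR; ring.
  rewrite ler_wpM2r ?mulr_ge0 ?expR_ge0//.
  apply: (le_trans hN); rewrite -expRD ler_expR -mulrDr ler_pM2l//.
  by rewrite -natrD ler_nat (leq_trans (ltnW nN))// leq_addr.
have -> : ep * n.+1%:R = 2 * ep1 * n.+1%:R by rewrite /ep1; field.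
rewrite eE -ler_sqr ?nnegrE ?normr_ge0//; last by rewrite mulr_ge0 ?expR_ge0// exprn_ge0// ltW.
by rewrite real_normK ?num_real.
Qed.

End Growth.


(** * Completeness of a maximal orthonormal system *)

Section Completeness.
Variable R : realType.
Local Notation T := (int * bool)%type.
Implicit Types (f g h : T -> R) (N S : nat).

(** Real l2 over Z x bool: [false] and [true] label the real and imaginary parts at a site. *)
Definition wsum h N : R := psum (fun k => h (k, false) + h (k, true)) N.

Lemma eq_wsum f g N : (forall p, f p = g p) -> wsum f N = wsum g N.
Proof. by move=> e; apply: eq_psum => k; rewrite !e. Qed.

Lemma wsumD f g N : wsum (fun p => f p + g p) N = wsum f N + wsum g N.
Proof. by rewrite -psumD; apply: eq_psum => k /=; rewrite addrACA. Qed.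

Lemma wsumZ c f N : wsum (fun p => c * f p) N = c * wsum f N.
Proof. by rewrite -psumMl; apply: eq_psum => k; rewrite mulrDr. Qed.

Lemma wsum_sum (n : nat) (F : nat -> T -> R) N :
  wsum (fun p => \sum_(i < n) F i p) N = \sum_(i < n) wsum (F i) N.
Proof.
rewrite -(psum_sum _ (fun i k => F i (k, false) + F i (k, true))).
by apply: eq_psum => k; rewrite -big_split.
Qed.

Lemma ler_wsum f g N : (forall p, f p <= g p) -> wsum f N <= wsum g N.
Proof. by move=> e; apply: ler_psum => k; rewrite lerD. Qed.

Lemma wsum_nondec f : (forall p, 0 <= f p) -> nondecreasing_seq (wsum f).
Proof. by move=> e; apply: psum_nondec => k; rewrite addr_ge0. Qed.

Lemma wsum_term f N (p : T) : (forall p, 0 <= f p) -> (`|p.1| <= N)%N -> f p <= wsum f N.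
Proof.
move=> e hp; apply: (@le_trans _ _ (f (p.1, false) + f (p.1, true))).
  by case: p {hp} => k [] /=; rewrite ?lerDl ?lerDr.
by apply: (psum_term (f := fun k => f (k, false) + f (k, true))) => // k; rewrite addr_ge0.
Qed.

Lemma wsum_delta f N (p : T) : (`|p.1| <= N)%N ->
  wsum (fun q => (if q == p then 1 else 0) * f q) N = f p.
Proof.
move=> hp; rewrite /wsum (eq_psum (g := fun k => if k == p.1 then f p else 0)) ?psum_delta//.
case: p {hp} => k0 [] k /=; rewrite !xpair_eqE /= ?andbF ?andbT.
  by case: eqP => [->|_]; rewrite ?mul0r ?mul1r ?add0r.
by case: eqP => [->|_]; rewrite ?mul0r ?mul1r ?addr0.
Qed.

Lemma cvg_sum_ord (n : nat) (F : nat -> nat -> R) (l : nat -> R) :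
  (forall i, (i < n)%N -> F i @ \oo --> l i) ->
  (fun N => \sum_(i < n) F i N) @ \oo --> \sum_(i < n) l i.
Proof.
elim: n => [|n IH] h.
  rewrite big_ord0 (_ : (fun N : nat => _) = fun=> 0); first exact: cvg_cst.
  by apply/funext => N; rewrite big_ord0.
rewrite big_ord_recr (_ : (fun N : nat => _) = (fun N => \sum_(i < n) F i N) \+ F n).
  by apply: cvgD; [apply: IH => i ik; exact: h (leqW ik)|exact: h].
by apply/funext => N; rewrite big_ord_recr.
Qed.

Lemma cvg_nondec_le (v : nat -> R) (l : R) :
  nondecreasing_seq v -> v @ \oo --> l -> forall N, v N <= l.
Proof.
move=> nd cv N; rewrite -(cvg_lim _ cv)//; apply: nondecreasing_cvgn_le => //.
by apply/cvg_ex; exists l.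
Qed.

Lemma cvg_le_ub (v : nat -> R) (l M : R) (N0 : nat) : v @ \oo --> l ->
  (forall N, (N0 <= N)%N -> v N <= M) -> l <= M.
Proof.
move=> cv h; rewrite -(cvg_lim _ cv)//; apply: limr_le; first by apply/cvg_ex; exists l.
by exists N0.
Qed.

Variable psi : nat -> T -> R.
Hypothesis orth : forall r t,
  wsum (fun p => psi r p * psi t p) @ \oo --> (if r == t then 1 else 0 : R).
Hypothesis maxi : forall u : T -> R, (exists M, forall N, wsum (fun p => u p ^+ 2) N <= M) ->
  (forall r, wsum (fun p => u p * psi r p) @ \oo --> (0 : R)) -> forall p, u p = 0.

Let comb (c : nat -> R) S (p : T) := \sum_(r < S) c r * psi r p.

Lemma comb_norm (c : nat -> R) S N :
  wsum (fun p => comb c S p ^+ 2) N <= \sum_(r < S) c r ^+ 2.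
Proof.
apply: (cvg_nondec_le (v := wsum (fun p => comb c S p ^+ 2))).
  by apply: wsum_nondec => p; rewrite sqr_ge0.
have -> : wsum (fun p => comb c S p ^+ 2) = (fun M => \sum_(r < S) \sum_(t < S)
    c r * c t * wsum (fun p => psi r p * psi t p) M).
  apply/funext => M.
  under eq_bigr do under eq_bigr do rewrite -wsumZ.
  under eq_bigr do rewrite -(wsum_sum _ (fun t p => c _ * c t * (psi _ p * psi t p))).
  rewrite -(wsum_sum _ (fun r p => \sum_(t < S) c r * c t * (psi r p * psi t p))).
  apply: eq_wsum => p; rewrite expr2 /comb mulr_suml; apply: eq_bigr => r _.
  by rewrite mulr_sumr; apply: eq_bigr => t _; ring.
apply: (cvg_sum_ord (F := fun r M => \sum_(t < S) c r * c t * wsum (fun p => psi r p * psi t p) M)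
  (l := fun r => c r ^+ 2)) => r rS.
have -> : c r ^+ 2 = \sum_(t < S) c r * c t * (if r == t then 1 else 0).
  rewrite (bigD1 (Ordinal rS))//= eqxx mulr1 big1 ?addr0 ?expr2//.
  by move=> t; rewrite -val_eqE/= eq_sym => /negbTE->; rewrite mulr0.
apply: (cvg_sum_ord (F := fun t M => c r * c t * wsum (fun p => psi r p * psi t p) M)
  (l := fun t => c r * c t * (if r == t then 1 else 0))) => t tS.
by apply: cvgMr; exact: orth.
Qed.

(** Self-improvement: with coefficients psi_r(p) the combination takes the value b at p and has
    squared norm at most b, whence b^2 <= b. *)
Lemma bessel p S : \sum_(r < S) psi r p ^+ 2 <= 1.
Proof.
set b := \sum_(r < S) _.
have h : b ^+ 2 <= b.
  apply: le_trans (comb_norm (psi ^~ p) S `|p.1|%N).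
  have -> : b = comb (psi ^~ p) S p by apply: eq_bigr => r _; rewrite expr2.
  by apply: (wsum_term (f := fun q => comb (psi ^~ p) S q ^+ 2)) => // q; rewrite sqr_ge0.
rewrite leNgt; apply/negP => b1; move: h; rewrite leNgt expr2 ltr_pMr ?b1//.
by apply: lt_trans b1.
Qed.

Section Point.
Variable p0 : T.

Let be S := \sum_(r < S) psi r p0 ^+ 2.
Let bl := limn be.

Let be_nd : nondecreasing_seq be.
Proof. by apply/nondecreasing_seqP => n; rewrite /be big_ord_recr/= lerDl sqr_ge0. Qed.

Let be_cvg : be @ \oo --> bl.
Proof.
apply: nondecreasing_is_cvgn be_nd _.
by exists 1 => _ [n _ <-]; exact: bessel.
Qed.

Let bl1 : bl <= 1.
Proof. by apply: (cvg_le_ub (N0 := 0) be_cvg) => N _; exact: bessel. Qed.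

Definition kpart S p := \sum_(r < S) psi r p0 * psi r p.

Lemma kpart_cvg p : cvgn (fun S => kpart S p).
Proof.
have -> : (fun S => kpart S p) = series (fun r => psi r p0 * psi r p).
  by apply/funext => S; rewrite /kpart /series/= big_mkord.
apply: normed_cvg.
have -> : [normed series (fun r => psi r p0 * psi r p)] =
  series (fun r => `|psi r p0 * psi r p|) by [].
apply: nondecreasing_is_cvgn.
  by apply/nondecreasing_seqP => n; rewrite /series/= big_nat_recr//= lerDl.
exists (2^-1 * (1 + 1)) => _ [n _ <-]; rewrite /series/= big_mkord.
apply: (@le_trans _ _ (\sum_(r < n) 2^-1 * (psi r p0 ^+ 2 + psi r p ^+ 2))).
  apply: ler_sum => r _; rewrite normrM.
  rewrite -[X in _ <= _ * (X + _)]real_normK ?num_real//.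
  rewrite -[X in _ <= _ * (_ + X)]real_normK ?num_real//.
  by set x := `|_|; set y := `|_|; have := sqr_ge0 (x - y); rewrite sqrrB; lra.
by rewrite -mulr_sumr big_split/= ler_wpM2l// lerD// bessel.
Qed.

Let kp p := limn (kpart ^~ p).

(** On a fixed window [comb_norm] bounds the difference of two partial kernels by be S' - be S; then
    S' tends to infinity. *)
Lemma kpart_tail S N : wsum (fun p => (kp p - kpart S p) ^+ 2) N <= bl - be S.
Proof.
apply: (@cvg_le_ub (fun S' => wsum (fun p => (kpart S' p - kpart S p) ^+ 2) N) _ _ S).
  rewrite /wsum /psum.
  apply: (cvg_sum_ord (n := (2 * N).+1) (F := fun k S' =>
     (kpart S' (k%:Z - N%:Z, false) - kpart S (k%:Z - N%:Z, false)) ^+ 2 +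
     (kpart S' (k%:Z - N%:Z, true) - kpart S (k%:Z - N%:Z, true)) ^+ 2)
     (l := fun k => (kp (k%:Z - N%:Z, false) - kpart S (k%:Z - N%:Z, false)) ^+ 2 +
     (kp (k%:Z - N%:Z, true) - kpart S (k%:Z - N%:Z, true)) ^+ 2)) => k _.
  have one q : (fun S' => (kpart S' q - kpart S q) ^+ 2) @ \oo --> (kp q - kpart S q) ^+ 2.
    rewrite expr2 (_ : (fun S' : nat => _) = (fun S' => (kpart S' q - kpart S q) * (kpart S' q - kpart S q))).
      by apply: cvgM; (apply: cvgB; [exact: kpart_cvg|exact: cvg_cst]).
    by apply/funext => S'; rewrite expr2.
  by apply: cvgD; exact: one.
move=> S' SS'.
pose c r : R := if (r < S)%N then 0 else psi r p0.
have split (G : nat -> R) : \sum_(r < S') (if (r < S)%N then 0 else G r) = \sum_(r < S') G r - \sum_(r < S) G r.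
  rewrite -(subnKC SS'); elim: (S' - S)%N => [|d IH].
    by rewrite addn0 subrr big1// => r _; rewrite ltn_ord.
  by rewrite addnS !big_ord_recr/= IH ltnNge leq_addr/= addrAC.
apply: (@le_trans _ _ (\sum_(r < S') c r ^+ 2)).
  apply: le_trans (comb_norm c S' N); rewrite le_eqVlt; apply/orP; left; apply/eqP.
  apply: eq_wsum => p; congr (_ ^+ 2); rewrite /kpart -(split (fun r => psi r p0 * psi r p)).
  by apply: eq_bigr => r _; rewrite /c; case: ifP => _; rewrite ?mul0r.
rewrite (eq_bigr (fun r : 'I_S' => if (r < S)%N then 0 else psi r p0 ^+ 2)); last first.
  by move=> r _; rewrite /c; case: ifP => _; rewrite ?expr0n.
rewrite (split (fun r => psi r p0 ^+ 2)) lerB//.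
exact: (cvg_nondec_le be_nd be_cvg).
Qed.

(** The defect [u] between delta_{p0} and its expansion is square summable and orthogonal to every
    psi_t, hence zero by maximality. *)
Lemma kernel_delta p : (fun S => kpart S p) @ \oo --> (if p == p0 then 1 else 0 : R).
Proof.
pose u q := (if q == p0 then 1 else 0) - kp q.
suff u0 : u p = 0.
  have -> : (if p == p0 then 1 else 0) = kp p by apply/eqP; rewrite -subr_eq0 -[X in X == _]/(u p) u0.
  exact: kpart_cvg.
have be0 : be 0%N = 0 by rewrite /be big_ord0.
have kp0 q : kpart 0 q = 0 by rewrite /kpart big_ord0.
have psi1 t N : wsum (fun q => psi t q ^+ 2) N <= 1.
  have := cvg_nondec_le (v := wsum (fun q => psi t q * psi t q)) (l := 1).
  rewrite (_ : wsum (fun q => psi t q ^+ 2) = wsum (fun q => psi t q * psi t q)).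
    by apply; [apply: wsum_nondec => q; rewrite -expr2 sqr_ge0|have := @orth t t; rewrite eqxx].
  by apply/funext => M; apply: eq_wsum => q; rewrite expr2.
have dsum N : wsum (fun q => (if q == p0 then 1 else 0 : R) ^+ 2) N <= 1.
  apply: (@le_trans _ _ (wsum (fun q => (if q == p0 then 1 else 0 : R) * 1) (N + `|p0.1|)%N)).
    have nd : nondecreasing_seq (wsum (fun q => (if q == p0 then 1 else 0 : R) ^+ 2)).
      by apply: wsum_nondec => q; rewrite sqr_ge0.
    apply: le_trans (nd _ _ (leq_addr `|p0.1|%N N)) _; rewrite le_eqVlt; apply/orP; left; apply/eqP.
    by apply: eq_wsum => q; case: ifP; rewrite ?expr1n ?expr0n ?mulr1.
  by rewrite (wsum_delta (fun=> 1)) ?leq_addl.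
apply: maxi => [|t].
  exists (2 * 1 + 2 * 1) => N.
  apply: (@le_trans _ _ (2 * wsum (fun q => (if q == p0 then 1 else 0 : R) ^+ 2) N +
     2 * wsum (fun q => (kp q - kpart 0 q) ^+ 2) N)).
    rewrite -!wsumZ -wsumD; apply: ler_wsum => q; rewrite kp0 subr0 /u.
    by set x := (if _ then _ else _); have := sqr_ge0 (x + kp q); rewrite sqrrD sqrrB; lra.
  rewrite lerD// ler_wpM2l//.
  by apply: le_trans (kpart_tail 0 N) _; rewrite be0 subr0; exact: bl1.
apply/cvgrPdist_le => e e0.
have e20 : 0 < (e / 2) ^+ 2 by rewrite exprn_gt0// divr_gt0.
have /cvgrPdist_lt/(_ _ e20)[S0 _ hS0] := be_cvg.
(* S exceeds t, so pairing the partial kernel with psi_t gives exactly psi_t(p0) in the limit. *)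
pose S := (S0 + t.+1)%N.
have hS : bl - be S <= (e / 2) ^+ 2.
  have := hS0 S (leq_addr _ _); rewrite ger0_norm ?subr_ge0; first exact: ltW.
  exact: (cvg_nondec_le be_nd be_cvg).
have c1 : (fun N => wsum (fun q => kpart S q * psi t q) N) @ \oo --> psi t p0.
  have -> : (fun N => wsum (fun q => kpart S q * psi t q) N) =
     (fun N => \sum_(r < S) psi r p0 * wsum (fun q => psi r q * psi t q) N).
    apply/funext => N; under eq_bigr do rewrite -wsumZ.
    rewrite -(wsum_sum _ (fun r q => psi r p0 * (psi r q * psi t q))); apply: eq_wsum => q.
    by rewrite /kpart mulr_suml; apply: eq_bigr => r _; rewrite mulrA.
  have tS : (t < S)%N by rewrite /S addnS ltnS leq_addl.
  have -> : psi t p0 = \sum_(r < S) psi r p0 * (if (r : nat) == t then 1 else 0).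
    rewrite (bigD1 (Ordinal tS))//= eqxx mulr1 big1 ?addr0//.
    by move=> r; rewrite -val_eqE/= => /negbTE->; rewrite mulr0.
  apply: (cvg_sum_ord (F := fun r N => psi r p0 * wsum (fun q => psi r q * psi t q) N)
    (l := fun r => psi r p0 * (if r == t then 1 else 0))) => r _.
  by apply: cvgMr; exact: orth.
have e2 : 0 < e / 2 by rewrite divr_gt0.
have /cvgrPdist_le/(_ _ e2)[N0 _ hN0] := c1.
exists (N0 + `|p0.1|)%N => // N /= hN.
have hN1 : (N0 <= N)%N by apply: leq_trans hN; exact: leq_addr.
have hN2 : (`|p0.1| <= N)%N by apply: leq_trans hN; exact: leq_addl.
rewrite sub0r normrN.
have -> : wsum (fun q => u q * psi t q) N =
   (psi t p0 - wsum (fun q => kpart S q * psi t q) N) - wsum (fun q => (kp q - kpart S q) * psi t q) N.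
  rewrite -(wsum_delta (psi t) hN2) -mulN1r -wsumZ -[X in _ - X]mul1r -mulNr -wsumZ -!wsumD.
  apply: eq_wsum => q; rewrite /u; move: (kp q) (kpart S q) (psi t q) => x y z.
  by case: ifP => _; ring.
apply: le_trans (ler_normB _ _) _.
have -> : e = e / 2 + e / 2 by field.
apply: lerD; first exact: hN0.
(* Young's inequality with weight e/2: the tail of mass (e/2)^2 and the unit norm of psi_t
   contribute e/4 each. *)
apply: (@le_trans _ _ (2^-1 * (e / 2)^-1 * wsum (fun q => (kp q - kpart S q) ^+ 2) N +
   2^-1 * (e / 2) * wsum (fun q => psi t q ^+ 2) N)).
  rewrite -!wsumZ -wsumD; apply: le_trans (ler_norm_psum _ _) _; apply: ler_psum => k /=.
  have one q : `|(kp q - kpart S q) * psi t q| <=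
      2^-1 * (e / 2)^-1 * (kp q - kpart S q) ^+ 2 + 2^-1 * (e / 2) * psi t q ^+ 2.
    rewrite normrM -[(kp q - _) ^+ 2]real_normK ?num_real// -[psi t q ^+ 2]real_normK ?num_real//.
    set x := `|_|; set y := `|_|; set d := e / 2.
    have d0 : 0 < d by [].
    have -> : 2^-1 * d^-1 * x ^+ 2 + 2^-1 * d * y ^+ 2 = x * y + 2^-1 * d^-1 * (x - d * y) ^+ 2.
      by field; rewrite gt_eqF.
    by rewrite lerDl mulr_ge0 ?sqr_ge0// mulr_ge0// invr_ge0 ltW.
  by apply: le_trans (ler_normD _ _) _; apply: lerD; exact: one.
have h1 : 2^-1 * (e / 2)^-1 * wsum (fun q => (kp q - kpart S q) ^+ 2) N <= 2^-1 * (e / 2).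
  have -> : 2^-1 * (e / 2) = 2^-1 * (e / 2)^-1 * (e / 2) ^+ 2 by field; rewrite gt_eqF.
  rewrite ler_wpM2l//; first by rewrite mulr_ge0// invr_ge0 ltW.
  exact: le_trans (kpart_tail S N) hS.
have h2 : 2^-1 * (e / 2) * wsum (fun q => psi t q ^+ 2) N <= 2^-1 * (e / 2).
  rewrite -[X in _ <= X]mulr1 ler_wpM2l// mulr_ge0// ltW//.
by apply: le_trans (lerD h1 h2) _; lra.
Qed.

End Point.
End Completeness.


(** * Square-summable solutions and the eigenbasis *)

Section Solutions.
Variables (R : realType) (alpha lam theta : R).
Implicit Types (f g h : int -> R) (E : R).

Local Notation hop := (hop alpha lam theta).

Definition sol E f := forall m, hop f m = E * f m.

Lemma sol_lin E f g (c d : R) : sol E f -> sol E g -> sol E (fun m => c * f m + d * g m).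
Proof.
move=> sf sg m; have h1 := sf m; have h2 := sg m.
transitivity (c * hop f m + d * hop g m); first by rewrite /hop; ring.
by rewrite h1 h2; ring.
Qed.

Lemma sol0 E f (m0 : int) : sol E f -> f m0 = 0 -> f (m0 + 1) = 0 -> forall m, f m = 0.
Proof.
move=> sf f0 f1.
have up (n : nat) : f (m0 + n%:Z) = 0 /\ f (m0 + n%:Z + 1) = 0.
  elim: n => [|n [IH1 IH2]]; first by rewrite addr0.
  have -> : m0 + n.+1%:Z = m0 + n%:Z + 1 by lia.
  split=> //; have := sf (m0 + n%:Z + 1).
  by rewrite /hop addrK IH1 IH2 !mulr0 !addr0.
have down (n : nat) : f (m0 - n%:Z) = 0 /\ f (m0 - n%:Z + 1) = 0.
  elim: n => [|n [IH1 IH2]]; first by rewrite subr0.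
  have -> : m0 - n.+1%:Z = m0 - n%:Z - 1 by lia.
  rewrite subrK; split=> //; have := sf (m0 - n%:Z).
  by rewrite /hop IH1 IH2 !mulr0 !addr0 add0r.
move=> m; case: (lerP m0 m) => h.
  have -> : m = m0 + `|m - m0|%N%:Z by lia.
  by case: (up `|m - m0|%N).
have -> : m = m0 - `|m - m0|%N%:Z by lia.
by case: (down `|m - m0|%N).
Qed.

Lemma summ_sq_term0 f : summ (fun m => f m ^+ 2) -> (fun N : nat => f N%:Z) @ \oo --> (0 : R).
Proof.
move=> /summ_term0 cv; apply/cvgrPdist_lt => e e0.
have e20 : 0 < e ^+ 2 by rewrite exprn_gt0.
have /cvgrPdist_lt/(_ _ e20)[N _ hN] := cv.
exists N => // n /= Nn; have := hN n Nn.
rewrite !sub0r !normrN normrX => h.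
by rewrite -(ltr_pXn2r (_ : 0 < 2)%N) ?nnegrE// ltW.
Qed.

(** The Wronskian of two solutions is constant and, for square-summable ones, tends to 0. As [h]
    vanishes at m0, this forces it to vanish at m0 + 1, hence everywhere. *)
Lemma sol_prop E f g (m0 : int) : sol E f -> sol E g ->
  summ (fun m => f m ^+ 2) -> summ (fun m => g m ^+ 2) -> f m0 != 0 ->
  forall m, g m = g m0 / f m0 * f m.
Proof.
move=> sf sg f2 g2 fm0.
pose h m := 1 * g m + (- (g m0 / f m0)) * f m.
have sh : sol E h by exact: sol_lin.
have hm0 : h m0 = 0 by rewrite /h mul1r mulNr divfK// subrr.
pose W (m : int) := h (m + 1) * f m - h m * f (m + 1).
have Wc m : W (m + 1) = W m.
  have h1 := sf (m + 1); have h2 := sh (m + 1).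
  rewrite /hop addrK in h1; rewrite /hop addrK in h2.
  have h3 : h (m + 1 + 1) = E * h (m + 1) - h m - site alpha lam theta (m + 1) * h (m + 1).
    by rewrite -h2; ring.
  have f3 : f (m + 1 + 1) = E * f (m + 1) - f m - site alpha lam theta (m + 1) * f (m + 1).
    by rewrite -h1; ring.
  by rewrite /W h3 f3; ring.
have Wn (n : nat) : W (m0 + n%:Z) = W m0.
  elim: n => [|n IH]; first by rewrite addr0.
  by rewrite -IH -[in RHS]Wc; congr W; lia.
have Wn' (n : nat) : W (m0 - n%:Z) = W m0.
  elim: n => [|n IH]; first by rewrite subr0.
  by rewrite -IH -[in LHS]Wc; congr W; lia.
have Wall m : W m = W m0.
  case: (lerP m0 m) => hm.
    have -> : m = m0 + `|m - m0|%N%:Z by lia.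
    exact: Wn.
  have -> : m = m0 - `|m - m0|%N%:Z by lia.
  exact: Wn'.
have cf := summ_sq_term0 f2.
have cf1 : (fun N : nat => f (N%:Z + 1)) @ \oo --> (0 : R).
  exact: (summ_sq_term0 (f := fun m => f (m + 1)) (summ_shift 1 f2)).
have cg := summ_sq_term0 g2.
have cg1 : (fun N : nat => g (N%:Z + 1)) @ \oo --> (0 : R).
  exact: (summ_sq_term0 (f := fun m => g (m + 1)) (summ_shift 1 g2)).
have cW : (fun N : nat => g (N%:Z + 1) * f N%:Z - g N%:Z * f (N%:Z + 1)) @ \oo --> (0 : R).
  have := cvgB (cvgM cg1 cf) (cvgM cg cf1).
  by rewrite !mulr0 subrr; exact.
have W0 : W m0 = 0.
  rewrite -(cvg_lim _ cW)//; apply/esym; apply: cvg_lim => //.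
  rewrite (_ : (fun N : nat => _) = fun=> W m0); first exact: cvg_cst.
  by apply/funext => N; rewrite -(Wall N%:Z) /W /h; ring.
have h1 : h (m0 + 1) = 0.
  have /eqP := W0; rewrite /W hm0 mul0r subr0 mulf_eq0 (negbTE fm0) orbF => /eqP//.
move=> m; have := sol0 sh hm0 h1 m; rewrite /h mul1r mulNr => /eqP.
by rewrite subr_eq0 => /eqP.
Qed.

(** A square-summable f is bounded, and iterating the equation gives |E|^k |f| <= B^k (M + 1), false
    for large k if |E| > B. *)
Lemma sol_energy_le E f (m0 : int) : sol E f -> summ (fun m => f m ^+ 2) -> f m0 != 0 ->
  `|E| <= 2 * `|lam| + 2.
Proof.
move=> sf [M hM] fm0; set B := 2 * `|lam| + 2.
have B0 : 0 < B by rewrite ltr_wpDl// mulr_ge0.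
have fM m : `|f m| <= M + 1.
  have h : `|f m| ^+ 2 <= M.
    apply: le_trans (hM `|m|%N).
    by rewrite -normrX; apply: (psum_term (f := fun m => `|f m ^+ 2|)).
  by set x := `|f m| in h *; have := sqr_ge0 x; have := sqr_ge0 (x - 1); rewrite sqrrB expr1n; lra.
have M0 : 0 <= M + 1 by apply: le_trans (fM 0).
have pw (k : nat) m : `|E| ^+ k * `|f m| <= B ^+ k * (M + 1).
  elim: k m => [|k IH] m; first by rewrite !expr0 !mul1r.
  have -> : `|E| ^+ k.+1 * `|f m| = `|E| ^+ k * `|E * f m| by rewrite normrM exprSr mulrA.
  rewrite -sf.
  apply: (@le_trans _ _ (`|E| ^+ k * (`|f (m + 1)| + `|f (m - 1)| + 2 * `|lam| * `|f m|))).
    rewrite ler_wpM2l ?exprn_ge0// /hop; apply: le_trans (ler_normD _ _) _; rewrite lerD ?ler_normD//.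
    by rewrite normrM ler_wpM2r// site_le.
  have h1 := IH (m + 1); have h2 := IH (m - 1); have h3 := ler_wpM2l (_ : 0 <= 2 * `|lam|) (IH m).
  have -> : B ^+ k.+1 * (M + 1) = B ^+ k * (M + 1) + B ^+ k * (M + 1) + 2 * `|lam| * (B ^+ k * (M + 1)).
    by rewrite exprS {1}/B; ring.
  have -> : `|E| ^+ k * (`|f (m + 1)| + `|f (m - 1)| + 2 * `|lam| * `|f m|) =
    `|E| ^+ k * `|f (m + 1)| + `|E| ^+ k * `|f (m - 1)| + 2 * `|lam| * (`|E| ^+ k * `|f m|) by ring.
  by rewrite lerD ?lerD// h3// mulr_ge0.
rewrite leNgt; apply/negP => BE.
have E0 : 0 < `|E| by apply: lt_trans BE.
have cv : (fun k => (B / `|E|) ^+ k * (M + 1)) @ \oo --> (0 : R).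
  rewrite -[X in _ --> X](mul0r (M + 1)); apply: cvgMl; apply: cvg_expr.
  by rewrite ger0_norm ?divr_ge0 ?(ltW B0)// ltr_pdivrMr// mul1r.
have fp : 0 < `|f m0| by rewrite normr_gt0.
have /cvgrPdist_lt/(_ _ fp)[N _ hN] := cv.
have := hN N (leqnn _); rewrite sub0r normrN ger0_norm; last first.
  by rewrite mulr_ge0// exprn_ge0// divr_ge0// ltW.
apply/negP; rewrite -leNgt expr_div_n mulrAC ler_pdivlMr ?exprn_gt0// mulrC.
exact: pw.
Qed.

(* 1 - ((H - E0) / d)^2; its powers converge to the eigenprojection of E0 when d
   exceeds the diameter of the spectrum. *)
Definition gop (d E0 : R) (u : int -> R) (m : int) : R :=
  let w m := hop u m - E0 * u m in u m - d^-1 ^+ 2 * (hop w m - E0 * w m).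

Definition gval (d E0 x : R) : R := 1 - ((x - E0) / d) ^+ 2.

Lemma hop_cvg (u : nat -> int -> R) (v : int -> R) :
  (forall m, (fun S => u S m) @ \oo --> v m) -> forall m, (fun S => hop (u S) m) @ \oo --> hop v m.
Proof.
move=> h m; rewrite /hop; apply: cvgD; first by apply: cvgD; exact: h.
by apply: cvgMr; exact: h.
Qed.

Lemma gop_cvg d E0 (u : nat -> int -> R) (v : int -> R) :
  (forall m, (fun S => u S m) @ \oo --> v m) ->
  forall m, (fun S => gop d E0 (u S) m) @ \oo --> gop d E0 v m.
Proof.
move=> h m; rewrite /gop.
have hw p : (fun S => hop (u S) p - E0 * u S p) @ \oo --> hop v p - E0 * v p.
  by apply: cvgB; [exact: hop_cvg|apply: cvgMr; exact: h].
apply: cvgB; first exact: h.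
apply: cvgMr; apply: cvgB; last by apply: cvgMr; exact: hw.
exact: (hop_cvg hw).
Qed.

Lemma hop_sum n (c : nat -> R) (F : nat -> int -> R) m :
  hop (fun p => \sum_(i < n) c i * F i p) m = \sum_(i < n) c i * hop (F i) m.
Proof.
rewrite /hop mulr_sumr -!big_split/=; apply: eq_bigr => i _; ring.
Qed.

Lemma sol_gop d E0 E f : d != 0 -> sol E f -> forall m, gop d E0 f m = gval d E0 E * f m.
Proof.
move=> d0 sf m; rewrite /gop /gval.
have -> : (fun p => hop f p - E0 * f p) = (fun p => (E - E0) * f p + 0 * f p).
  by apply/funext => p; rewrite sf; ring.
rewrite (sol_lin (E - E0) 0 sf sf) sf; field.
by [].
Qed.

Lemma gop_sum d E0 n (c e : nat -> R) (F : nat -> int -> R) m : d != 0 ->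
  (forall i, sol (e i) (F i)) ->
  gop d E0 (fun p => \sum_(i < n) c i * F i p) m = \sum_(i < n) (c i * gval d E0 (e i)) * F i m.
Proof.
move=> d0 sF.
transitivity (\sum_(i < n) c i * gop d E0 (F i) m); last first.
  by apply: eq_bigr => i _; rewrite (sol_gop _ d0 (sF i)) mulrA.
rewrite /gop.
have -> : (fun p => hop (fun q => \sum_(i < n) c i * F i q) p - E0 * (\sum_(i < n) c i * F i p)) =
   (fun p => \sum_(i < n) c i * (hop (F i) p - E0 * F i p)).
  apply/funext => p; rewrite hop_sum mulr_sumr -sumrB; apply: eq_bigr => i _; ring.
rewrite (hop_sum _ _ (fun i p => hop (F i) p - E0 * F i p)).
rewrite hop_sum [E0 * \sum_(i < n) _]mulr_sumr -sumrB [E0 * \sum_(i < n) _]mulr_sumr -sumrB mulr_sumr -sumrB.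
by apply: eq_bigr => i _; ring.
Qed.

End Solutions.


(** * Spectral kernels of an eigenbasis *)

Section Eigenbasis.
Variables (R : realType) (alpha lam theta : R) (phi : nat -> int -> R[i]).
Hypothesis onb : eigen_onb lam alpha theta phi.

Local Notation sol := (sol alpha lam theta).

Let a s m := complex.Re (phi s m).
Let b s m := complex.Im (phi s m).

Lemma Re_psumZ (f : int -> R[i]) N : complex.Re (psumZ f N) = psum (fun k => complex.Re (f k)) N.
Proof. by apply: (big_morph (@complex.Re R)) => // -[x1 x2] [y1 y2]. Qed.

Lemma Im_psumZ (f : int -> R[i]) N : complex.Im (psumZ f N) = psum (fun k => complex.Im (f k)) N.
Proof. by apply: (big_morph (@complex.Im R)) => // -[x1 x2] [y1 y2]. Qed.

Lemma Re_mulJ (x y : R[i]) : complex.Re (x * conjc y) =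
  complex.Re x * complex.Re y + complex.Im x * complex.Im y.
Proof. by case: x y => [x1 x2] [y1 y2] /=; rewrite mulrN opprK. Qed.

Lemma Im_mulJ (x y : R[i]) : complex.Im (x * conjc y) =
  complex.Im x * complex.Re y - complex.Re x * complex.Im y.
Proof. by case: x y => [x1 x2] [y1 y2] /=; rewrite mulrN addrC. Qed.

Lemma inner_isE (u v : int -> R[i]) (c : R[i]) : inner_is u v c <->
  psum (fun k => complex.Re (u k) * complex.Re (v k) + complex.Im (u k) * complex.Im (v k)) @ \oo --> complex.Re c /\
  psum (fun k => complex.Im (u k) * complex.Re (v k) - complex.Re (u k) * complex.Im (v k)) @ \oo --> complex.Im c.
Proof.
rewrite /inner_is.
have -> : (fun N => complex.Re (psumZ (fun m => u m * conjc (v m)) N)) =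
  psum (fun k => complex.Re (u k) * complex.Re (v k) + complex.Im (u k) * complex.Im (v k)).
  by apply/funext => N; rewrite Re_psumZ; apply: eq_psum => k; rewrite Re_mulJ.
have -> : (fun N => complex.Im (psumZ (fun m => u m * conjc (v m)) N)) =
  psum (fun k => complex.Im (u k) * complex.Re (v k) - complex.Re (u k) * complex.Im (v k)).
  by apply/funext => N; rewrite Im_psumZ; apply: eq_psum => k; rewrite Im_mulJ.
by [].
Qed.

(* Multiplication by 'i turns the complex orthonormal basis into the real one (phi_s, 'i phi_s). *)
Let psi (r : nat) (p : int * bool) : R :=
  if odd r then (if p.2 then a r./2 p.1 else - b r./2 p.1)
  else (if p.2 then b r./2 p.1 else a r./2 p.1).

Let ip (s t : nat) :
  psum (fun k => a s k * a t k + b s k * b t k) @ \oo --> (if s == t then 1 else 0 : R) /\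
  psum (fun k => b s k * a t k - a s k * b t k) @ \oo --> (0 : R).
Proof.
have [+ _ _] := onb; move=> /(_ s t)/inner_isE[h1 h2]; split.
  by move: h1; case: ifP.
by move: h2; case: ifP.
Qed.

Let psi_orth r t : wsum (fun p => psi r p * psi t p) @ \oo --> (if r == t then 1 else 0 : R).
Proof.
have rt : (r == t) = (odd r == odd t) && (r./2 == t./2).
  apply/eqP/andP => [->//|[/eqP h1 /eqP h2]].
  by rewrite -(odd_double_half r) -(odd_double_half t) h1 h2.
have [h1 h2] := ip r./2 t./2.
rewrite rt; rewrite /wsum /psi; case: (odd r); case: (odd t) => /=.
- apply: cvg_trans h1; rewrite (_ : psum _ = psum (fun k => a r./2 k * a t./2 k + b r./2 k * b t./2 k))//.
  by apply/funext => N; apply: eq_psum => k /=; ring.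
- rewrite -[X in _ --> X]oppr0; apply: cvg_trans (cvgN h2).
  rewrite (_ : psum _ = - psum (fun k => b r./2 k * a t./2 k - a r./2 k * b t./2 k))//.
  by apply/funext => N; rewrite /= -[RHS]mulN1r -psumMl; apply: eq_psum => k /=; ring.
- apply: cvg_trans h2.
  rewrite (_ : psum _ = psum (fun k => b r./2 k * a t./2 k - a r./2 k * b t./2 k))//.
  by apply/funext => N; apply: eq_psum => k /=; ring.
- by apply: cvg_trans h1.
Qed.

Let psi_max u : (exists M, forall N, wsum (fun p => u p ^+ 2) N <= M) ->
  (forall r, wsum (fun p => u p * psi r p) @ \oo --> (0 : R)) -> forall p, u p = 0.
Proof.
move=> [M hM] hu [k0 b0].
have [_ mx _] := onb.
pose U (m : int) : R[i] := (u (m, false) +i* u (m, true))%C.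
have U0 : U = fun _ => 0.
  apply: mx; first by exists M => N; exact: hM.
  move=> s; apply/inner_isE; split.
    have := hu s.*2; rewrite (_ : wsum _ = psum (fun k => complex.Re (U k) * complex.Re (phi s k) + complex.Im (U k) * complex.Im (phi s k)))//.
    by apply/funext => N; apply: eq_psum => k; rewrite /psi odd_double doubleK.
  have := hu s.*2.+1; rewrite (_ : wsum _ = psum (fun k => complex.Im (U k) * complex.Re (phi s k) - complex.Re (U k) * complex.Im (phi s k)))//.
  apply/funext => N; apply: eq_psum => k; rewrite /psi /= odd_double /= uphalf_double /U/= /a /b.
  by ring.
have := congr1 (fun f => f k0) U0; rewrite /U => -[]; by case: b0.
Qed.

(** Real part of phi_s(m) times the conjugate of phi_s(k): it ignores the phase of phi_s and is a
    real solution in m. *)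
Definition ekern s m k : R := a s m * a s k + b s m * b s k.

Lemma ekernC s m k : ekern s m k = ekern s k m.
Proof. by rewrite /ekern; ring. Qed.

Lemma ekern_delta k m : (fun S => \sum_(s < S) ekern s m k) @ \oo --> dl R k m.
Proof.
have cv := @kernel_delta R psi psi_orth psi_max (k, false) (m, false).
rewrite /dl; move: cv; rewrite xpair_eqE eqxx andbT => cv.
have -> : (fun S => \sum_(s < S) ekern s m k) = (fun S => kpart psi (k, false) S.*2 (m, false)).
  apply/funext => S; rewrite /kpart; elim: S => [|S IH]; first by rewrite !big_ord0.
  rewrite doubleS !big_ord_recr/= IH -addrA; congr (_ + _).
  rewrite /psi /= odd_double /= uphalf_double doubleK /ekern; ring.
apply/cvgrPdist_lt => e e0; have /cvgrPdist_lt/(_ _ e0)[N _ hN] := cv.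
exists N => // S /= NS; apply: hN => /=; rewrite -addnn; exact: leq_trans NS (leq_addr _ _).
Qed.

Lemma ekern_bessel S m : \sum_(s < S) ekern s m m <= 1.
Proof.
have := @ekern_delta m m; rewrite /dl eqxx => cv.
apply: (cvg_nondec_le _ cv); apply/nondecreasing_seqP => n.
by rewrite big_ord_recr/= lerDl /ekern addr_ge0// -expr2 sqr_ge0.
Qed.

Lemma ekern_abs S m k : \sum_(s < S) `|ekern s m k| <= 1.
Proof.
apply: (@le_trans _ _ (2^-1 * (\sum_(s < S) ekern s m m + \sum_(s < S) ekern s k k))); last first.
  have := ekern_bessel S m; have := ekern_bessel S k; lra.
rewrite -big_split/= mulr_sumr; apply: ler_sum => s _; rewrite ler_norml /ekern.
have h1 := sqr_ge0 (a s m - a s k); have h2 := sqr_ge0 (b s m - b s k).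
have h3 := sqr_ge0 (a s m + a s k); have h4 := sqr_ge0 (b s m + b s k).
rewrite sqrrB in h1; rewrite sqrrB in h2; rewrite sqrrD in h3; rewrite sqrrD in h4.
by apply/andP; split; lra.
Qed.

Lemma phi_l2 s N : psum (fun k => a s k ^+ 2 + b s k ^+ 2) N <= 1.
Proof.
have [h _] := ip s s; rewrite eqxx in h.
apply: (cvg_nondec_le (v := psum (fun k => a s k ^+ 2 + b s k ^+ 2))).
  by apply: psum_nondec => k; rewrite addr_ge0 ?sqr_ge0.
by apply: cvg_trans h.
Qed.

Lemma summ_a s : summ (fun m => a s m ^+ 2).
Proof.
exists 1 => N; apply: le_trans (phi_l2 s N); apply: ler_psum => k.
by rewrite ger0_norm ?sqr_ge0// lerDl sqr_ge0.
Qed.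

Lemma summ_b s : summ (fun m => b s m ^+ 2).
Proof.
exists 1 => N; apply: le_trans (phi_l2 s N); apply: ler_psum => k.
by rewrite ger0_norm ?sqr_ge0// lerDr sqr_ge0.
Qed.

Lemma eigen_energies : exists En : nat -> R, forall s, sol (En s) (a s) /\ sol (En s) (b s).
Proof.
have [_ _ ev] := onb; have /choice[En hE] := ev; exists En => s; split=> m.
  have := congr1 (@complex.Re R) (hE s m).
  rewrite /amo /hop /site /a.
  case: (phi s (m + 1)) (phi s (m - 1)) (phi s m) => [x1 x2] [y1 y2] [z1 z2] /=.
  by rewrite !mul0r !subr0.
have := congr1 (@complex.Im R) (hE s m).
rewrite /amo /hop /site /b.
case: (phi s (m + 1)) (phi s (m - 1)) (phi s m) => [x1 x2] [y1 y2] [z1 z2] /=.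
by rewrite !mul0r !addr0.
Qed.

Variable En : nat -> R.
Hypothesis hEn : forall s, sol (En s) (a s) /\ sol (En s) (b s).

Lemma phi_neq0 s : exists m, (a s m != 0) || (b s m != 0).
Proof.
apply/not_existsP => h; have [cv _] := ip s s; rewrite eqxx in cv.
have z : psum (fun k => a s k * a s k + b s k * b s k) = fun=> 0.
  apply/funext => N; rewrite (eq_psum (g := fun k => if k == 0 then 0 else 0)) ?psum_delta//.
  move=> k; have := h k => /negP; rewrite negb_or !negbK => /andP[/eqP-> /eqP->].
  by rewrite !mul0r addr0 if_same.
have : (1 : R) = 0 by rewrite -(cvg_lim _ cv)// z; apply: lim_cst.
by move/eqP; rewrite oner_eq0.
Qed.

Lemma real_mode s : exists f m0, [/\ sol (En s) f, summ (fun m => f m ^+ 2) & f m0 != 0].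
Proof.
have [m /orP[h|h]] := phi_neq0 s; have [sa sb] := hEn s.
  by exists (a s), m; split=> //; exact: summ_a.
by exists (b s), m; split=> //; exact: summ_b.
Qed.

Lemma energy_le s : `|En s| <= 2 * `|lam| + 2.
Proof. by have [f [m [sf f2 fm]]] := real_mode s; exact: sol_energy_le sf f2 fm. Qed.

Lemma ekern_sol s k : sol (En s) (ekern s ^~ k).
Proof.
have [sa sb] := hEn s; have := sol_lin (a s k) (b s k) sa sb.
rewrite (_ : (fun m => _) = ekern s ^~ k)//.
by apply/funext => m; rewrite /ekern; ring.
Qed.

Lemma ekern_l2 s k : summ (fun m => ekern s m k ^+ 2).
Proof.
apply: (summ_le (summZ (2 * (a s k ^+ 2 + b s k ^+ 2)) (summD (summ_a s) (summ_b s)))) => m.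
rewrite ger0_norm ?sqr_ge0// /ekern.
have h := sqr_ge0 (a s m * b s k - b s m * a s k).
have h1 : 0 <= (a s k ^+ 2 + b s k ^+ 2) * (a s m ^+ 2 + b s m ^+ 2).
  by rewrite mulr_ge0// addr_ge0 ?sqr_ge0.
have -> : (a s m * a s k + b s m * b s k) ^+ 2 =
  (a s k ^+ 2 + b s k ^+ 2) * (a s m ^+ 2 + b s m ^+ 2) - (a s m * b s k - b s m * a s k) ^+ 2 by ring.
lra.
Qed.

(** All four real and imaginary parts are multiples of one real solution [f], so phi_s = (c1 + i c2)
    f and phi_t = (c3 + i c4) f; orthogonality forces one coefficient to vanish. *)
Lemma energies_simple s t : s != t -> En s != En t.
Proof.
move=> st; apply/eqP => Est.
have [f [m0 [sf f2 fm0]]] := real_mode s.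
have [sa sb] := hEn s; have [ta tb] := hEn t; rewrite -Est in ta tb.
have prop g : sol (En s) g -> summ (fun m => g m ^+ 2) -> exists c, forall m, g m = c * f m.
  by move=> sg g2; exists (g m0 / f m0) => m; exact: (sol_prop sf sg f2 g2 fm0).
have [c1 h1] := prop _ sa (summ_a s); have [c2 h2] := prop _ sb (summ_b s).
have [c3 h3] := prop _ ta (summ_a t); have [c4 h4] := prop _ tb (summ_b t).
have z (c : R) : (fun N => c * psum (fun m => f m ^+ 2) N) @ \oo --> (0 : R) -> c = 0.
  move=> cv; have cf := summ_cvg f2.
  have e : c * tot (fun m => f m ^+ 2) = 0.
    rewrite -(cvg_lim _ cv)//; apply/esym; apply: cvg_lim => //; exact: cvgMr.
  have tp : 0 < tot (fun m => f m ^+ 2).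
    apply: (@lt_le_trans _ _ (f m0 ^+ 2)); first by rewrite exprn_even_gt0//= fm0.
    apply: le_trans (cvg_nondec_le (psum_nondec (fun m => sqr_ge0 (f m))) cf `|m0|%N).
    by apply: (psum_term (f := fun m => f m ^+ 2)) => // k; rewrite sqr_ge0.
  by move/eqP: e; rewrite mulf_eq0 (gt_eqF tp) orbF => /eqP.
have [i1 i2] := ip s t; rewrite (negbTE st) in i1.
have e1 : c1 * c3 + c2 * c4 = 0.
  apply: z; apply: cvg_trans i1; rewrite (_ : (fun N => _) = psum (fun k => a s k * a t k + b s k * b t k))//.
  by apply/funext => N; rewrite -psumMl; apply: eq_psum => k; rewrite h1 h2 h3 h4; ring.
have e2 : c2 * c3 - c1 * c4 = 0.
  apply: z; apply: cvg_trans i2; rewrite (_ : (fun N => _) = psum (fun k => b s k * a t k - a s k * b t k))//.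
  by apply/funext => N; rewrite -psumMl; apply: eq_psum => k; rewrite h1 h2 h3 h4; ring.
have e3 : (c1 ^+ 2 + c2 ^+ 2) * (c3 ^+ 2 + c4 ^+ 2) = 0.
  transitivity ((c1 * c3 + c2 * c4) ^+ 2 + (c2 * c3 - c1 * c4) ^+ 2); first by ring.
  by rewrite e1 e2 expr0n addr0.
move/eqP: e3; rewrite mulf_eq0 => /orP[] /eqP e.
  have [m] := phi_neq0 s; rewrite h1 h2.
  have [-> ->] : c1 = 0 /\ c2 = 0.
    by move/eqP: e; rewrite paddr_eq0 ?sqr_ge0// !sqrf_eq0 => /andP[/eqP-> /eqP->].
  by rewrite mul0r eqxx.
have [m] := phi_neq0 t; rewrite h3 h4.
have [-> ->] : c3 = 0 /\ c4 = 0.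
  by move/eqP: e; rewrite paddr_eq0 ?sqr_ge0// !sqrf_eq0 => /andP[/eqP-> /eqP->].
by rewrite mul0r eqxx.
Qed.

Lemma ekern_adjacent : exists s, ekern s 1 0 != 0.
Proof.
apply/not_existsP => h.
have cv := @hop_cvg R alpha lam theta _ _ (@ekern_delta 0) 1.
have z : (fun S => hop alpha lam theta (fun m => \sum_(s < S) ekern s m 0) 1) = fun=> 0.
  apply/funext => S.
  have -> : (fun m => \sum_(s < S) ekern s m 0) = (fun m => \sum_(s < S) 1 * ekern s m 0).
    by apply/funext => m; apply: eq_bigr => s _; rewrite mul1r.
  rewrite (@hop_sum R alpha lam theta S (fun=> 1) (fun s m => ekern s m 0)) big1// => s _.
  by rewrite ekern_sol; move: (h s) => /negP; rewrite negbK => /eqP->; rewrite !mulr0.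
rewrite z in cv.
have : hop alpha lam theta (dl R 0) 1 = 0.
  by rewrite -(cvg_lim _ cv)//; apply: lim_cst.
by rewrite /hop /dl /= mulr0 add0r addr0 => /eqP; rewrite oner_eq0.
Qed.

(** Matrix element of the j-th power of [gop], a finite computation without reference to the
    eigenbasis. *)
Definition gker d E0 j k := iter j (gop alpha lam theta d E0) (dl R k).

Lemma gker_cvg d E0 j k : d != 0 ->
  forall m, (fun S => \sum_(s < S) gval d E0 (En s) ^+ j * ekern s m k) @ \oo --> gker d E0 j k m.
Proof.
move=> d0; elim: j => [|j IH] m.
  rewrite (_ : (fun S => _) = (fun S => \sum_(s < S) ekern s m k)); first exact: ekern_delta.
  by apply/funext => S; apply: eq_bigr => s _; rewrite expr0 mul1r.
have := @gop_cvg R alpha lam theta d E0 _ _ IH m.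
rewrite (_ : (fun S => gop _ _ _ _ _ _ _) = (fun S => \sum_(s < S) gval d E0 (En s) ^+ j.+1 * ekern s m k))//.
apply/funext => S.
rewrite (@gop_sum R alpha lam theta d E0 S (fun s => gval d E0 (En s) ^+ j) En (fun s m => ekern s m k) m d0).
  by apply: eq_bigr => s _; rewrite exprSr.
by move=> s; exact: ekern_sol.
Qed.

(** All energies lie in [-B, B], so d = 2B bounds their differences and keeps [gval] in [0, 1]. *)
Let B := 2 * `|lam| + 2.
Let d := 2 * B.

Let B_gt0 : 0 < B. Proof. by rewrite ltr_wpDl// mulr_ge0. Qed.
Let d_neq0 : d != 0. Proof. by rewrite gt_eqF// mulr_gt0. Qed.

Lemma gval_range E0 s : `|E0| <= B -> 0 <= gval d E0 (En s) <= 1.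
Proof.
move=> hE0; have hs := energy_le s.
rewrite /gval gerBl sqr_ge0 andbT subr_ge0 expr_div_n ler_pdivrMr ?mul1r ?exprn_gt0 ?mulr_gt0//.
rewrite -[X in X <= _]real_normK ?num_real// lerXn2r ?nnegrE ?mulr_ge0 ?(ltW B_gt0)//.
by apply: le_trans (ler_normB _ _) _; rewrite /d mulr_natl mulr2n lerD.
Qed.

Lemma gker_upper E0 j k m M : `|E0| <= B ->
  (forall S, \sum_(s < S) `|ekern s m k| <= M) -> `|gker d E0 j k m| <= M.
Proof.
move=> hE0 hM; have /cvg_norm cv := @gker_cvg d E0 j k d_neq0 m.
apply: (cvg_le_ub (N0 := 0) cv) => S _; apply: le_trans (ler_norm_sum _ _ _) (le_trans _ (hM S)).
apply: ler_sum => s _; rewrite normrM ler_piMl// ger0_norm; first apply: exprn_ile1.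
- by case/andP: (gval_range s hE0).
- by case/andP: (gval_range s hE0).
- by rewrite exprn_ge0//; case/andP: (gval_range s hE0).
Qed.

(** Only s0 has [gval] equal to 1. By [energies_simple] the other modes before T decay under powers,
    and those beyond T have a small absolute sum uniformly in j. *)
Lemma gker_lower s0 k m (e : R) : 0 < e -> exists j, `|gker d (En s0) j k m - ekern s0 m k| <= e.
Proof.
move=> e0; set E0 := En s0.
have hE0 : `|E0| <= B := energy_le s0.
pose A S := \sum_(s < S) `|ekern s m k|.
have ndA : nondecreasing_seq A.
  by apply/nondecreasing_seqP => n; rewrite /A big_ord_recr/= lerDl.
have cA : cvgn A by apply: nondecreasing_is_cvgn ndA _; exists 1 => _ [n _ <-]; exact: ekern_abs.
have e2 : 0 < e / 2 by rewrite divr_gt0.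
have /cvgrPdist_lt/(_ _ e2)[T0 _ hT0] := cA.
pose T := (T0 + s0.+1)%N.
have s0T : (s0 < T)%N by rewrite /T addnS ltnS leq_addl.
have tail S : (T <= S)%N -> A S - A T <= e / 2.
  move=> TS; have := hT0 T (leq_addr _ _).
  have h1 := nondecreasing_cvgn_le ndA cA S; have h2 := nondecreasing_cvgn_le ndA cA T.
  rewrite ger0_norm ?subr_ge0// => h3; lra.
pose F (t j : nat) : R := if t == s0 then 0 else gval d E0 (En t) ^+ j * `|ekern t m k|.
have cF : (fun j => \sum_(t < T) F t j) @ \oo --> (\sum_(t < T) (0 : R)).
  apply: (cvg_sum_ord (F := F) (l := fun=> 0)) => t _; rewrite /F.
  case: eqP => [_|/eqP ts]; first exact: cvg_cst.
  rewrite -[X in _ --> X](mul0r `|ekern t m k|); apply: cvgMl; apply: cvg_expr.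
  have /andP[g0 g1] := gval_range t hE0.
  rewrite ger0_norm// lt_neqAle g1 andbT /gval -subr_eq0 addrAC subrr sub0r oppr_eq0.
  rewrite sqrf_eq0 mulf_eq0 invr_eq0 (negbTE d_neq0) orbF subr_eq0.
  exact: energies_simple.
rewrite big1// in cF.
have /cvgrPdist_lt/(_ _ e2)[j0 _ hj0] := cF.
exists j0; have hj := hj0 j0 (leqnn _).
have cv := @gker_cvg d E0 j0 k d_neq0 m.
have /cvg_norm cv' : (fun S => \sum_(s < S) gval d E0 (En s) ^+ j0 * ekern s m k - ekern s0 m k)
    @ \oo --> gker d E0 j0 k m - ekern s0 m k.
  by apply: cvgB cv _; exact: cvg_cst.
apply: (cvg_le_ub (N0 := T) cv') => S TS /=.
have F0 t j : 0 <= F t j.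
  rewrite /F; case: ifP => // _; rewrite mulr_ge0// exprn_ge0//.
  by case/andP: (gval_range t hE0).
have eq1 : \sum_(s < S) gval d E0 (En s) ^+ j0 * ekern s m k - ekern s0 m k =
   \sum_(s < S) (if s == s0 :> nat then 0 else gval d E0 (En s) ^+ j0 * ekern s m k).
  have s0S : (s0 < S)%N by exact: leq_trans s0T TS.
  rewrite (bigD1 (Ordinal s0S))//= [in RHS](bigD1 (Ordinal s0S))//= eqxx add0r.
  rewrite /gval subrr mul0r expr0n subr0 expr1n mul1r addrAC subrr add0r.
  by apply: eq_bigr => s; rewrite -val_eqE/= => /negbTE->.
rewrite eq1; apply: le_trans (ler_norm_sum _ _ _) _.
apply: (@le_trans _ _ (\sum_(s < S) F s j0)).
  apply: ler_sum => s _; rewrite /F; case: ifP => _; rewrite ?normr0// normrM ger0_norm//.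
  by rewrite exprn_ge0//; case/andP: (gval_range s hE0).
have split D : \sum_(s < T + D) F s j0 <= \sum_(s < T) F s j0 + (A (T + D)%N - A T).
  elim: D => [|D IH]; first by rewrite addn0 subrr addr0.
  rewrite addnS big_ord_recr/= /A [X in _ <= _ + (X - _)]big_ord_recr/= -/(A _) -/(A _).
  have hF : F (T + D)%N j0 <= `|ekern (T + D)%N m k|.
    rewrite /F; case: ifP => // _; rewrite ler_piMl//; apply: exprn_ile1.
      by case/andP: (gval_range (T + D)%N hE0).
    by case/andP: (gval_range (T + D)%N hE0).
  by move: IH hF; rewrite /A; lra.
have := split (S - T)%N; rewrite (subnKC TS) => h.
apply: (le_trans h).
have := tail S TS; move: hj; rewrite sub0r normrN ger0_norm ?sumr_ge0//; lra.
Qed.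

Lemma ekern_le_sqmod s m k : `|ekern s m k| <= Num.sqrt (sqmod (phi s k * phi s m)).
Proof.
rewrite -sqrtr_sqr ler_wsqrtr// /ekern /sqmod /a /b.
case: (phi s k) (phi s m) => [x1 x2] [y1 y2] /=.
rewrite -subr_ge0.
have -> : (x1 * y1 - x2 * y2) ^+ 2 + (x1 * y2 + x2 * y1) ^+ 2 - (y1 * x1 + y2 * x2) ^+ 2 =
  (y1 * x2 - y2 * x1) ^+ 2 by ring.
exact: sqr_ge0.
Qed.

End Eigenbasis.


(** * Lower bound on the modes *)

Section Lower.
Variables (R : realType) (alpha lam theta : R).

Lemma sin_pi_shift (y : R) (m : int) : `|sin (pi * (y + m%:~R))| = `|sin (pi * y)|.
Proof.
have up (n : nat) (z : R) : `|sin (pi * (z + n%:R))| = `|sin (pi * z)|.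
  elim: n => [|n IH]; first by rewrite addr0.
  by rewrite -natr1 addrA mulrDr mulr1 sinDpi normrN.
case: m => n; first exact: up.
by rewrite NegzE mulrNz -(up n.+1) -pmulrn subrK.
Qed.

Lemma sin_pi_eq0 (y : R) : sin (pi * y) = 0 -> y = (Num.floor y)%:~R.
Proof.
move=> h; apply/eqP; rewrite -subr_eq0; set f := y - _.
have f0 : 0 <= f by rewrite subr_ge0 Num.Theory.floor_le_tmp.
have f1 : f < 1 by rewrite ltrBlDl -intrD1 Num.Theory.floorD1_gt.
have sf : `|sin (pi * f)| = 0.
  by rewrite /f -mulrNz sin_pi_shift h normr0.
apply/negPn/negP => fn; have fp : 0 < f by rewrite lt_neqAle eq_sym fn.
have : 0 < sin (pi * f).
  by apply: sin_gt0_pi; rewrite mulr_gt0 ?pi_gt0//= -[X in _ < X]mulr1 ltr_pM2l ?pi_gt0.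
by move=> h'; move: sf; rewrite gtr0_norm// => e; rewrite e ltxx in h'.
Qed.

Lemma diophantine_irr : diophantine alpha ->
  forall k : int, k != 0 -> sin (pi * (k%:~R * alpha)) != 0.
Proof.
move=> [kappa [tau [k0 [t0 h]]]] k kn; apply/eqP => /sin_pi_eq0 e.
have := h k kn; rewrite /distZ.
have -> : k%:~R * alpha - (Num.floor (k%:~R * alpha))%:~R = 0 by rewrite -e subrr.
rewrite leNgt => /negP; apply.
apply: (@le_lt_trans _ _ 0); first by rewrite ge_min lexx.
rewrite divr_gt0// powR_gt0// ltr0z; lia.
Qed.

(** The equation solved backwards: the continuants are transfer matrix entries leading from the
    sites p + n + 1 and p + n + 2 back to p. *)
Lemma cont_transfer (E : R) (chi : int -> R) (p : int) n : sol alpha lam theta E chi ->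
  chi p = cont (fun k => E - site alpha lam theta (p + 1 + k%:Z)) n.+1 * chi (p + n.+1%:Z)
     - cont (fun k => E - site alpha lam theta (p + 1 + k%:Z)) n * chi (p + n.+2%:Z).
Proof.
move=> sx; elim: n => [|n IH].
  rewrite /= mul1r addr0; have := sx (p + 1); rewrite /hop addrK => h.
  have -> : p + 2%:Z = p + 1 + 1 by lia.
  by rewrite mulrBl -h; ring.
rewrite {1}IH contSSr; set D1 := cont _ n.+1; set D0 := cont _ n.
have := sx (p + n.+2%:Z); rewrite /hop.
have -> : p + n.+2%:Z + 1 = p + n.+3%:Z by lia.
have -> : p + n.+2%:Z - 1 = p + n.+1%:Z by lia.
have -> : p + 1 + n.+1%:Z = p + n.+2%:Z by lia.
set v := site _ _ _ _ => h.
have -> : chi (p + n.+1%:Z) = E * chi (p + n.+2%:Z) - v * chi (p + n.+2%:Z) - chi (p + n.+3%:Z).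
  by rewrite -h; ring.
by ring.
Qed.

Definition wt (G : R) (n : nat) : R := expR (- (G * n%:R)).

Lemma wt_small (e c : R) : 0 < e -> 0 < c -> exists N : nat, forall n, (N <= n)%N -> wt e n < c.
Proof.
move=> e0 c0; exists (Num.Def.archi_bound (c^-1 / e)) => n hn.
have h0 : 0 <= c^-1 / e by rewrite divr_ge0 ?invr_ge0 ?ltW.
have h : c^-1 < expR (e * n%:R).
  have := archi_boundP h0; rewrite ltr_pdivrMr// mulrC => h1.
  apply: (lt_le_trans h1).
  apply: le_trans (_ : e * n%:R <= _); first by rewrite ler_pM2l// ler_nat.
  by apply: le_trans (expR_ge1Dx _); rewrite lerDr.
by rewrite /wt expRN -[c]invrK ltf_pV2 ?posrE ?invr_gt0// expR_gt0.
Qed.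

Hypothesis lam1 : 1 < lam.
Hypothesis irr : forall k : int, k != 0 -> sin (pi * (k%:~R * alpha)) != 0.
Hypothesis nonres : forall k : int, sin (pi * (2 * theta + k%:~R * alpha)) != 0.

(** Going back from the pair (n, n + 1) to site 0 costs at most lam^n e^{ep n}. Half of G - ln lam
    pays for ep, the other half absorbs c and |chi 0|. *)
Lemma mode_lower (E : R) (chi : int -> R) (G c : R) :
  sol alpha lam theta E chi -> summ (fun m => chi m ^+ 2) -> chi 0 != 0 -> ln lam < G -> 0 < c ->
  exists N : nat, forall n, (N <= n)%N -> c * wt G n < `|chi n%:Z| + `|chi n.+1%:Z|.
Proof.
move=> sx x2 x0 LG c0.
have lam0 : 0 < lam by apply: lt_trans lam1.
have lamn : lam != 0 by rewrite gt_eqF.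
have [C C0 hC] := @dual_cont_bound R lam alpha theta E chi lamn irr nonres x2 sx (ex_intro _ 0 x0).
pose ep := (G - ln lam) / 2.
have ep0 : 0 < ep by rewrite divr_gt0// subr_gt0.
(* The box of the determinant starts at site 1, hence the phase theta + alpha. *)
have [N0 hN0] := @supercritical_growth R lam alpha E C lam0 irr C0 hC (theta + alpha) ep ep0.
have cx : 0 < `|chi 0| / c by rewrite divr_gt0// normr_gt0.
have [N1 hN1] := wt_small ep0 cx.
have bd m : (N0 <= m)%N -> `|cont (fun k => E - site alpha lam theta (0 + 1 + k%:Z)) m| <= expR ((ln lam + ep) * m%:R).
  move=> hm; have := hN0 m hm.
  have -> : lam ^+ m * expR (ep * m%:R) = expR ((ln lam + ep) * m%:R).
    by rewrite -{1}(lnK (_ : lam \is Num.pos)) ?posrE// -expRM_natl -expRD; congr expR; ring.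
  rewrite (@eq_cont _ _ (fun k => E - site alpha lam theta (0 + 1 + k%:Z)))// => k _.
  by rewrite /site add0r intrD -pmulrn; congr (_ - _ * cos (_ * _)); ring.
have L0 : 0 < ln lam by rewrite ln_gt0.
exists (maxn N0.+1 N1) => -[|n]; first by rewrite geq_max ltn0.
move=> hn; have hn0 : (N0 <= n)%N by have := leq_trans (leq_maxl _ _) hn; rewrite ltnS.
have hn1 : (N1 <= n.+1)%N by exact: leq_trans (leq_maxr _ _) hn.
have := cont_transfer 0 n sx; rewrite !add0r => e.
have b1 := bd n.+1 (leqW hn0); have b0 := bd n hn0; rewrite !add0r in b1 b0.
have b0' : `|cont (fun k => E - site alpha lam theta (1 + k%:Z)) n| <= expR ((ln lam + ep) * n.+1%:R).
  apply: (le_trans b0); rewrite ler_expR ler_wpM2l ?ler_nat//.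
  by rewrite addr_ge0// ltW.
have h1 : `|chi 0| <= expR ((ln lam + ep) * n.+1%:R) * (`|chi n.+1%:Z| + `|chi n.+2%:Z|).
  rewrite e mulrDr; apply: le_trans (ler_normB _ _) _.
  by rewrite lerD// normrM ler_wpM2r.
have h2 := hN1 _ hn1; rewrite ltr_pdivlMr// in h2.
have ep1 : 0 < expR ((ln lam + ep) * n.+1%:R) by exact: expR_gt0.
rewrite -(ltr_pM2l ep1); apply: lt_le_trans h1.
apply: le_lt_trans h2.
rewrite mulrC -mulrA mulrC ler_wpM2r ?(ltW c0)// /wt -expRD ler_expR.
by rewrite /ep -subr_ge0; set x := n.+1%:R; have -> : - ((G - ln lam) / 2 * x) - (- (G * x) + (ln lam + (G - ln lam) / 2) * x) = 0 by field.
Qed.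

Variable phi : nat -> int -> R[i].
Hypothesis onb : eigen_onb lam alpha theta phi.

(** Columns 0 and 1 of the kernel are square-summable solutions at the same energy, hence
    proportional; the ratio [kap] is nonzero by the choice of s. *)
Lemma ekern_lower (G : R) : ln lam < G ->
  exists s (N : nat), forall n, (N <= n)%N ->
    wt G n < `|ekern phi s n%:Z 0| \/ wt G n < `|ekern phi s n.+1%:Z 1|.
Proof.
move=> LG.
have [En hEn] := eigen_energies onb.
have [s hs] := ekern_adjacent onb hEn; exists s.
have s0 := ekern_sol hEn s 0; have s1 := ekern_sol hEn s 1.
have l0 := ekern_l2 onb s 0; have l1 := ekern_l2 onb s 1.
have k00 : ekern phi s 0 0 != 0.
  apply: contra hs; rewrite /ekern -!expr2 paddr_eq0 ?sqr_ge0// !sqrf_eq0 => /andP[/eqP-> /eqP->].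
  by rewrite !mulr0 addr0.
have prop := sol_prop s0 s1 l0 l1 k00.
rewrite ekernC in hs.
pose kap := ekern phi s 0 1 / ekern phi s 0 0.
have kap0 : 0 < `|kap| by rewrite normr_gt0 mulf_neq0// invr_eq0.
(* If the value at n is at most wt, this leaves more than wt/|kap| at n + 1, that is more than wt in
   column 1. *)
pose c := 1 + `|kap|^-1.
have c0 : 0 < c by rewrite addr_gt0// invr_gt0.
have [N hN] := mode_lower s0 l0 k00 LG c0.
exists N => n hn; have := hN n hn => h.
have e1 : `|ekern phi s n.+1%:Z 1| = `|kap| * `|ekern phi s n.+1%:Z 0|.
  by rewrite -normrM prop.
case: (ltP (wt G n) `|ekern phi s n%:Z 0|) => h0; [by left|right].
have h3 : `|kap|^-1 * wt G n < `|ekern phi s n.+1%:Z 0|.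
  by move: h; rewrite /c mulrDl mul1r; lra.
by rewrite e1 -ltr_pdivrMl.
Qed.

End Lower.

(** * Basis-free open sets of phases *)

Section OpenSets.
Variables (R : realType) (alpha lam : R).

Let B : R := 2 * `|lam| + 2.

(* An open set of phases on which the eigenfunction sum at n is at least w, whatever
   the eigenbasis. *)
Definition kgt (w : R) (n : int) : set R :=
  [set theta | exists E0 j, `|E0| <= B /\ w < `|gker alpha lam theta (2 * B) E0 j 0 n|].

Lemma gop_shift (theta d E0 : R) (p : int) (u : int -> R) m :
  gop alpha lam (theta + p%:~R * alpha) d E0 (fun q => u (q + p)) m =
  gop alpha lam theta d E0 u (m + p).
Proof.
have hs (v : int -> R) q : hop alpha lam (theta + p%:~R * alpha) (fun q => v (q + p)) q = hop alpha lam theta v (q + p).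
  rewrite /hop /site (addrAC q) [q - 1 + p]addrAC; congr (_ + _ * cos (_ * _) * _).
  by rewrite intrD; ring.
rewrite /gop; congr (_ - _ * (_ - _ * _)); last by rewrite hs.
rewrite -hs; congr hop; apply/funext => q; by rewrite hs.
Qed.

Lemma gker_shift (theta d E0 : R) (p : int) j k m :
  gker alpha lam (theta + p%:~R * alpha) d E0 j k m = gker alpha lam theta d E0 j (k + p) (m + p).
Proof.
elim: j m => [|j IH] m.
  rewrite /gker /dl /=; congr (if _ then _ else _); apply/eqP/eqP; lia.
rewrite /gker /= -gop_shift; congr (gop _ _ _ _ _ _ m); apply/funext => q; exact: IH.
Qed.

Lemma gker_period (theta d E0 : R) (p : int) j k :
  gker alpha lam (theta + p%:~R) d E0 j k = gker alpha lam theta d E0 j k.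
Proof.
have hs : hop alpha lam (theta + p%:~R) = hop alpha lam theta.
  apply/funext => u; apply/funext => m; rewrite /hop /site.
  have -> : 2 * pi * (theta + p%:~R + m%:~R * alpha) = 2 * pi * (theta + m%:~R * alpha) + pi * 2 * p%:~R.
    by ring.
  congr (_ + _ * _ * _); set y := 2 * pi * _.
  have up (n : nat) (z : R) : cos (z + pi * 2 * n%:R) = cos z.
    have -> : (pi : R) * 2 * n%:R = (pi *+ 2) *+ n by rewrite !mulr_natr.
    exact: (periodicn (@cosD2pi R)).
  case: p => n; first exact: up.
  by rewrite NegzE mulrNz -(up n.+1) mulrN -pmulrn subrK.
by rewrite /gker /gop hs.
Qed.

Lemma gker_continuous (d E0 : R) j k m : continuous (fun theta => gker alpha lam theta d E0 j k m).
Proof.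
have hc (u : R -> int -> R) : (forall q, continuous (fun theta => u theta q)) ->
    forall q, continuous (fun theta => hop alpha lam theta (u theta) q).
  move=> hu q; rewrite /hop => th.
  apply: cvgD; first by apply: cvgD; exact: hu.
  apply: cvgM; last exact: hu.
  apply: cvgMr.
  apply: (@continuous_comp _ _ _ (fun theta => 2 * pi * (theta + q%:~R * alpha)) (@cos R)); last exact: continuous_cos.
  by apply: cvgMr; apply: cvgD; [exact: cvg_id|exact: cvg_cst].
elim: j m => [|j IH] m th; first by exact: cvg_cst.
have hw q : continuous (fun theta => hop alpha lam theta (gker alpha lam theta d E0 j k) q - E0 * gker alpha lam theta d E0 j k q).
  by move=> t; apply: cvgB; [exact: (hc _ IH)|apply: cvgMr; exact: IH].
apply: cvgB; first exact: IH.
apply: cvgMr; apply: cvgB; last by apply: cvgMr; exact: hw.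
exact: (hc (fun theta q => hop alpha lam theta (gker alpha lam theta d E0 j k) q - E0 * gker alpha lam theta d E0 j k q) hw).
Qed.

Lemma kgt_open w n : open (kgt w n).
Proof.
have -> : kgt w n = \bigcup_(x in [set x : R * nat | `|x.1| <= B])
   (fun theta => `|gker alpha lam theta (2 * B) x.1 x.2 0 n|) @^-1` [set y | w < y].
  apply/seteqP; split=> th.
    by move=> [E0 [j [h1 h2]]]; exists (E0, j).
  by move=> [[E0 j] h1 h2]; exists E0, j.
apply: bigcup_open => x _; apply: open_comp; last exact: open_gt.
move=> th _; apply: (@continuous_comp _ _ _ (fun theta => gker alpha lam theta (2 * B) x.1 x.2 0 n) Num.norm).
  exact: gker_continuous.
exact: norm_continuous.
Qed.

Lemma kgt_period w n theta (p : int) : kgt w n (theta + p%:~R) <-> kgt w n theta.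
Proof.
by split=> -[E0 [j h]]; exists E0, j; move: h; rewrite gker_period.
Qed.

(** The strict inequality leaves room for an approximation to within half the gap; covariance moves
    the source k to 0 and translates the phase by k alpha. *)
Lemma kgt_mode theta phi (w : R) s (k n : int) : eigen_onb lam alpha theta phi ->
  w < `|ekern phi s n k| -> kgt w (n - k) (theta + k%:~R * alpha).
Proof.
move=> onb h; have [En hEn] := eigen_energies onb.
have e0 : 0 < (`|ekern phi s n k| - w) / 2 by rewrite divr_gt0// subr_gt0.
have [j hj] := gker_lower onb hEn s k n e0.
exists (En s), j; split; first by have := energy_le onb hEn s; rewrite /B.
rewrite gker_shift add0r subrK.
set x := gker _ _ _ _ _ _ _ _ in hj *.
have h1 : `|ekern phi s n k| <= `|x| + `|x - ekern phi s n k|.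
  by rewrite -[X in `|X| <= _](subKr x) ; apply: ler_normB.
lra.
Qed.

(** [gker_upper] is applied with the eigenfunction sum itself as bound, once the infinite case is
    set aside. *)
Lemma kgt_corr theta phi (w : R) (n : int) : eigen_onb lam alpha theta (phi theta) ->
  kgt w n theta -> (w%:E <= corr_sum phi n theta)%E.
Proof.
move=> onb [E0 [j [h1 h2]]]; have [En hEn] := eigen_energies onb.
rewrite /corr_sum; set S := (\sum_(0 <= s <oo) _)%E.
have S0 : (0 <= S)%E by apply: nneseries_ge0 => s _ _; rewrite lee_fin sqrtr_ge0.
have hS m : ((\sum_(s < m) `|ekern (phi theta) s n 0|)%:E <= S)%E.
  apply: (@le_trans _ _ (\sum_(0 <= s < m) (Num.sqrt (sqmod (phi theta s 0 * phi theta s n)))%:E)%E).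
    rewrite big_mkord sumEFin lee_fin; apply: ler_sum => s _; exact: ekern_le_sqmod.
  by apply: nneseries_lim_ge => s _ _; rewrite lee_fin sqrtr_ge0.
case: (boolP (S == +oo%E)) => [/eqP->|Sn]; first by rewrite leey.
have Sf : (S \is a fin_num)%E by rewrite ge0_fin_numE// lt_neqAle Sn leey.
rewrite -(fineK Sf) lee_fin; apply: (le_trans (ltW h2)).
apply: (gker_upper onb hEn j h1) => m.
by rewrite -lee_fin (fineK Sf).
Qed.

End OpenSets.


(** * Integration over the phase *)

Import HBNNSimple.

(* f need not be measurable: the integral of a nonnegative function is a supremum over simple functions. *)
Lemma integral_lower (d : measure_display) (T : measurableType d) (R : realType)
    (mu : {measure set T -> \bar R}) (D A : set T) (f : T -> \bar R) (w : R) : measurable D -> measurable A ->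
  A `<=` D -> 0 <= w -> (forall x, D x -> (0 <= f x)%E) -> (forall x, A x -> (w%:E <= f x)%E) ->
  (w%:E * mu A <= \int[mu]_(x in D) f x)%E.
Proof.
move=> mD mA AD w0 f0 fA.
rewrite (@ge0_integralE _ _ _ mu _ _ f0).
apply: ereal_sup_ubound => /=.
exists (scale_nnsfun (indic_nnsfun R mA) w0); last first.
  rewrite (_ : sintegral mu _ = sintegral mu (cst w \* indic_nnsfun R mA)%R)//.
  rewrite sintegralrM; congr (_ * _)%E.
  by rewrite (_ : sintegral mu _ = sintegral mu (\1_A : T -> R))// sintegral_indic.
move=> x; rewrite [scale_nnsfun _ _ _](_ : _ = w * \1_A x)// /patch indicE; case: (boolP (x \in A)) => [|xA].
  by rewrite inE => Ax; rewrite mulr1 ifT ?inE; [exact: fA|exact: AD].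
by rewrite mulr0; case: ifP => //; rewrite inE; exact: f0.
Qed.

Section Measure.
Variable R : realType.
Local Notation mu := (@lebesgue_measure R).

Lemma lebesgue_translate (t : R) (A : set R) : measurable A ->
  mu ((fun x => x + t) @^-1` A) = mu A.
Proof.
move=> mA; apply/esym.
have mf : measurable_fun [set: measurableTypeR R] ((fun x => x + t) : measurableTypeR R -> measurableTypeR R).
  apply: continuous_measurable_fun => x; apply: cvgD; [exact: cvg_id|exact: cvg_cst].
pose m : {measure set (measurableTypeR R) -> \bar R} :=
  measure_function_pushforward__canonical__measure_function_Measure mu mf.
rewrite (@lebesgue_measure_unique _ m)//.
move=> X [[a b] _ <-] /=.
rewrite /m /= /pushforward.
have -> : (fun x => x + t) @^-1` `]a, b]%classic = `]a - t, b - t]%classic.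
  apply/seteqP; split=> x /=; rewrite !in_itv/= ltrBlDr lerBrDr//.
rewrite !lebesgue_measure_itv/= !lte_fin ltrD2r.
by case: ifP => // _; rewrite -!EFinD; congr EFin; ring.
Qed.

Lemma lebesgue_le (A B : set R) : measurable A -> measurable B -> A `<=` B -> (mu A <= mu B)%E.
Proof. by move=> mA mB AB; apply: le_measure; rewrite ?inE. Qed.

Lemma lebesgue_leU (A B : set R) : measurable A -> measurable B -> (mu (A `|` B) <= mu A + mu B)%E.
Proof. exact: (measureU2 mu). Qed.

Lemma measurable_translate (t : R) (A : set R) : measurable A -> measurable ((fun x => x + t) @^-1` A).
Proof.
move=> mA; rewrite -[X in measurable X]setTI.
apply: (@continuous_measurable_fun _ (fun x : R => x + t)) => // x.
by apply: cvgD; [exact: cvg_id|exact: cvg_cst].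
Qed.

Let I : set R := `[0%R, 1%R]%classic.

(** Modulo integers t becomes f in [0, 1); the window [f, 1 + f] is cut at 1 and its right piece
    moved back by one period. *)
Lemma periodic_measure_le (A : set R) (t : R) : measurable A ->
  (forall x (p : int), A (x + p%:~R) <-> A x) ->
  (mu ((fun x => (x + t)%R) @^-1` A `&` I) <= mu (A `&` I))%E.
Proof.
move=> mA perA.
set f := t - (Num.floor t)%:~R.
have f0 : 0 <= f by rewrite subr_ge0 Num.Theory.floor_le_tmp.
have f1 : f < 1 by rewrite ltrBlDl -intrD1 Num.Theory.floorD1_gt.
have mi (i : interval R) : measurable (A `&` [set` i]) by apply: measurableI => //; exact: measurable_itv.
have -> : (fun x => x + t) @^-1` A `&` I = (fun x => x + f) @^-1` (A `&` `[f, 1 + f]%classic).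
  apply/seteqP; split=> x /=; rewrite /I /= !in_itv/= lerDr lerD2r.
    move=> [h1 h2]; split=> //; apply/(perA _ (Num.floor t)).
    by rewrite /f -addrA subrK.
  move=> [h1 h2]; split=> //; move/(perA _ (Num.floor t)): h1.
  by rewrite /f -addrA subrK.
rewrite lebesgue_translate//.
have e1 : mu (A `&` `[1, 1 + f]%classic) = mu (A `&` `[0, f]%classic).
  rewrite -(lebesgue_translate (-1) (mi `[0, f]%R)); congr (mu _).
  apply/seteqP; split=> x /=; rewrite !in_itv/= subr_ge0 lerBlDl => -[h1 h2]; split=> //.
    by have := perA x (- 1); rewrite mulrN1z => ->.
  by have := perA x (- 1); rewrite mulrN1z => <-.
(* Dropping the null endpoint f makes the two pieces disjoint. *)
have e2 : (mu (A `&` `[0%R, f]%classic) <= mu (A `&` `[0%R, f[%classic))%E.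
  apply: (@le_trans _ _ (mu ((A `&` `[0, f[%classic) `|` [set f]))).
    apply: le_measure; rewrite ?inE; [exact: mi|apply: measurableU; [exact: mi|exact: measurable_set1]|].
    move=> x [Ax] /=; rewrite in_itv/= => /andP[x0 xf].
    have [->|xnf] := eqVneq x f; [by right|left; split=> //=].
    by rewrite in_itv/= x0 lt_neqAle xnf.
  apply: le_trans (measureU2 mu (mi _) (measurable_set1 _)) _.
  by rewrite [X in (_ + X <= _)%E](_ : _ = 0%E) ?adde0//; exact: lebesgue_measure_set1.
apply: (@le_trans _ _ (mu (A `&` `[f, 1%R[%classic) + mu (A `&` `[1%R, (1 + f)%R]%classic))%E).
  apply: le_trans (measureU2 mu (mi _) (mi _)).
  apply: le_measure; rewrite ?inE; [exact: mi|by apply: measurableU; exact: mi|].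
  move=> x [Ax] /=; rewrite in_itv/= => /andP[x0 xf].
  by case: (ltP x 1) => hx; [left|right]; split=> //=; rewrite in_itv/= ?x0 ?hx.
rewrite e1; apply: (@le_trans _ _ (mu (A `&` `[f, 1%R[%classic) + mu (A `&` `[0%R, f[%classic))%E).
  by rewrite leeD2l.
rewrite -measureU; [|exact: mi|exact: mi|]; last first.
  apply/seteqP; split=> x //= -[[_ h1] [_ h2]]; move: h1 h2; rewrite !in_itv/=.
  by move=> /andP[h1 _] /andP[_ h2]; move: (le_lt_trans h1 h2); rewrite ltxx.
apply: le_measure; rewrite ?inE; [by apply: measurableU; exact: mi|exact: mi|].
move=> x [] [Ax] /=; rewrite !in_itv/= => /andP[h1 h2]; split=> //=; rewrite /I/= in_itv/=.
  by rewrite (le_trans f0 h1) ltW.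
by rewrite h1 ltW// (lt_trans h2).
Qed.

(** The exceptional phases (m - k alpha)/2, with m and k integers, form a countable set. *)
Lemma nonres_ae (alpha : R) :
  {ae mu, forall theta, forall k : int, sin (pi * (2 * theta + k%:~R * alpha)) != 0}.
Proof.
pose Z := [set theta : R | exists k : int, sin (pi * (2 * theta + k%:~R * alpha)) = 0].
have cZ : countable Z.
  pose F (x : int * int) : R := (x.1%:~R - x.2%:~R * alpha) / 2.
  apply: (@sub_countable _ _ _ (F @` setT)); last exact: card_le_trans (card_image_le _ _) (countableP _).
  apply: subset_card_le => th [k /sin_pi_eq0 e].
  exists (Num.floor (2 * th + k%:~R * alpha), k) => //.
  by rewrite /F /= -e addrK mulrC mulKf.
have mZ : measurable Z by exact: countable_measurable.
exists Z; split=> //; first exact: countable_lebesgue_measure0.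
move=> th /= /existsNP[k /negP]; rewrite negbK => /eqP h; by exists k.
Qed.

End Measure.

(** * Uniform threshold and integration *)

Theorem theorem4p1 (R : realType) (lam alpha Gamma : R) :
  1 < lam -> diophantine alpha ->
  ln lam < Gamma -> Gamma <= 2 * ln lam ->
  exists N : nat, forall n : int, (N <= `|n|)%N ->
    forall Phi : R -> nat -> int -> complex R,
      {ae (@lebesgue_measure R), forall theta : R,
          theta \in `[0%R, 1%R] -> eigen_onb lam alpha theta (Phi theta)} ->
      ((expR (- (Gamma * (`|n|%:~R : R))))%:E <=
        (\int[@lebesgue_measure R]_(theta in `[0%R, 1%R]) corr_sum Phi n theta))%E.
Proof.
move=> lam1 dio LG _.
have irr := diophantine_irr dio.
(* [N] has to precede [Phi]. Without any admissible family the claim is vacuous; otherwise one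
   family [Phi0] serves to estimate sets of phases that mention no basis. *)
case: (pselect (exists Phi : R -> nat -> int -> complex R,
   {ae @lebesgue_measure R, forall theta : R, theta \in `[0%R, 1%R] -> eigen_onb lam alpha theta (Phi theta)})); last first.
  by move=> h; exists 0%N => n _ Phi hPhi; exfalso; apply: h; exists Phi.
move=> [Phi0 ae0].
pose G := (ln lam + Gamma) / 2.
have LG1 : ln lam < G by rewrite /G; lra.
have G1G : G < Gamma by rewrite /G; lra.
pose K (n : nat) (m : int) := kgt alpha lam (wt G n) m.
(* The two factors treat the targets n and -n; inside each, the good pair is (0, n) or (1, n + 1).
   For -n the source is the far site, hence translations by n alpha and (n + 1) alpha. *)
pose P (n : nat) : set R := (K n n%:Z `|` (fun x => x + alpha) @^-1` K n n%:Z) `&`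
  ((fun x => x + n%:R * alpha) @^-1` K n (- n%:Z) `|` (fun x => x + n.+1%:R * alpha) @^-1` K n (- n%:Z)).
have mK n m : measurable (K n m) by apply: open_measurable; exact: kgt_open.
have mP n : measurable (P n).
  by apply: measurableI; apply: measurableU => //; exact: measurable_translate.
pose I : set R := `[0%R, 1%R]%classic.
have mI : measurable I by exact: measurable_itv.
have muI : @lebesgue_measure R I = 1%E.
  by rewrite /I lebesgue_measure_itv/= lte_fin ltr01 oppr0 adde0.
pose GN N := I `&` \bigcap_(n in [set n | (N <= n)%N]) P n.
have mGN N : measurable (GN N) by apply: measurableI => //; apply: bigcap_measurableType => n _; exact: mP.
have good theta : eigen_onb lam alpha theta (Phi0 theta) ->
   (forall k : int, sin (pi * (2 * theta + k%:~R * alpha)) != 0) -> exists N, forall n, (N <= n)%N -> P n theta.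
  move=> onb nonres.
  have [s [N hN]] := ekern_lower lam1 irr nonres onb LG1.
  exists N => n hn; have := hN n hn => -[h|h].
    split; [left|left].
      have := kgt_mode onb h; rewrite mulr0z mul0r [theta + 0]addr0.
      by have -> : n%:Z - 0 = n%:Z by lia.
    rewrite ekernC in h; have := kgt_mode onb h; by rewrite sub0r -pmulrn.
  split; [right|right].
    have := kgt_mode onb h; rewrite mulr1z mul1r.
    by have -> : n.+1%:Z - 1 = n%:Z by lia.
  rewrite ekernC in h; have := kgt_mode onb h; rewrite -pmulrn.
  by have -> : 1 - n.+1%:Z = - n%:Z by lia.
(* Otherwise I would be covered by countably many null sets, the resonant phases and the phases
   without eigenbasis. *)
have [N1 hN1] : exists N1, @lebesgue_measure R (GN N1) != 0%E.
  apply/not_existsP => h.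
  have z N : @lebesgue_measure R (GN N) = 0%E by apply/eqP/negPn/negP; exact: h.
  have nI : (@lebesgue_measure R).-negligible I.
    have n1 : (@lebesgue_measure R).-negligible (\bigcup_N GN N).
      by apply: (@negligible_bigcup _ _ _ (@lebesgue_measure R) GN) => N; exists (GN N); split; [exact: mGN|exact: z|].
    have n2 := nonres_ae alpha.
    apply: negligibleS (negligibleU n1 (negligibleU ae0 n2)).
    move=> th Ith; apply: contrapT => /not_orP[h1 /not_orP[h2 h3]].
    have {}h2 := contrapT h2; have {}h3 := contrapT h3.
    have [N hN] := good th (h2 (mem_set Ith)) h3.
    by apply: h1; exists N => //; split.
  have [Y [mY Y0 IY]] := nI.
  have : (@lebesgue_measure R I <= @lebesgue_measure R Y)%E by apply: lebesgue_le.
  by rewrite muI Y0 lee_fin ler10.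
have GNfin : (@lebesgue_measure R (GN N1) \is a fin_num)%E.
  rewrite ge0_fin_numE//; apply: (@le_lt_trans _ _ (@lebesgue_measure R I)); last by rewrite muI ltry.
  by apply: lebesgue_le => //; exact: subIsetl.
pose c := fine (@lebesgue_measure R (GN N1)).
have c0 : 0 < c by rewrite fine_gt0// lt0e hN1 measure_ge0/= -ge0_fin_numE.
(* [GN N1] lies in two translates of K, and by periodicity neither has more measure within one
   period than K itself. *)
have half (n : nat) (m : int) : m = n%:Z \/ m = - n%:Z -> (N1 <= n)%N -> ((c / 2)%:E <= @lebesgue_measure R (K n m `&` I))%E.
  move=> hm hn.
  have [t1 [t2 h]] : exists t1 t2, GN N1 `<=` ((fun x => x + t1) @^-1` K n m `&` I) `|` ((fun x => x + t2) @^-1` K n m `&` I).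
    case: hm => ->.
      exists 0, alpha => x [Ix /(_ n hn) [[h|h] _]]; [left|right]; split=> //=.
      by rewrite addr0.
    by exists (n%:R * alpha), (n.+1%:R * alpha) => x [Ix /(_ n hn) [_ [h|h]]]; [left|right].
  have per x p : K n m (x + p%:~R) <-> K n m x by exact: kgt_period.
  have b : (c%:E <= @lebesgue_measure R (K n m `&` I) + @lebesgue_measure R (K n m `&` I))%E.
    rewrite /c fineK//.
    have mt t : measurable ((fun x => x + t) @^-1` K n m `&` I).
      by apply: measurableI => //; exact: measurable_translate.
    apply: (@le_trans _ _ (@lebesgue_measure R (((fun x => x + t1) @^-1` K n m `&` I) `|` ((fun x => x + t2) @^-1` K n m `&` I)))).
      by apply: lebesgue_le => //; exact: measurableU.
    apply: le_trans (lebesgue_leU _ _) _ => //.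
    by apply: leeD; exact: periodic_measure_le.
  have fin : (@lebesgue_measure R (K n m `&` I) \is a fin_num)%E.
    rewrite ge0_fin_numE//; apply: (@le_lt_trans _ _ (@lebesgue_measure R I)); last by rewrite muI ltry.
    by apply: lebesgue_le => //; exact: measurableI.
  rewrite -(fineK fin) in b *; rewrite -EFinD !lee_fin in b *; lra.
have GG : 0 < Gamma - G by rewrite subr_gt0.
have c20 : 0 < c / 2 by rewrite divr_gt0.
(* From here on e^{-(Gamma - G)|n|} < c/2, which trades the constant for the rate Gamma. *)
have [N2 hN2] := wt_small GG c20.
exists (maxn N1 N2) => n hn Phi hPhi.
pose k := `|n|%N.
have hk1 : (N1 <= k)%N by exact: leq_trans (leq_maxl _ _) hn.
have hk2 : (N2 <= k)%N by exact: leq_trans (leq_maxr _ _) hn.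
have hm : n = k%:Z \/ n = - k%:Z by rewrite /k; lia.
have [X [mX X0 hX]] := hPhi.
(* The null set X contains the phases of I where the given [Phi] is not an eigenbasis. *)
pose A := (K k n `&` I) `\` X.
have mKI : measurable (K k n `&` I) by exact: measurableI.
have mA : measurable A by exact: measurableD.
have muA : (@lebesgue_measure R (K k n `&` I) <= @lebesgue_measure R A)%E.
  apply: (@le_trans _ _ (@lebesgue_measure R (A `|` X))).
    apply: lebesgue_le => //; first exact: measurableU.
    by move=> x Kx; case: (pselect (X x)) => xX; [right|left].
  apply: le_trans (lebesgue_leU _ _) _ => //.
  by rewrite [X in (_ + X <= _)%E](_ : _ = 0%E) ?adde0.
apply: (@le_trans _ _ ((wt G k)%:E * @lebesgue_measure R A)%E).
  apply: (@le_trans _ _ ((wt G k)%:E * (c / 2)%:E)%E); last first.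
    by rewrite lee_wpmul2l ?lee_fin ?expR_ge0// (le_trans (half k n hm hk1)).
  rewrite -EFinM lee_fin.
  have -> : expR (- (Gamma * `|n|%:~R)) = wt G k * wt (Gamma - G) k.
    rewrite /wt -expRD; congr expR.
    have -> : `|n|%:~R = k%:R :> R by rewrite /k natr_absz.
    by ring.
  by rewrite ler_wpM2l ?expR_ge0// ltW// hN2.
apply: integral_lower => //.
- by move=> x [[]].
- exact: expR_ge0.
- by move=> x _; apply: nneseries_ge0 => s _ _; rewrite lee_fin sqrtr_ge0.
- move=> x [[Kx Ix] nX]; apply: kgt_corr Kx.
  apply: contrapT => h; apply: nX; apply: hX => /= h'; apply: h; exact: h' (mem_set Ix).
Qed.
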